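(* Let $n\geq 3$ and let $B_1\subset\mathbf{R}^n$ be the open unit ball centered at the origin. There exists a positive constant $k(n)$, depending only on $n$, such that the following holds. Assume that $\vec b\in L^n(B_1)$ is a vector field $B_1\to\mathbf{R}^n$, that $m>0$ is a constant, and that $u\in H^1(B_1)$ is a weak solution of $$\begin{cases}-\Delta u(x)+\vec b(x)\cdot\nabla u(x)\geq 0 & \text{in } B_1,\\ u(x)\geq m>0 & \text{on }\partial B_1.\end{cases}$$ If $\|\vec b\|_{L^n(B_1)}\leq k(n)$, then $u(x)\geq m$ in $B_1$.
   Context: The inequality $-\Delta u+\vec b\cdot\nabla u\geq0$ in $B_1$ holds in the weak sense if $\int_{B_1}\nabla u\cdot\nabla\varphi\,dx+\int_{B_1}(\vec b\cdot\nabla u)\varphi\,dx\geq 0$ for all nonnegative $\varphi\in C_0^\infty(B_1)$ (equivalently, by density, for all nonnegative $\varphi\in H_0^1(B_1)$). The condition $u\geq m$ on $\partial B_1$ is in the trace sense, i.e. $(u-m)^-=-\min\{u-m,0\}\in H_0^1(B_1)$. The inequality $u\ge m$ in $B_1$ is understood almost everywhere. *)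

(* Defs.v *)
From HB Require Import structures.
From mathcomp Require Import all_boot all_order all_algebra.
From mathcomp Require Import all_classical all_reals all_analysis.

Set Implicit Arguments.
Unset Strict Implicit.
Unset Printing Implicit Defensive.

Import Order.TTheory GRing.Theory Num.Theory.
Import numFieldNormedType.Exports.

Local Open Scope classical_set_scope.
Local Open Scope ring_scope.

(* R^n is 'rV[R]_n.  The library provides its topology (the one induced by the
   sup norm) but no sigma-algebra and no measure: as for n.-tuple T, we take
   the sigma-algebra generated by the coordinates. *)
Section measurable_rV.
Variables (R : realType) (n : nat).

Let coors : 'I_n -> 'rV[R]_n -> measurableTypeR R := fun i x => x ord0 i.

Let rV_set0 : g_sigma_preimage coors set0.
Proof. exact: sigma_algebra0. Qed.

Let rV_setC A : g_sigma_preimage coors A -> g_sigma_preimage coors (~` A).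
Proof. exact: sigma_algebraC. Qed.

Let rV_bigcup (F : (set 'rV[R]_n)^nat) :
  (forall i, g_sigma_preimage coors (F i)) ->
  g_sigma_preimage coors (\bigcup_i (F i)).
Proof. exact: sigma_algebra_bigcup. Qed.

HB.instance Definition _ := @isMeasurable.Build default_measure_display
  'rV[R]_n (g_sigma_preimage coors) rV_set0 rV_setC rV_bigcup.

Lemma measurable_coord (i : 'I_n) :
  measurable_fun [set: 'rV[R]_n]
    (fun x => x ord0 i : measurableTypeR R).
Proof.
move=> _ Y mY; rewrite setTI; apply: sub_sigma_algebra => /=.
rewrite -bigcup_seq/=; exists i => /=; first by rewrite mem_index_enum.
by exists Y => //; rewrite setTI.
Qed.

Lemma measurable_fun_coordP d (T : measurableType d) (f : T -> 'rV[R]_n) :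
  measurable_fun [set: T] f <->
  forall i, measurable_fun [set: T]
    (fun x => f x ord0 i : measurableTypeR R).
Proof.
split=> [mf i|mf].
  exact: (measurableT_comp (measurable_coord i) mf).
move=> _ A mA; rewrite setTI.
have : preimage_set_system [set: T] f (g_sigma_preimage coors) (f @^-1` A).
  by exists A => //; rewrite setTI.
rewrite -g_sigma_preimage_comp.
apply: smallest_sub; first exact: sigma_algebra_measurable.
rewrite -bigcup_seq; apply: bigcup_sub => i _ B [C mC <-].
exact: (mf i).
Qed.

End measurable_rV.

Section lebesgue_rV.
Variable R : realType.

Definition cons_rV n (p : measurableTypeR R * 'rV[R]_n) : 'rV[R]_n.+1 :=
  row_mx (const_mx p.1 : 'rV[R]_1) p.2.

Lemma measurable_cons_rV n : measurable_fun setT (@cons_rV n).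
Proof.
apply/measurable_fun_coordP => i.
rewrite /cons_rV; case: (split_ordP (i : 'I_(1 + n))) => j ->.
  under eq_fun do rewrite (row_mxEl (const_mx _ : 'rV[R]_1)) mxE.
  exact: measurable_fst.
under eq_fun do rewrite (row_mxEr (const_mx _ : 'rV[R]_1)).
exact: (measurableT_comp (measurable_coord j) measurable_snd).
Qed.

Definition uncons_rV n (x : 'rV[R]_n.+1) : measurableTypeR R * 'rV[R]_n :=
  (x ord0 ord0, rsubmx (x : 'rV[R]_(1 + n))).

Lemma cons_rVK n : cancel (@cons_rV n) (@uncons_rV n).
Proof.
move=> [a v]; rewrite /uncons_rV /cons_rV row_mxKr; congr pair.
transitivity (row_mx (const_mx a : 'rV[R]_1) v ord0 (lshift n ord0)).
  by congr (row_mx _ _ _ _); exact/val_inj.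
by rewrite row_mxEl mxE.
Qed.

Lemma cons_rV_lift n (p : measurableTypeR R * 'rV[R]_n) i :
  cons_rV p ord0 (lift ord0 i) = p.2 ord0 i.
Proof.
have : (uncons_rV (cons_rV p)).2 = p.2 by rewrite cons_rVK.
move/(congr1 (fun v : 'rV[R]_n => v ord0 i)); rewrite /uncons_rV /= mxE => <-.
by congr (cons_rV p _ _); exact/val_inj.
Qed.

Lemma measurable_uncons_rV n : measurable_fun setT (@uncons_rV n).
Proof.
apply: measurable_fun_pair; first exact: measurable_coord.
apply/measurable_fun_coordP => i.
under eq_fun do rewrite mxE.
exact: measurable_coord.
Qed.

Section step.
Local Open Scope ereal_scope.
Variables (n : nat) (mu : {sigma_finite_measure set 'rV[R]_n -> \bar R}).

Definition lebesgue_cons : set 'rV[R]_n.+1 -> \bar R :=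
  pushforward (@lebesgue_measure R \x mu) (@cons_rV n).

Let mpre A : measurable A -> measurable (@cons_rV n @^-1` A).
Proof.
by move=> mA; rewrite -[X in measurable X]setTI; exact: measurable_cons_rV.
Qed.

Let lebesgue_cons0 : lebesgue_cons set0 = 0.
Proof. by rewrite /lebesgue_cons /pushforward preimage_set0 measure0. Qed.

Let lebesgue_cons_ge0 A : 0 <= lebesgue_cons A.
Proof. exact: (measure_ge0 (@lebesgue_measure R \x mu)). Qed.

Let lebesgue_cons_sigma_additive : semi_sigma_additive lebesgue_cons.
Proof.
move=> F mF tF mUF; rewrite /lebesgue_cons /pushforward preimage_bigcup.
apply: measure_semi_sigma_additive.
- by move=> k; exact: mpre.
- apply/trivIsetP => /= i j _ _ ij; rewrite -preimage_setI.
  by move/trivIsetP : tF => /(_ _ _ _ _ ij) ->//; rewrite preimage_set0.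
- by rewrite -preimage_bigcup; exact: mpre.
Qed.

HB.instance Definition _ := isMeasure.Build _ _ _ lebesgue_cons
  lebesgue_cons0 lebesgue_cons_ge0 lebesgue_cons_sigma_additive.

Let lebesgue_cons_sigma_finite : sigma_finite setT lebesgue_cons.
Proof.
have /sigma_finiteP[F [TF ndF Foo]] := sigma_finiteT (@lebesgue_measure R).
have /sigma_finiteP[G [TG ndG Goo]] := sigma_finiteT mu.
exists (fun k => @uncons_rV n @^-1` (F k `*` G k)).
  rewrite -preimage_bigcup (_ : \bigcup_i _ = setT) ?preimage_setT//.
  apply/seteqP; split=> // -[x y] _.
  have [i _ Fx] : (\bigcup_i F i) x by rewrite -TF.
  have [j _ Gy] : (\bigcup_i G i) y by rewrite -TG.
  exists (maxn i j) => //; split.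
  - by move: x Fx; exact/subsetPset/ndF/leq_maxl.
  - by move: y Gy; exact/subsetPset/ndG/leq_maxr.
move=> k; have [mF Fk] := Foo k; have [mG Gk] := Goo k; split.
  rewrite -[X in measurable X]setTI; apply: measurable_uncons_rV => //.
  exact: measurableX.
rewrite /lebesgue_cons /pushforward -comp_preimage.
rewrite (_ : _ \o _ = id); last by apply/funext => p; exact: cons_rVK.
by rewrite preimage_id product_measure1E// lte_mul_pinfty// ge0_fin_numE.
Qed.

HB.instance Definition _ := Measure_isSigmaFinite.Build _ _ _ lebesgue_cons
  lebesgue_cons_sigma_finite.

End step.

Fixpoint lebesgue_rV n : {sigma_finite_measure set 'rV[R]_n -> \bar R} :=
  if n is m.+1 then lebesgue_cons (lebesgue_rV m) else \d_(0 : 'rV[R]_0).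

Lemma lebesgue_rV_box n (A : 'I_n -> set (measurableTypeR R)) :
  (forall i, measurable (A i)) ->
  lebesgue_rV n [set x | forall i, A i (x ord0 i)] =
  (\prod_(i < n) (@lebesgue_measure R (A i)))%E.
Proof.
elim: n A => [A _|n IH A mA] /=.
  rewrite big_ord0 diracE; rewrite mem_set//= => -[].
  by case.
rewrite /lebesgue_cons /pushforward big_ord_recl -IH//.
have mB : measurable [set x : 'rV[R]_n | forall i, A (lift ord0 i) (x ord0 i)].
  rewrite (_ : [set _ | _] = \bigcap_(i in [set: 'I_n])
      [set x : 'rV[R]_n | A (lift ord0 i) (x ord0 i)]).
    apply: fin_bigcap_measurable => // i _.
    have := @measurable_coord R n i measurableT _ (mA (lift ord0 i)).
    by rewrite setTI.
  by apply/seteqP; split => x /= h i; [move=> _|]; exact: h.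
rewrite -product_measure1E//; congr (_ _).
apply/seteqP; split => -[a x] /=.
- move=> H; split => /=.
  + have e : cons_rV (a, x) ord0 ord0 = a := congr1 fst (cons_rVK (a,x)).
    by have := H ord0; rewrite e.
  + by move=> i; have := H (lift ord0 i); rewrite cons_rV_lift.
- move=> [h1 h2] i; case: (unliftP ord0 i) => [j ->|->].
  + by rewrite cons_rV_lift.
  + have e : cons_rV (a, x) ord0 ord0 = a := congr1 fst (cons_rVK (a,x)).
    by rewrite e.
Qed.

End lebesgue_rV.

Section euclidean.
Variables (R : realType) (n : nat).
Implicit Types x y : 'rV[R]_n.

Definition dotrV x y : R := \sum_(i < n) x ord0 i * y ord0 i.

Definition enorm x : R := Num.sqrt (dotrV x x).

(* Not [ball 0 1], which is a ball for the sup norm. *)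
Definition unit_ball : set 'rV[R]_n := [set x | enorm x < 1].

End euclidean.

Section calculus.
Variables (R : realType) (n : nat).
Implicit Types f : 'rV[R]_n -> R.

Definition partial i f : 'rV[R]_n -> R := 'D_(delta_mx ord0 i) f.

Definition grad f : 'rV[R]_n -> 'rV[R]_n := fun x => \row_i partial i f x.

Fixpoint Ck (k : nat) f : Prop :=
  continuous f /\
  if k is k'.+1 then
    forall i, (forall x, derivable f x (delta_mx ord0 i)) /\ Ck k' (partial i f)
  else True.

Definition smooth f := forall k, Ck k f.

Definition test_fun (D : set 'rV[R]_n) : set ('rV[R]_n -> R) :=
  [set phi | let supp := closure [set x | phi x != 0] in
     [/\ smooth phi, compact supp & supp `<=` D]].

End calculus.

(* Functions on D are total functions of which only the values on D matter;
   [f \_ D] is f extended by 0 outside D. *)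
Section lebesgue_sobolev.
Variables (R : realType) (n : nat) (D : set 'rV[R]_n).
Local Notation mu := (@lebesgue_rV R n).

Definition Lp (p : R) : set ('rV[R]_n -> R) :=
  [set f | f \_ D \in Lfun mu p%:E].

Definition Lp_norm (p : R) (f : 'rV[R]_n -> R) : \bar R :=
  ('N[mu]_(p%:E) [EFin \o (f \_ D)])%E.

Definition vLp (p : R) : set ('rV[R]_n -> 'rV[R]_n) :=
  [set b | forall i, Lp p (fun x => b x ord0 i)].

Definition vLp_norm (p : R) (b : 'rV[R]_n -> 'rV[R]_n) : \bar R :=
  Lp_norm p (fun x => enorm (b x)).

Definition weak_grad (u : 'rV[R]_n -> R) : set ('rV[R]_n -> 'rV[R]_n) :=
  [set g | forall phi, test_fun D phi -> forall i,
     \int[mu]_(x in D) (u x * partial i phi x) =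
     - \int[mu]_(x in D) (g x ord0 i * phi x)].

Definition H1 : set ('rV[R]_n -> R) :=
  [set u | Lp 2 u /\ exists g, vLp 2 g /\ weak_grad u g].

(* The weak gradient of u in H1 is unique almost everywhere in D;
   [wgrad u] is one representative of it. *)
Definition wgrad (u : 'rV[R]_n -> R) : 'rV[R]_n -> 'rV[R]_n :=
  xget (cst 0) [set g | vLp 2 g /\ weak_grad u g].

Definition H1_norm (u : 'rV[R]_n -> R) : \bar R :=
  ((\int[mu]_(x in D) (u x ^+ 2 + enorm (wgrad u x) ^+ 2)%:E) `^ 2^-1)%E.

Definition H10 : set ('rV[R]_n -> R) :=
  [set u | H1 u /\ forall e : R, 0 < e ->
     exists2 phi, test_fun D phi & (H1_norm (fun x => u x - phi x)%R < e%:E)%E].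

(* Weak form of - Delta u + b . grad u >= 0 in D. *)
Definition weak_supersolution (b : 'rV[R]_n -> 'rV[R]_n) (u : 'rV[R]_n -> R) :=
  forall phi, test_fun D phi -> (forall x, 0 <= phi x) ->
    0 <= \int[mu]_(x in D) dotrV (wgrad u x) (grad phi x)
       + \int[mu]_(x in D) (dotrV (b x) (wgrad u x) * phi x).

(* u >= m on the boundary of D, in the sense of traces: the negative part
   (u - m)^- vanishes there. *)
Definition trace_ge (u : 'rV[R]_n -> R) (m : R) :=
  H10 (fun x => - Num.min (u x - m) 0).

End lebesgue_sobolev.

(* Main.v *)
(* Let w = (u - m)^-, extended as a limit in H^1 of test functions phi_k.  On
   {w > 0} one has grad u = - grad w almost everywhere, because w + u - m vanishes
   there, so testing the inequality with w gives
     E := \int_{w > 0} |grad w|^2 <= \int_{w > 0} |b| |grad w| w.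
   Hölder's inequality with exponents n, 2, 2n/(n-2) and Sobolev's inequality for
   w bound the right-hand side by C |b|_n E.  When C |b|_n < 1 this forces E = 0,
   and w = 0 by Sobolev's inequality again.

   No mollification is needed: the actual test functions are smooth bounded
   truncations of the phi_k, which are nonnegative, and the limit is taken first
   in k and then in the truncation parameter.  Sobolev's inequality is only
   needed for smooth functions, where it follows from Gagliardo's argument. *)

Require Import Defs.
From HB Require Import structures.
From mathcomp Require Import all_boot all_order all_algebra.
From mathcomp Require Import all_classical all_reals all_analysis.
From mathcomp Require Import measurable_realfun ring lra.

Set Implicit Arguments.
Unset Strict Implicit.
Unset Printing Implicit Defensive.

Import Order.TTheory GRing.Theory Num.Theory.
Import numFieldNormedType.Exports.

Local Open Scope classical_set_scope.
Local Open Scope ring_scope.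

(** * Differentiable and smooth functions on R^n *)

(** Why truncate: [dotrV b (wgrad u)] is a product of two square-integrable functions, hence
    integrable and no better, while only the gradients of the phi_k are dominated. Dominated
    convergence for the drift term therefore needs test functions bounded by a constant. In
    [trunc a], the inner [t * expinv 1 (a * t)] is a smooth positive part, and the outer map y |-> a
    (1 - exp (- y / a)) caps it at [a].

    Every tested integrand carries a factor [trunc a w] or [dtrunc a w], which vanishes on w <= 0.
    The energy and the Sobolev bound thus both live on {w > 0}, where grad u = - grad w holds.

    [wgrad] is a representative picked by choice, so every statement about its values rests on
    uniqueness almost everywhere. That is the fundamental lemma of the calculus of variations,
    obtained here from Dynkin's lemma and smooth approximations of indicators.

    Gagliardo's argument yields C = 2 (n - 1) / (n - 2). The threshold k(n) = 1 / (2 C) turns the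
    estimate into E <= E / 2, which forces E = 0 because E is a finite real number. *)

Section line.
Variables (R : realType) (V : normedModType R).
Implicit Types (f : V -> R) (x v : V).

(** The two difference quotients are the same function of [h]. With the converse below, this
    transfers one-variable calculus to directional derivatives. *)
Lemma is_derive_line f x v d (t : R) : is_derive (t *: v + x) v f d ->
  is_derive t 1 (fun s : R => f (s *: v + x)) d.
Proof.
move=> [df dfd].
have E : (fun h : R => h^-1 *: (((fun s : R =>
  f (s *: v + x)) \o shift t) (h *: 1) - f (t *: v + x))) =
  (fun h : R => h^-1 *: ((f \o shift (t *: v + x)) (h *: v) - f (t *: v + x))).
  by apply/funext => h /=; rewrite [h%:A]mulr1 scalerDl addrA.
split; first by rewrite /derivable E.
by rewrite /derive E.
Qed.

Lemma is_derive_of_line f x v d :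
  is_derive (0 : R) 1 (fun s : R => f (s *: v + x)) d -> is_derive x v f d.
Proof.
move=> [df dfd].
have E : (fun h : R => h^-1 *: (((fun s : R =>
  f (s *: v + x)) \o shift 0) (h *: 1) - f (0 *: v + x))) =
  (fun h : R => h^-1 *: ((f \o shift x) (h *: v) - f x)).
  by apply/funext => h /=; rewrite [h%:A]mulr1 addr0 scale0r add0r.
split; first by rewrite /derivable -E.
by rewrite /derive -E.
Qed.

Lemma is_derive_comp1 (h : R -> R) f x v dh d :
  is_derive (f x) 1 h dh -> is_derive x v f d ->
  is_derive x v (fun y => h (f y)) (dh * d).
Proof.
move=> hh hf; apply: is_derive_of_line.
apply: (@is_derive1_comp R h (fun s : R => f (s *: v + x)) 0 dh d).
  by rewrite scale0r add0r.
by apply: is_derive_line; rewrite scale0r add0r.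
Qed.

End line.

Section Ck.
Variables (R : realType) (n : nat).
Implicit Types f g : 'rV[R]_n -> R.
Local Notation dx i := (delta_mx ord0 i : 'rV[R]_n).

Lemma Ck_succ k f (df : 'I_n -> 'rV[R]_n -> R) : continuous f ->
  (forall i x, is_derive x (dx i) f (df i x)) ->
  (forall i, Ck k (df i)) -> Ck k.+1 f.
Proof.
move=> cf hd hk; split=> // i; split=> [x|]; first by have [] := hd i x.
rewrite (_ : partial i f = df i) ?hk//; apply/funext => x.
exact: derive_val.
Qed.

Lemma CkS k f : Ck k.+1 f -> Ck k f.
Proof.
elim: k f => [|k IH] f [cf df]; split => // i.
by have [d1 d2] := df i; split=> //; exact: IH.
Qed.

Lemma Ck_cont k f : Ck k f -> continuous f. Proof. by case: k => [|k] []. Qed.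

Lemma Ck_der k f i x : Ck k.+1 f -> is_derive x (dx i) f (partial i f x).
Proof. by move=> [_ /(_ i)[d _]]; apply: derivableP. Qed.

Lemma Ck_partial k f i : Ck k.+1 f -> Ck k (partial i f).
Proof. by move=> [_ /(_ i)[]]. Qed.

Lemma Ck_cst k c : Ck k (fun _ : 'rV[R]_n => c).
Proof.
elim: k c => [|k IH] c.
  by split=> //; exact: cst_continuous.
apply: (@Ck_succ _ _ (fun _ _ => 0)) => //; first exact: cst_continuous.
Qed.

Lemma is_derive_coord (i j : 'I_n) x :
  is_derive x (dx i) (fun y : 'rV[R]_n => y ord0 j) (j == i)%:R.
Proof.
apply: is_derive_of_line.
have -> : (fun s : R => (s *: dx i + x) ord0 j) = (fun s => s * (j == i)%:R + x ord0 j).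
  by apply/funext => s; rewrite !mxE eqxx.
apply: is_derive_eq; rewrite addr0 /GRing.scale /=.
by rewrite mulr1 ?scaler0 ?mulr0 ?add0r ?addr0.
Qed.

Lemma Ck_coord k j : Ck k (fun x : 'rV[R]_n => x ord0 j).
Proof.
case: k => [|k]; first by split=> //; exact: coord_continuous.
apply: (@Ck_succ _ _ (fun i _ => (j == i)%:R)).
- exact: coord_continuous.
- by move=> i x; exact: is_derive_coord.
- by move=> i; exact: Ck_cst.
Qed.

Lemma CkD k f g : Ck k f -> Ck k g -> Ck k (fun x => f x + g x).
Proof.
elim: k f g => [|k IH] f g Hf Hg.
  by split=> // x; apply: (@continuousD _ _ _ f g);
    [exact: (Ck_cont Hf)|exact: (Ck_cont Hg)].
apply: (@Ck_succ _ _ (fun i x => partial i f x + partial i g x)).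
- move=> x; apply: (@continuousD _ _ _ f g); [exact: (Ck_cont Hf)|exact: (Ck_cont Hg)].
- by move=> i x; apply: is_deriveD; apply: Ck_der; eassumption.
- by move=> i; apply: IH; exact: Ck_partial.
Qed.

Lemma CkM k f g : Ck k f -> Ck k g -> Ck k (fun x => f x * g x).
Proof.
elim: k f g => [|k IH] f g Hf Hg.
  by split=> // x; apply: (@continuousM _ _ f g); [exact: (Ck_cont Hf)|exact: (Ck_cont Hg)].
apply: (@Ck_succ _ _ (fun i x => f x * partial i g x + g x * partial i f x)).
- move=> x; apply: (@continuousM _ _ f g); [exact: (Ck_cont Hf)|exact: (Ck_cont Hg)].
- by move=> i x; apply: is_deriveM; apply: Ck_der; eassumption.
- by move=> i; apply: CkD; apply: IH; (exact: Ck_partial || exact: CkS).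
Qed.

Lemma Ck_sum k (I : Type) (r : seq I) (F : I -> 'rV[R]_n -> R) :
  (forall i, Ck k (F i)) -> Ck k (fun x => \sum_(i <- r) F i x).
Proof.
move=> HF; elim: r => [|a r IH].
  by under eq_fun do rewrite big_nil; exact: Ck_cst.
by under eq_fun do rewrite big_cons; exact: CkD.
Qed.

Lemma Ck_prod k (I : Type) (r : seq I) (F : I -> 'rV[R]_n -> R) :
  (forall i, Ck k (F i)) -> Ck k (fun x => \prod_(i <- r) F i x).
Proof.
move=> HF; elim: r => [|a r IH].
  by under eq_fun do rewrite big_nil; exact: Ck_cst.
by under eq_fun do rewrite big_cons; exact: CkM.
Qed.

End Ck.

(** The whole tower of derivatives is the witness: smoothness is shown by exhibiting it, and the
    derivative is smooth again by shifting the tower. *)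
Definition smooth1 (R : realType) (h : R -> R) := exists2 hs : nat -> R -> R,
  hs 0%N = h & forall k (t : R), is_derive t 1 (hs k) (hs k.+1 t).

Section smooth1.
Variable R : realType.
Implicit Types h : R -> R.

Lemma smooth1_derive h : smooth1 h ->
  (forall t : R, is_derive t 1 h (derive1 h t)) /\ smooth1 (derive1 h).
Proof.
move=> [hs <- H]; have E : derive1 (hs 0%N) = hs 1%N.
  by apply/funext => t; rewrite derive1E; have [_ ->] := H 0%N t.
by rewrite E; split=> //; exists (fun k => hs k.+1).
Qed.

Lemma smooth1_continuous h : smooth1 h -> continuous h.
Proof.
by move=> /smooth1_derive[H _] t; apply/differentiable_continuous/derivable1_diffP;
  case: (H t).
Qed.

Lemma continuous_comp1 n h (f : 'rV[R]_n -> R) :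
  continuous h -> continuous f -> continuous (fun x => h (f x)).
Proof. by move=> ch cf x; apply: continuous_comp; [exact: cf|exact: ch]. Qed.

Lemma Ck_comp n k h (f : 'rV[R]_n -> R) : smooth1 h -> Ck k f -> Ck k (fun x => h (f x)).
Proof.
elim: k h f => [|k IH] h f Hh Hf.
  split=> //; apply: continuous_comp1; first exact: smooth1_continuous.
  exact: (Ck_cont Hf).
have [dh sh] := smooth1_derive Hh.
apply: (@Ck_succ _ _ _ _ (fun i x => derive1 h (f x) * partial i f x)).
- apply: continuous_comp1; first exact: smooth1_continuous.
  exact: (Ck_cont Hf).
- by move=> i x; exact: (is_derive_comp1 (dh _) (Ck_der i x Hf)).
- move=> i; apply: CkM; last exact: Ck_partial Hf.
  by apply: IH => //; exact: CkS.
Qed.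

End smooth1.

(** * Flat functions built from exp (- 1 / t) *)

Section expinv.
Variable R : realType.
Implicit Types (p : {poly R}) (t : R).

(* These functions are stable under derivation, hence smooth;
   [expinv 1] is the flat function t |-> exp (- 1 / t). *)
Definition expinv p t : R := if 0 < t then p.[t^-1] * expR (- t^-1) else 0.

(** A single term of the exponential series is at most [expR s]. *)
Lemma expr_expRN_le k (s : R) : 0 <= s -> s ^+ k * expR (- s) <= k`!%:R.
Proof.
move=> s0; rewrite expRN ler_pdivrMr ?expR_gt0//.
case: k => [|k]; first by rewrite fact0 mul1r expr0 (le_trans _ (expR_ge1Dx s))// lerDl.
have := expR_ge1Dxn k s0.
rewrite -(ler_pM2l (_ : 0 < (k.+1)`!%:R)) ?ltr0n ?fact_gt0//; apply: le_trans.
rewrite mulrDr mulrCA divff ?mulr1 ?lerDr ?mulr1 ?ler0n//.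
Qed.

Lemma poly_expRN_bounded p : exists2 C, 0 < C &
  forall s, 0 <= s -> `|p.[s] * expR (- s)| <= C.
Proof.
exists (1 + \sum_(i < size p) `|p`_i| * i`!%:R).
  by rewrite ltr_pwDl// sumr_ge0// => i _; rewrite mulr_ge0 ?ler0n.
move=> s s0; rewrite horner_coef mulr_suml.
apply: (le_trans (ler_norm_sum _ _ _)).
rewrite -[leLHS]add0r lerD// ler_sum// => i _.
rewrite -mulrA normrM ler_wpM2l// ger0_norm ?expr_expRN_le//.
by rewrite mulr_ge0 ?exprn_ge0// expR_ge0.
Qed.

Lemma expinv_bounded p : exists2 C, 0 < C & forall t, `|expinv p t| <= C.
Proof.
have [C C0 H] := poly_expRN_bounded p; exists C => // t; rewrite /expinv.
case: ifP => [t0|_]; last by rewrite normr0 ltW.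
by rewrite H// invr_ge0 ltW.
Qed.

Lemma expinv_eq0 p t : t <= 0 -> expinv p t = 0.
Proof. by rewrite /expinv; case: ltgtP. Qed.

(** With s = 1 / t one has ds/dt = - s^2, so p(s) exp (- s) has derivative s^2 (p(s) - p'(s)) exp (-
    s). *)
Lemma is_derive_expinv p t :
  is_derive t 1 (expinv p) (expinv ('X^2 * (p - p^`())) t).
Proof.
have [t0|t0|->] := ltgtP t 0.
- rewrite expinv_eq0 ?ltW//.
  apply: (@near_eq_is_derive _ _ _ (cst 0)).
  by near=> x; rewrite /= expinv_eq0// ltW//; near: x; exact: lt_nbhsl.
- apply: (@near_eq_is_derive _ _ _ (fun t => p.[t^-1] * expR (- t^-1))).
  + by near=> x; rewrite /expinv ifT//; near: x; exact: lt_nbhsr.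
  + have dV : is_derive t 1 (fun x : R => x^-1) (- t ^- 2).
      apply: is_derive_eq; first by apply: is_deriveV; rewrite gt_eqF.
      by rewrite [LHS]mulr1.
    have d1 := @is_derive1_comp R (horner p) (fun x : R =>
      x^-1) t _ _ (is_derive_poly p t^-1) dV.
    have dN : is_derive t 1 (fun x : R => - x^-1) (t ^- 2).
      by apply: is_derive_eq; rewrite opprK.
    have d2 := @is_derive1_comp R expR (fun x : R => - x^-1) t _ _ (is_derive_expR _) dN.
    apply: (is_derive_eq (is_deriveM d1 d2)).
    rewrite /expinv t0 /= !hornerE /GRing.scale /= exprVn; ring.
- rewrite expinv_eq0//.
  (* At 0 the difference quotient is [h] times [expinv ('X^2 * p) h], whose second factor is bounded
     by [C]. *)
  have [C C0 H] := expinv_bounded ('X^2 * p).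
  have cv : (fun h : R => h^-1 *: ((expinv p \o shift 0) (h *: 1) - expinv p 0)) @ 0^' -->
    (0 : R).
    apply/cvgrPdist_le => e e0; near=> h.
    rewrite sub0r normrN (expinv_eq0 _ (lexx _)) subr0 /= addr0 [h%:A]mulr1.
    have [h0|h0] := ltP 0 h; last by rewrite expinv_eq0// scaler0 normr0 ltW.
    have := H h; rewrite /expinv h0 !hornerE /= => Hh.
    rewrite [_ *: _](_ : _ = h * (h^-1 ^+ 2 * p.[h^-1] * expR (- h^-1))); last first.
      by rewrite /GRing.scale/= expr2 !mulrA divff ?gt_eqF// mul1r.
    rewrite normrM (le_trans (ler_wpM2l _ Hh))// -ler_pdivlMr//.
    near: h; apply: dnbhs0_le; exact: divr_gt0.
  split; first by apply/cvg_ex; exists 0.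
  exact: cvg_lim.
Unshelve. all: by end_near. Qed.

Lemma smooth1_expinv p : smooth1 (expinv p).
Proof.
exists (fun k => expinv (iter k (fun q => 'X^2 * (q - q^`())) p)) => // k t.
exact: is_derive_expinv.
Qed.

End expinv.

(** * Measurability, test functions and Fubini's theorem *)

Section rV_measurable.
Variables (R : realType) (n : nat).

(** The topology is that of the sup norm, so an open set is the union of the boxes with rational
    centre and radius 1 / (k + 1) that it contains; there are countably many of them. *)
Lemma open_measurable_rV (U : set 'rV[R]_n) : open U -> measurable U.
Proof.
move=> oU.
pose box (p : 'rV[rat]_n * nat) := [set x : 'rV[R]_n |
  forall i, `]ratr (p.1 ord0 i) - p.2.+1%:R^-1, ratr (p.1 ord0 i) + p.2.+1%:R^-1[%classic
    (x ord0 i)].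
have mbox p : measurable (box p).
  rewrite (_ : box p = \bigcap_(i in [set: 'I_n]) [set x : 'rV[R]_n |
     `]ratr (p.1 ord0 i) - p.2.+1%:R^-1, ratr (p.1 ord0 i) + p.2.+1%:R^-1[%classic (x ord0
       i)]).
    apply: fin_bigcap_measurable => // i _.
    have := @measurable_coord R n i measurableT _ (measurable_itv `]ratr (p.1 ord0 i) -
      p.2.+1%:R^-1, ratr (p.1 ord0 i) + p.2.+1%:R^-1[).
    by rewrite setTI.
  by apply/seteqP; split => x /= h i; [move=> _|]; exact: h.
rewrite (_ : U = \bigcup_(p : 'rV[rat]_n * nat) (if `[< box p `<=` U >] then box p else
  set0)).
  apply: countable_bigcupT_measurable => [|p]; first exact: countableP.
  by case: asboolP.
apply/seteqP; split => [x Ux|x [p _]]; last by case: asboolP => // + ?; apply.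
have /nbhs_ballP[e /= e0 eU] : nbhs x U by exact: open_nbhs_nbhs.
(* Factor 2: [x] and any other point of the box are both within 1 / (k + 1) of the centre. *)
have [k ke] : exists k, 2 * k.+1%:R^-1 < e :> R.
  exists (Num.truncn (2 / e)); rewrite -ltr_pdivlMl// invf_plt ?posrE ?divr_gt0 ?mulr_gt0
    ?invr_gt0//.
  by rewrite invrM ?unitfE ?gt_eqF ?invr_gt0// invrK mulrC ?truncnS_gt ?divr_ge0// ?ltW.
have k0 : 0 < k.+1%:R^-1 :> R by rewrite invr_gt0.
have [q qx] : exists q : 'rV[rat]_n, forall i, `|x ord0 i - ratr (q ord0 i)| < k.+1%:R^-1.
  have H i : exists r : rat, `|x ord0 i - ratr r| < k.+1%:R^-1.
    have [|r] := @rat_in_itvoo R (x ord0 i - k.+1%:R^-1) (x ord0 i + k.+1%:R^-1).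
      by rewrite ltrBlDr -addrA ltrDl addr_gt0.
    rewrite in_itv/= => /andP[r1 r2]; exists r; rewrite ltr_norml;
      move: (k.+1%:R^-1) r1 r2 => c r1 r2; apply/andP; split; lra.
  have [q Hq] := choice H.
  by exists (\row_i q i) => i; rewrite mxE.
exists (q, k) => //; case: asboolP => [_ i /=|].
  have := qx i; rewrite in_itv/= ltr_norml; move: (k.+1%:R^-1) => c /andP[? ?].
  by apply/andP; split; lra.
case => y By; apply: eU; split=> // i j /=; rewrite (ord1 i).
apply: le_lt_trans ke.
have := By j; have := qx j; rewrite /= in_itv/= ltr_norml ler_norml.
by move: (k.+1%:R^-1) => c /andP[? ?] /andP[? ?]; apply/andP; split; lra.
Qed.

Lemma continuous_measurable_rV (f : 'rV[R]_n -> R) : continuous f -> measurable_fun setT f.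
Proof.
move=> /continuousP cf; apply: (measurability _ (RGenOInfty.measurableE R)).
move=> _ [_ [a ->] <-]; rewrite setTI; apply: open_measurable_rV.
exact/cf/interval_open.
Qed.

Lemma dotrVxx_ge0 (x : 'rV[R]_n) : 0 <= dotrV x x.
Proof. by apply: sumr_ge0 => i _; rewrite -expr2 sqr_ge0. Qed.

Lemma enorm_ge0 (x : 'rV[R]_n) : 0 <= enorm x. Proof. exact: sqrtr_ge0. Qed.

Lemma enorm_sqr (x : 'rV[R]_n) : enorm x ^+ 2 = dotrV x x.
Proof. by rewrite sqr_sqrtr// dotrVxx_ge0. Qed.

Lemma unit_ballE (x : 'rV[R]_n) : unit_ball x <-> dotrV x x < 1.
Proof.
rewrite /unit_ball /= -enorm_sqr; split=> H.
  by rewrite expr_lt1// enorm_ge0.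
by rewrite -(@expr_lt1 _ 2)// enorm_ge0.
Qed.

Lemma coord_le_enorm (x : 'rV[R]_n) i : `|x ord0 i| <= enorm x.
Proof.
rewrite -(@ler_pXn2r _ 2)// ?nnegrE ?enorm_ge0// enorm_sqr real_normK ?num_real//.
by rewrite /dotrV (bigD1 i)//= -expr2 lerDl sumr_ge0// => j _; rewrite -expr2 sqr_ge0.
Qed.

Lemma Ck_dotrVxx k : Ck k (fun x : 'rV[R]_n => dotrV x x).
Proof. by apply: Ck_sum => i; apply: CkM; exact: Ck_coord. Qed.

Lemma measurable_dotrV d (T : measurableType d) (f g : T -> 'rV[R]_n) A :
  (forall i, measurable_fun A (fun x => f x ord0 i)) ->
  (forall i, measurable_fun A (fun x => g x ord0 i)) ->
  measurable_fun A (fun x => dotrV (f x) (g x)).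
Proof.
move=> mf mg; apply: measurable_sum => i; exact: measurable_funM.
Qed.

Lemma measurable_enorm d (T : measurableType d) (f : T -> 'rV[R]_n) A :
  (forall i, measurable_fun A (fun x => f x ord0 i)) ->
  measurable_fun A (fun x => enorm (f x)).
Proof.
move=> mf; apply: (@measurableT_comp _ _ _ _ _ _ (@Num.sqrt R)).
  by apply: continuous_measurable_fun; exact: sqrt_continuous.
exact: measurable_dotrV.
Qed.

Lemma measurable_unit_ball : measurable (@unit_ball R n).
Proof.
have : measurable_fun setT (fun x : 'rV[R]_n => dotrV x x).
  by apply: continuous_measurable_rV; exact: (Ck_cont (Ck_dotrVxx 0)).
move=> /(_ measurableT _ (measurable_itv `]-oo, 1[)); rewrite setTI.
congr measurable; apply/seteqP; split=> x /=; rewrite in_itv/= => H; exact/unit_ballE.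
Qed.

Lemma unit_ball_fin : (@lebesgue_rV R n (@unit_ball R n) < +oo)%E.
Proof.
pose A (i : 'I_n) : set (measurableTypeR R) := `[-1, 1]%classic.
have mA i : measurable (A i) by exact: measurable_itv.
have := lebesgue_rV_box mA => H.
apply: (@le_lt_trans _ _ (lebesgue_rV R n [set x | forall i, A i (x ord0 i)])).
  apply: le_measure; rewrite ?inE; first exact: measurable_unit_ball.
    rewrite [X in measurable X](_ : _ = \bigcap_(i in [set: 'I_n]) [set x : 'rV[R]_n | A i
      (x ord0 i)]).
      apply: fin_bigcap_measurable => // i _.
      by have := @measurable_coord R n i measurableT _ (mA i); rewrite setTI.
    by apply/seteqP; split => x /= h i; [move=> _|]; exact: h.
  move=> x /= /ltW x1 i; rewrite /A /= in_itv /= -ler_norml.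
  exact: le_trans (coord_le_enorm x i) x1.
(* Finiteness of a product of extended reals is carried through the induction together with
   nonnegativity. *)
rewrite H; apply: (@proj2 (0 <= \prod_(i < n) lebesgue_measure (A i))%E).
elim/big_ind : _ => [|x y [x0 x1] [y0 y1]|i _]; first by rewrite ltry lee01.
  by rewrite mule_ge0// lte_mul_pinfty// ge0_fin_numE.
rewrite measure_ge0; split=> //.
rewrite lebesgue_measure_itv/= lte_fin.
by case: ifP => // _; rewrite -EFinB ltry.
Qed.

End rV_measurable.

(** * Closure properties of test functions *)

Section test_fun.
Variables (R : realType) (n : nat).
Implicit Types (f g phi psi : 'rV[R]_n -> R) (D : set 'rV[R]_n).

Lemma smooth_partial f i : smooth f -> smooth (partial i f).
Proof. by move=> sf k; exact: Ck_partial. Qed.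

Lemma smoothM f g : smooth f -> smooth g -> smooth (fun x => f x * g x).
Proof. by move=> sf sg k; exact: CkM. Qed.

Lemma smooth_der f i x : smooth f -> is_derive x (delta_mx ord0 i) f (partial i f x).
Proof. by move=> sf; apply: (@Ck_der _ _ 0). Qed.

Lemma smooth_cont f : smooth f -> continuous f.
Proof. by move=> /(_ 0%N)/Ck_cont. Qed.

Lemma partialM f g i : smooth f -> smooth g ->
  partial i (fun x => f x * g x) = (fun x => f x * partial i g x + g x * partial i f x).
Proof.
move=> sf sg; apply/funext => x.
have := is_deriveM (smooth_der i x sf) (smooth_der i x sg).
by move=> H; have [_ <-] := H.
Qed.

Lemma test_fun_smooth D phi : test_fun D phi -> smooth phi.
Proof. by case. Qed.

Lemma test_fun_supp D phi x : test_fun D phi -> ~ D x -> phi x = 0.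
Proof.
move=> [_ _ sD] Dx; apply/eqP/negP => /negP px.
by apply/Dx/sD; exact: subset_closure.
Qed.

(** A closed subset of a compact support is compact. Partial derivatives, products and truncations
    of test functions are all recognised as test functions this way. *)
Lemma test_fun_sub D phi g : test_fun D phi -> smooth g ->
  (forall x, g x != 0 -> closure [set x | phi x != 0] x) -> test_fun D g.
Proof.
move=> [sp cp sD] sg gp; have sub : closure [set x | g x != 0] `<=` closure [set x | phi x
  != 0].
  apply: (@subset_trans _ (closure (closure [set x | phi x != 0]))).
    exact: closureS.
  by have /closure_id <- := @closed_closure _ [set x | phi x != 0].
split=> //; last exact: subset_trans sub sD.
apply: subclosed_compact sub => //; exact: closed_closure.
Qed.

(** Off the closed support, [phi] vanishes on a whole neighbourhood, hence so does its derivative at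
    the point. *)
Lemma test_fun_partial D phi i : test_fun D phi -> test_fun D (partial i phi).
Proof.
move=> tp; apply: (test_fun_sub tp); first by apply: smooth_partial; case: tp.
move=> x; apply: contra_neqP => /= nx.
have : \forall y \near x, phi y = 0.
  have /open_nbhs_nbhs : open_nbhs x (~` closure [set x | phi x != 0]).
    by split=> //; exact/closed_openC/closed_closure.
  apply: filterS => y /= ny; apply/eqP/negP => /negP py; apply: ny; exact: subset_closure.
move=> nz; have : is_derive x (delta_mx ord0 i) phi 0.
  apply: (@near_eq_is_derive _ _ _ (cst 0)).
  by apply: filterS nz => y ->.
by case.
Qed.

Lemma test_funMl D f phi : smooth f -> test_fun D phi -> test_fun D (fun x => f x * phi x).
Proof.
move=> sf tp; apply: (test_fun_sub tp); first by apply: smoothM => //; case: tp.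
by move=> x; rewrite mulf_eq0 negb_or => /andP[_ px]; exact: subset_closure.
Qed.

Lemma test_fun_bounded D phi : test_fun D phi -> exists2 C, 0 < C & forall x, `|phi x| <= C.
Proof.
move=> tp; have [sp cp _] := tp.
have : compact (phi @` closure [set x | phi x != 0]).
  by apply: continuous_compact cp; exact/continuous_subspaceT/smooth_cont.
move=> /compact_bounded[M [_ HM]]; exists (`|M| + 1).
  by rewrite ltr_wpDl.
move=> x; have [->|px] := eqVneq (phi x) 0.
  by rewrite normr0 addr_ge0.
apply: (HM (`|M| + 1)); first by rewrite (le_lt_trans (ler_norm _)) ?ltrDl.
by exists x => //; exact: subset_closure.
Qed.

Lemma test_fun_measurable D phi A : test_fun D phi -> measurable_fun A phi.
Proof.
by move=> [sp _ _]; apply: measurable_funTS; apply: continuous_measurable_rV;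
  exact: smooth_cont.
Qed.

End test_fun.

(** * Lines parallel to the axes *)

Section upd.
Variables (R : realType) (n : nat).
Implicit Types (f : 'rV[R]_n -> R) (x : 'rV[R]_n).

(** The line is parametrised by the value of the coordinate and not by an increment, so that an
    integral over [t] does not depend on [x ord0 i]. *)
Definition upd (i : 'I_n) (t : R) (x : 'rV[R]_n) : 'rV[R]_n :=
  \row_j (if j == i then t else x ord0 j).

Lemma updE i t x : upd i t x = (t - x ord0 i) *: delta_mx ord0 i + x.
Proof.
apply/rowP => j; rewrite !mxE eqxx /=; have [->|_] := eqVneq j i.
  by rewrite mulr1 subrK.
by rewrite mulr0 add0r.
Qed.

Lemma upd_id i (x : 'rV[R]_n) : upd i (x ord0 i) x = x.
Proof. by rewrite updE subrr scale0r add0r. Qed.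

Lemma upd_coord i t x : upd i t x ord0 i = t.
Proof. by rewrite mxE eqxx. Qed.

Lemma is_derive_upd f i x (t : R) : smooth f ->
  is_derive t 1 (fun s : R => f (upd i s x)) (partial i f (upd i t x)).
Proof.
move=> sf.
pose x0 := upd i 0 x.
have E s : upd i s x = s *: delta_mx ord0 i + x0.
  apply/rowP => j; rewrite !mxE eqxx /=; case: eqVneq => _; first by rewrite mulr1 addr0.
  by rewrite mulr0 add0r.
rewrite [X in is_derive _ _ X _](_ : _ = fun s => f (s *: delta_mx ord0 i + x0)).
  by apply: is_derive_line; rewrite -E; exact: smooth_der.
by apply/funext => s; rewrite E.
Qed.

Lemma measurable_upd i : measurable_fun setT (fun p : 'rV[R]_n * measurableTypeR R =>
  upd i p.2 p.1).
Proof.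
apply/measurable_fun_coordP => j; under eq_fun do rewrite mxE.
case: eqVneq => _; first exact: measurable_snd.
exact: (measurableT_comp (measurable_coord j) measurable_fst).
Qed.

End upd.

Section fubini_rV.
Variable R : realType.
Local Notation mu := (lebesgue_rV R).
Local Notation lam := (@lebesgue_measure R).
Local Open Scope ereal_scope.

Lemma ge0_integral_cons n (f : 'rV[R]_n.+1 -> \bar R) : measurable_fun setT f ->
  (forall x, 0 <= f x) ->
  \int[mu n.+1]_x f x = \int[lam \x mu n]_p f (cons_rV p).
Proof.
move=> mf f0; have := @ge0_integral_pushforward _ _ _ _ R _ (@measurable_cons_rV R n) (lam
  \x mu n) setT f measurableT mf (fun x _ => f0 x).
by rewrite preimage_setT.
Qed.

Lemma measurable_comp_cons n d (T : measurableType d) (f : 'rV[R]_n.+1 ->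
  T) : measurable_fun setT f ->
  measurable_fun setT (fun p => f (cons_rV p)).
Proof. by move=> mf; exact: (measurableT_comp mf (@measurable_cons_rV R n)). Qed.

Lemma ge0_integral_cons21 n (f : 'rV[R]_n.+1 -> \bar R) : measurable_fun setT f ->
  (forall x, 0 <= f x) ->
  \int[mu n.+1]_x f x = \int[mu n]_y \int[lam]_a f (cons_rV (a, y)).
Proof.
move=> mf f0; rewrite ge0_integral_cons// fubini_tonelli2//.
exact: measurable_comp_cons.
Qed.

Lemma upd_cons0 n t a (y : 'rV[R]_n) : upd ord0 t (cons_rV (a, y)) = cons_rV (t, y).
Proof.
apply/rowP => j; rewrite mxE; case: (unliftP ord0 j) => [k ->|->].
  by rewrite !cons_rV_lift eq_sym (negbTE (neq_lift _ _)).
by rewrite eqxx; have := congr1 fst (cons_rVK (t, y)).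
Qed.

Lemma upd_cons_lift n i t a (y : 'rV[R]_n) :
  upd (lift ord0 i) t (cons_rV (a, y)) = cons_rV (a, upd i t y).
Proof.
apply/rowP => j; rewrite mxE; case: (unliftP ord0 j) => [k ->|->].
  by rewrite !cons_rV_lift/= mxE (inj_eq (@lift_inj _ _)).
rewrite (negbTE (neq_lift _ _)).
have := congr1 fst (cons_rVK (a, y)); have := congr1 fst (cons_rVK (a, upd i t y)).
by rewrite /uncons_rV /= => -> ->.
Qed.

Lemma integrable_cons n (f : 'rV[R]_n.+1 -> \bar R) : (mu n.+1).-integrable setT f ->
  (lam \x mu n).-integrable setT (fun p => f (cons_rV p)).
Proof.
move=> /integrableP[mf fi]; apply/integrableP; split; first exact: measurable_comp_cons.
have := @ge0_integral_cons n (fun x => `|f x|) (measurableT_comp (@abse_measurable _ _) mf)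
  (fun=> abse_ge0 _).
by move=> <-.
Qed.

Lemma integral_cons n (f : 'rV[R]_n.+1 -> \bar R) : (mu n.+1).-integrable setT f ->
  \int[mu n.+1]_x f x = \int[lam \x mu n]_p f (cons_rV p).
Proof.
move=> fi; have mf := measurable_int _ fi.
have := @integral_pushforward _ _ _ _ R _ (@measurable_cons_rV R n) (lam \x mu n) setT f mf.
by rewrite preimage_setT => ->//; exact: integrable_cons.
Qed.

(** Fubini's theorem in the direction [i], which is reached by peeling off the first coordinates one
    at a time. This is the form used for integrating by parts. *)
Lemma integral_line0 n i (f : 'rV[R]_n -> \bar R) : (mu n).-integrable setT f ->
  (forall x, \int[lam]_t f (upd i t x) = 0) -> \int[mu n]_x f x = 0.
Proof.
elim: n i f => [[]//|n IH] i f fi f0.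
rewrite integral_cons//; have fci := integrable_cons fi.
case: (unliftP ord0 i) f0 => [j ->|->] f0.
  rewrite -integral12_prod_meas1//.
  rewrite -[RHS](@integral0 _ _ _ lam setT); apply: ae_eq_integral => //.
    by have := measurable_fubini_F fci.
  (* The slices are integrable for almost every [a] only, which suffices under the outer
     integral. *)
  have := ae_integrable1 fci; apply: filterS => a ai _.
  rewrite /fubini_F (IH j)// => y.
  by rewrite -[RHS](f0 (cons_rV (a, y))); apply: eq_integral => t _; rewrite upd_cons_lift.
rewrite -integral21_prod_meas1// -[RHS](@integral0 _ _ _ (mu n) setT).
apply: eq_integral => y _; rewrite /fubini_G -[RHS](f0 (cons_rV (0%R, y))).
by apply: eq_integral => t _; rewrite upd_cons0.
Qed.

End fubini_rV.

(** * Sobolev's inequality *)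

Section line_integral.
Variable R : realType.
Local Notation lam := (@lebesgue_measure R).
Implicit Types h dh : R -> R.

Lemma is_derive1_continuous h dh : (forall t : R, is_derive t 1 h (dh t)) -> continuous h.
Proof. by move=> H t; apply/differentiable_continuous/derivable1_diffP; case: (H t). Qed.

Lemma integral_derive h dh (a b : R) : a < b -> (forall t : R, is_derive t 1 h (dh t)) ->
  continuous dh -> (\int[lam]_(t in `[a, b]) (dh t)%:E = (h b)%:E - (h a)%:E)%E.
Proof.
move=> ab dhh cdh; have ch := is_derive1_continuous dhh.
apply: continuous_FTC2 => //.
- exact: continuous_subspaceT.
- split=> [x _||]; first by case: (dhh x).
  + by apply: cvg_at_right_filter; exact: ch.
  + by apply: cvg_at_left_filter; exact: ch.
- by move=> x _; rewrite derive1E; case: (dhh x).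
Qed.

Lemma integral_derive_supp h dh : (forall t : R, is_derive t 1 h (dh t)) ->
  continuous dh -> (forall t, 1 <= `|t| -> h t = 0) -> (forall t, 1 <= `|t| -> dh t = 0) ->
  (\int[lam]_t (dh t)%:E = 0)%E.
Proof.
move=> dhh cdh h0 dh0.
have /= := @integral_derive h dh (-1) 1 _ dhh cdh.
rewrite !h0 ?normrN ?normr1// subee// => <-; last by lra.
rewrite [RHS]integral_mkcond; apply: eq_integral => t _; rewrite patchE.
case: ifPn => //; rewrite notin_setE/= in_itv/= => /negP; rewrite -ler_norml -ltNge => /ltW.
by move=> /dh0 ->.
Qed.

(** The absolute value gives continuity on the whole line, 0 included; it is removed wherever the
    argument is nonnegative. *)
Lemma continuous_powR_norm (q : R) : 0 < q -> continuous (fun x : R => `|x| `^ q).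
Proof.
move=> q0 x; have [->|x0] := eqVneq x 0.
  apply/cvgrPdist_lt => e e0.
  have : \forall y \near (0 : R), `|y| < e `^ q^-1 by apply: nbhs0_lt; exact: powR_gt0.
  apply: filterS => y ye.
  rewrite normr0 powR0 ?gt_eqF// sub0r normrN ger0_norm ?powR_ge0//.
  have -> : e = (e `^ q^-1) `^ q by rewrite -powRrM mulVf ?gt_eqF// powRr1// ltW.
  by apply: gt0_ltr_powR; rewrite ?nnegrE ?powR_ge0.
apply: (@continuous_comp _ _ _ (@Num.norm R R) (fun y => y `^ q));
  first exact: norm_continuous.
apply/differentiable_continuous/derivable1_diffP.
by apply: derivable_powR; rewrite in_itv/= andbT normr_gt0.
Qed.

(** The case needing care is [h t = 0]: there the difference quotient of h^g is that of [h] times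
    h^(g - 1), and the last factor tends to 0 since [1 < g]. *)
Lemma is_derive_powR_ge0 h (dh g t : R) : 1 < g -> (forall t, 0 <= h t) ->
  is_derive t 1 h dh -> is_derive t 1 (fun s => h s `^ g) (g * h t `^ (g - 1) * dh).
Proof.
move=> g1 h0 dhh; have [ht|ht] := eqVneq (h t) 0; last first.
  have ht0 : 0 < h t by rewrite lt_neqAle eq_sym ht h0.
  exact: (@is_derive1_comp R (fun x => x `^ g) h t _ _ (is_derive1_powR g ht0) dhh).
have gt0 : 0 < g - 1 by lra.
rewrite ht powR0 ?gt_eqF// mulr0 mul0r.
have ch : {for t, continuous h} by apply/differentiable_continuous/derivable1_diffP;
  case: dhh.
have cp : (fun s : R => `|h (s + t)| `^ (g - 1)) @ 0^' --> (0 : R).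
  have c1 : {for 0, continuous (fun s : R => h (s + t))}.
    apply: (@continuous_comp _ _ _ (fun s => s + t) h); last by rewrite add0r.
    by apply: (@continuousD _ _ _ id (cst t)); [exact: cvg_id|exact: cst_continuous].
  have c2 : {for 0, continuous (fun s : R => `|h (s + t)| `^ (g - 1))}.
    have c3 := @continuous_comp _ _ _ (fun s : R => h (s + t)) (fun x =>
      `|x| `^ (g - 1)) 0 c1 (@continuous_powR_norm (g - 1) gt0 _).
    exact: c3.
  have := @cvg_within_filter _ _ _ _ _ _ [set x | x != 0] c2.
  rewrite /= add0r ht normr0 powR0 ?gt_eqF//; exact.
have cd : (fun s : R => s^-1 *: ((h \o shift t) (s *: 1) - h t)) @ 0^' --> dh.
  by have [+ <-] := dhh.
have cv : (fun s : R => s^-1 *: (((fun s =>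
  h s `^ g) \o shift t) (s *: 1) - h t `^ g)) @ 0^' --> (0 : R).
  have := cvgM cd cp; rewrite mulr0. move=> cm.
  apply: cvg_trans (cm _); apply: near_eq_cvg; near=> s => /=.
  rewrite ht powR0 ?gt_eqF ?(lt_trans ltr01)// !subr0 [s%:A]mulr1 ger0_norm//.
  by rewrite -scalerAl mulr_powRB1// (lt_trans ltr01).
split; first by apply/cvg_ex; exists 0.
exact: cvg_lim.
Unshelve. all: by end_near. Qed.

(** The fundamental theorem of calculus from -1, where [h] vanishes, to [s]. Extending the integral
    to the whole line makes the bound independent of [s], as Gagliardo's argument requires. *)
Lemma powR_le_integral_derive h dh (g s : R) : 1 < g -> (forall t, 0 <= h t) ->
  (forall t : R, is_derive t 1 h (dh t)) -> continuous dh -> (forall t, 1 <= `|t| ->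
    h t = 0) ->
  ((h s `^ g)%:E <= \int[lam]_t (g * h t `^ (g - 1) * `|dh t|)%:E)%E.
Proof.
move=> g1 h0 dhh cdh hs; have ch := is_derive1_continuous dhh.
have i0 t : 0 <= g * h t `^ (g - 1) * `|dh t| by rewrite !mulr_ge0 ?powR_ge0//; lra.
have [s1|s1] := leP s (-1).
  rewrite hs; last by rewrite ler_normr; apply/orP; right; lra.
  by rewrite powR0 ?integral_ge0// => [t _|]; rewrite ?lee_fin// gt_eqF//; lra.
have cph : continuous (fun t => h t `^ (g - 1)).
  rewrite (_ : (fun _ => _) = (fun x => `|x| `^ (g - 1)) \o h).
    by move=> t; apply: continuous_comp; [exact: ch|apply: continuous_powR_norm; lra].
  by apply/funext => r /=; rewrite ger0_norm.
have c1 : continuous (fun t => g * h t `^ (g - 1)).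
  by move=> t; apply: (@continuousM _ _ (fun _ => g) (fun t => h t `^ (g - 1)));
    [exact: cst_continuous|exact: cph].
have c2 : continuous (fun t => g * h t `^ (g - 1) * dh t).
  by move=> t; apply: (@continuousM _ _ (fun t => g * h t `^ (g - 1)) dh);
    [exact: c1|exact: cdh].
have c3 : continuous (fun t => g * h t `^ (g - 1) * `|dh t|).
  move=> t; apply: (@continuousM _ _ (fun t => g * h t `^ (g - 1)) (fun t => `|dh t|));
    first exact: c1.
  by apply: continuous_comp; [exact: cdh|exact: norm_continuous].
have := @integral_derive _ _ (-1) s s1 (fun t => is_derive_powR_ge0 g1 h0 (dhh t)) c2.
rewrite (hs (-1)) ?normrN ?normr1// powR0 ?sube0; last by rewrite gt_eqF//; lra.
move=> <-.
have m2 A : measurable_fun A (fun t => (g * h t `^ (g - 1) * dh t)%:E).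
  by apply/measurable_EFinP/measurable_funTS; exact: continuous_measurable_fun.
have m3 A : measurable_fun A (fun t => (g * h t `^ (g - 1) * `|dh t|)%:E).
  by apply/measurable_EFinP/measurable_funTS; exact: continuous_measurable_fun.
apply: (@le_trans _ _ (\int[lam]_(t in `[(-1)%R, s]) (g * h t `^ (g - 1) * `|dh t|)%:E)%E).
  apply: le_integral => //.
  - by apply: continuous_compact_integrable;
      [exact: segment_compact|exact: continuous_subspaceT].
  - by apply: continuous_compact_integrable;
      [exact: segment_compact|exact: continuous_subspaceT].
  - move=> t _; rewrite lee_fin ler_wpM2l ?ler_norm// mulr_ge0 ?powR_ge0//; lra.
have := @ge0_subset_integral _ _ _ lam `[(-1)%R, s]%classic setT (measurable_itv _)
  measurableT _ (m3 setT).
by apply => // t _; rewrite lee_fin.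
Qed.

End line_integral.

(** * Hölder's inequality for extended-real functions and finite products *)

Section holder.
Context d (T : measurableType d) (R : realType) (mu : {measure set T -> \bar R}).
Local Open Scope ereal_scope.

(** Young's inequality for the normalised quantities a / A and b / B, scaled back. *)
Lemma young_powR (a b A B th : R) : (0 < th < 1 -> 0 < A -> 0 < B -> 0 <= a -> 0 <= b ->
  a `^ (1 - th) * b `^ th <= A `^ (1 - th) * B `^ th * ((1 - th) / A * a + th / B * b))%R.
Proof.
move=> /andP[th0 th1] A0 B0 a0 b0; have th1' : (0 < 1 - th)%R by lra.
have aE : (a = A * (a / A))%R by rewrite mulrCA divff ?mulr1// gt_eqF.
have bE : (b = B * (b / B))%R by rewrite mulrCA divff ?mulr1// gt_eqF.
have x0 : (0 <= a / A)%R by rewrite divr_ge0// ltW.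
have y0 : (0 <= b / B)%R by rewrite divr_ge0// ltW.
have := @conjugate_powR R (((a / A) `^ (1 - th))%R) (((b / B) `^ th)%R) ((1 - th)^-1)%R
  (th^-1)%R (powR_ge0 _ _) (powR_ge0 _ _).
rewrite !invr_gt0 !invrK subrK -!powRrM !divff ?gt_eqF// !powRr1// => /(_ th1' th0 erefl) H.
rewrite [X in (X `^ _ * _)%R]aE [X in (_ * X `^ _)%R]bE (powRM _ (ltW A0) x0) (powRM _ (ltW
  B0) y0).
rewrite [leLHS](_ : _ = A `^ (1 - th) * B `^ th * ((a / A) `^ (1 - th) * (b / B) `^ th))%R;
  last by ring.
rewrite ler_wpM2l ?mulr_ge0 ?powR_ge0// (le_trans H)//.
by rewrite le_eqVlt; apply/orP; left; apply/eqP; ring.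
Qed.

(** Integrate [young_powR] with [A] and [B] the two integrals: the bracket integrates to (1 - th) +
    th = 1. Extended-real values are allowed because line integrals may be infinite. *)
Lemma holder_poweR (f g : T -> \bar R) (th : R) : (0 < th < 1)%R ->
  measurable_fun setT f -> measurable_fun setT g ->
  (forall x, 0 <= f x) -> (forall x, 0 <= g x) ->
  \int[mu]_x (f x `^ (1 - th) * g x `^ th) <=
  (\int[mu]_x f x) `^ (1 - th) * (\int[mu]_x g x) `^ th.
Proof.
move=> /[dup] th01 /andP[th0 th1] mf mg f0 g0; have th1' : (0 < 1 - th)%R by lra.
have mfg : measurable_fun setT (fun x => f x `^ (1 - th) * g x `^ th).
  by apply: emeasurable_funM; exact: (measurableT_comp (measurable_poweR _)).
have F0 : 0 <= \int[mu]_x f x by exact: integral_ge0.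
have G0 : 0 <= \int[mu]_x g x by exact: integral_ge0.
(* Integrals equal to 0 or to [+oo] cannot normalise; they are settled first. A null integral makes
   the function, hence the product, vanish almost everywhere. *)
have [fz|fz] := eqVneq (\int[mu]_x f x) 0.
  rewrite [leLHS](_ : _ = 0); first by rewrite mule_ge0// poweR_ge0.
  rewrite -[RHS](@integral0 _ _ _ mu setT); apply: ae_eq_integral => //.
  have : ae_eq mu setT f (cst 0).
    by apply/ae_eq_integral_abs => //; under eq_integral do rewrite gee0_abs//.
  by apply: filterS => x /= fx _; rewrite fx// poweR0r ?mul0e// gt_eqF.
have [gz|gz] := eqVneq (\int[mu]_x g x) 0.
  rewrite [leLHS](_ : _ = 0); first by rewrite mule_ge0// poweR_ge0.
  rewrite -[RHS](@integral0 _ _ _ mu setT); apply: ae_eq_integral => //.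
  have : ae_eq mu setT g (cst 0).
    by apply/ae_eq_integral_abs => //; under eq_integral do rewrite gee0_abs//.
  by apply: filterS => x /= gx _; rewrite gx// poweR0r ?mule0// gt_eqF.
have Fp : 0 < \int[mu]_x f x by rewrite lt_neqAle eq_sym fz.
have Gp : 0 < \int[mu]_x g x by rewrite lt_neqAle eq_sym gz.
have [fy|fy] := eqVneq (\int[mu]_x f x) +oo.
  by rewrite fy poweRyr ?gt_eqF// gt0_mulye ?leey// poweR_gt0.
have [gy|gy] := eqVneq (\int[mu]_x g x) +oo.
  by rewrite gy poweRyr ?gt_eqF// gt0_muley ?leey// poweR_gt0.
have Ff : \int[mu]_x f x \is a fin_num by rewrite ge0_fin_numE// ltey.
have Gf : \int[mu]_x g x \is a fin_num by rewrite ge0_fin_numE// ltey.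
set A := fine (\int[mu]_x f x); set B := fine (\int[mu]_x g x).
have A0 : (0 < A)%R by rewrite fine_gt0// Fp ltey.
have B0 : (0 < B)%R by rewrite fine_gt0// Gp ltey.
rewrite -(fineK Ff) -(fineK Gf) -/A -/B !poweR_EFin -EFinM.
have p1 : (0 < (1 - th) / A)%R by rewrite divr_gt0.
have p2 : (0 < th / B)%R by rewrite divr_gt0.
have p3 : (0 < A `^ (1 - th) * B `^ th)%R by rewrite mulr_gt0 ?powR_gt0.
have yg x : f x `^ (1 - th) * g x `^ th <= (A `^ (1 - th) * B `^ th)%:E *
    (((1 - th) / A)%:E * f x + (th / B)%:E * g x).
  move: (f0 x) (g0 x); case: (f x) => [a||]//; last first.
    move=> _ b0; rewrite [X in _ <= _ * (X + _)]gt0_muley ?lte_fin// addye ?gt0_muley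
      ?lte_fin ?leey//.
    by rewrite -ltNye (@lt_le_trans _ _ 0)// mule_ge0// lee_fin ltW.
  case: (g x) => [b||]//; last first.
    by move=> _ _; rewrite [X in _ <= _ * (_ + X)]gt0_muley ?lte_fin// addey// gt0_muley
      ?lte_fin ?leey.
  by rewrite !lee_fin => a0 b0; exact: young_powR.
apply: (@le_trans _ _ (\int[mu]_x ((A `^ (1 - th) * B `^ th)%:E * (((1 - th) / A)%:E * f x
  + (th / B)%:E * g x)))).
  apply: ge0_le_integral => //.
  - by move=> x _; rewrite mule_ge0 ?poweR_ge0.
  - by apply: measurable_funeM; apply: emeasurable_funD; exact: measurable_funeM.
rewrite ge0_integralZl//; last 3 first.
- by apply: emeasurable_funD; exact: measurable_funeM.
- by move=> x _; rewrite adde_ge0// mule_ge0// lee_fin ltW.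
- by rewrite lee_fin ltW.
rewrite ge0_integralD//; last 4 first.
- by move=> x _; rewrite mule_ge0// lee_fin ltW.
- exact: measurable_funeM.
- by move=> x _; rewrite mule_ge0// lee_fin ltW.
- exact: measurable_funeM.
rewrite !ge0_integralZl ?lee_fin ?(ltW p1) ?(ltW p2)//.
rewrite -(fineK Ff) -(fineK Gf) -/A -/B lee_fin.
by rewrite !divfK ?gt_eqF// subrK mulr1.
Qed.

Lemma poweR_prod n (F : 'I_n -> \bar R) r : (forall i, 0 <= F i) ->
  (\prod_(i < n) F i) `^ r = \prod_(i < n) F i `^ r.
Proof.
elim: n F => [|n IH] F F0; first by rewrite !big_ord0 poweR1r.
by rewrite !big_ord_recl poweRM// ?IH// prode_ge0.
Qed.

Lemma emeasurable_prod n (F : 'I_n -> T -> \bar R) A : (forall i, measurable_fun A (F i)) ->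
  measurable_fun A (fun x => \prod_(i < n) F i x).
Proof.
elim: n F => [|n IH] F mF; first by under eq_fun do rewrite big_ord0; exact: measurable_cst.
by under eq_fun do rewrite big_ord_recl; apply: emeasurable_funM => //; exact: IH.
Qed.

(** Induction on the number of factors: [holder_poweR] splits off the first one with exponent [p],
    and the other exponents are divided by q = 1 - p, so that they sum to 1 again. *)
Lemma holder_prod n (f : T -> \bar R) (g : 'I_n -> T -> \bar R) (s p : R) :
  (0 <= s)%R -> (0 <= p)%R -> (s + p * n%:R = 1)%R ->
  measurable_fun setT f -> (forall i, measurable_fun setT (g i)) ->
  (forall x, 0 <= f x) -> (forall i x, 0 <= g i x) ->
  \int[mu]_x (f x `^ s * \prod_(i < n) g i x `^ p) <=
  (\int[mu]_x f x) `^ s * \prod_(i < n) (\int[mu]_x g i x) `^ p.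
Proof.
elim: n g s p => [|n IH] g s p s0 p0 spn mf mg f0 g0.
  have -> : s = 1%R by lra.
  rewrite big_ord0 mule1 poweRe1 ?integral_ge0//.
  by under eq_integral do rewrite big_ord0 mule1 poweRe1//.
have [pz|pz] := eqVneq p 0%R.
  have -> : s = 1%R by move: spn; rewrite pz mul0r addr0.
  rewrite pz big1 ?mule1 ?poweRe1 ?integral_ge0//; last by move=> i _; rewrite poweRe0.
  rewrite le_eqVlt; apply/orP; left; apply/eqP; apply: eq_integral => x _.
  by rewrite big1 ?mule1 ?poweRe1// => i _; rewrite poweRe0.
have pp : (0 < p)%R by rewrite lt_neqAle eq_sym pz.
have n1 : (p * n.+1%:R = p + p * n%:R)%R by rewrite -natr1 mulrDr mulr1 addrC.
have pn0 : (0 <= p * n%:R)%R by rewrite mulr_ge0.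
(* Here q would be 0; but p = 1 leaves room for a single factor, with s = 0. *)
have [p1|p1] := eqVneq p 1%R.
  have nz : n = 0%N.
    apply/eqP; rewrite -(eqr_nat R); apply/eqP.
    by move: n1 spn pn0; rewrite p1 !mul1r; lra.
  have sz : s = 0%R by move: spn; rewrite p1 nz; lra.
  rewrite p1 sz poweRe0 mul1e; move: {IH spn n1 pn0} g mg g0; rewrite nz => g mg g0.
  rewrite big_ord_recl big_ord0 mule1 poweRe1 ?integral_ge0//.
  by under eq_integral do rewrite poweRe0 mul1e big_ord_recl big_ord0 mule1 poweRe1//.
have pl1 : (p < 1)%R by rewrite lt_neqAle p1/=; lra.
have q0 : (0 < 1 - p)%R by lra.
set q := (1 - p)%R.
have m1 : measurable_fun setT (fun x => f x `^ (s / q) * \prod_(i < n) g (lift ord0 i) x `^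
  (p / q)).
  apply: emeasurable_funM; first exact: (measurableT_comp (measurable_poweR _)).
  by apply: emeasurable_prod => i; exact: (measurableT_comp (measurable_poweR _)).
have n1' x : 0 <= f x `^ (s / q) * \prod_(i < n) g (lift ord0 i) x `^ (p / q).
  by rewrite mule_ge0 ?poweR_ge0// prode_ge0// => i _; exact: poweR_ge0.
have := @holder_poweR (fun x => f x `^ (s / q) * \prod_(i < n) g (lift ord0 i) x `^ (p / q))
  (g ord0) p _ m1 (mg _) n1' (g0 _).
rewrite pp pl1 => /(_ isT).
have E1 : \int[mu]_x (f x `^ s * \prod_(i < n.+1) g i x `^ p) =
  \int[mu]_x ((f x `^ (s / q) * \prod_(i < n) g (lift ord0 i) x `^ (p / q)) `^ (1 - p) * g
    ord0 x `^ p).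
  apply: eq_integral => x _; rewrite poweRM ?poweR_ge0//;
    last by rewrite prode_ge0// => i _; exact: poweR_ge0.
  rewrite -poweRrM divfK ?gt_eqF// poweR_prod; last by move=> i; exact: poweR_ge0.
  rewrite big_ord_recl -muleA; congr (_ * _); rewrite muleC; congr (_ * _).
  by apply: eq_bigr => i _; rewrite -poweRrM divfK// gt_eqF.
rewrite -E1 => /le_trans; apply.
rewrite big_ord_recl [leRHS](_ : _ = ((\int[mu]_x f x) `^ (s / q) *
    \prod_(i < n) (\int[mu]_x g (lift ord0 i) x) `^ (p / q)) `^ q * (\int[mu]_x g ord0 x)
      `^ p); last first.
  rewrite poweRM ?poweR_ge0//; last by rewrite prode_ge0// => i _; exact: poweR_ge0.
  rewrite -poweRrM divfK ?gt_eqF// poweR_prod; last by move=> i; exact: poweR_ge0.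
  rewrite -muleA; congr (_ * _); rewrite muleC; congr (_ * _).
  by apply: eq_bigr => i _; rewrite -poweRrM divfK// gt_eqF.
rewrite lee_wpmul2r ?poweR_ge0// gt0_ler_poweR ?(ltW q0)//.
- by rewrite in_itv/= leey integral_ge0.
- by rewrite in_itv/= leey mule_ge0 ?poweR_ge0// prode_ge0// => i _; exact: poweR_ge0.
apply: IH => //; rewrite ?divr_ge0 ?(ltW q0)//.
by rewrite mulrAC -mulrDl (_ : s + p * n%:R = q)%R ?divff ?gt_eqF// /q; lra.
Qed.

End holder.

(** * Gagliardo's inequality for line integrals *)

Section gagliardo.
Variable R : realType.
Local Notation mu := (lebesgue_rV R).
Local Notation lam := (@lebesgue_measure R).
Local Open Scope ereal_scope.

(** Kept as a function of the full vector, constant in its coordinate [i], so that marginals in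
    different directions can be multiplied. *)
Definition marginal n (i : 'I_n) (f : 'rV[R]_n -> \bar R) (x : 'rV[R]_n) : \bar R :=
  \int[lam]_t f (upd i t x).

Lemma marginal_ge0 n i (f : 'rV[R]_n -> \bar R) x : (forall x, 0 <= f x) ->
  0 <= marginal i f x.
Proof. by move=> f0; exact: integral_ge0. Qed.

Lemma measurable_marginal n (i : 'I_n) (f : 'rV[R]_n -> \bar R) : measurable_fun setT f ->
  (forall x, 0 <= f x) -> measurable_fun setT (marginal i f).
Proof.
move=> mf f0.
have := @measurable_fun_fubini_tonelli_F _ _ _ _ R lam (fun p => f (upd i p.2 p.1)).
by apply => //; exact: (measurableT_comp mf (measurable_upd i)).
Qed.

Lemma poweRDge0 (x : \bar R) (r s : R) : (0 <= r)%R -> (0 <= s)%R ->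
  x `^ (r + s) = x `^ r * x `^ s.
Proof.
move=> r0 s0; have [->|x0] := eqVneq x 0; last by rewrite poweRD// nneg_neq0_poweRD_def.
have [->|r1] := eqVneq r 0%R; first by rewrite add0r poweRe0 mul1e.
have rs : (r + s != 0)%R by rewrite gt_eqF// ltr_pwDl// lt_neqAle eq_sym r1.
by rewrite (poweR0r rs) (poweR0r r1) mul0e.
Qed.

Lemma measurable_cons_slice n y : measurable_fun setT (fun a : measurableTypeR R =>
  cons_rV (a, y : 'rV[R]_n)).
Proof. exact: (measurableT_comp (@measurable_cons_rV R n) (pair2_measurable y)). Qed.

(* Induction on n: Hölder's inequality in the first coordinate, then the
   induction hypothesis for the marginal in that coordinate.  The factor
   f ^ s is what allows p to stay the same from one dimension to the next. *)
Lemma gridlines n (f : 'rV[R]_n -> \bar R) (s p : R) : (0 <= s)%R -> (0 <= p)%R ->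
  (s + p * n%:R = 1 + p)%R -> measurable_fun setT f -> (forall x, 0 <= f x) ->
  \int[mu n]_x (f x `^ s * \prod_(i < n) marginal i f x `^ p) <=
  (\int[mu n]_x f x) `^ (1 + p).
Proof.
elim: n f s => [|n IH] f s s0 p0 sp mf f0.
  have -> : s = (1 + p)%R by move: sp; rewrite mulr0 addr0.
  rewrite /= !integral_dirac//; last first.
  - apply: emeasurable_funM; first exact: (measurableT_comp (measurable_poweR _)).
    by apply: emeasurable_prod => -[].
  by rewrite diracT !mul1e big_ord0 mule1.
(* These are the exponents of Hölder's inequality in the first coordinate: [s] for [f], and [p] for
   each of the [n] other marginals. *)
have sp1 : (s + p * n%:R = 1)%R by move: sp; rewrite -natr1 mulrDr mulr1; lra.
have mM i : measurable_fun setT (fun x => marginal i f x `^ p).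
  by apply: (measurableT_comp (measurable_poweR _)); exact: measurable_marginal.
pose F y := \int[lam]_a f (cons_rV (a, y)).
have F0 y : 0 <= F y by exact: integral_ge0.
have mF : measurable_fun setT F.
  have := @measurable_fun_fubini_tonelli_G _ _ _ _ R lam (fun p => f (cons_rV p)).
  by apply => //; exact: measurable_comp_cons.
rewrite ge0_integral_cons21//; last 2 first.
- apply: emeasurable_funM; first exact: (measurableT_comp (measurable_poweR _)).
  exact: emeasurable_prod.
- by move=> x; rewrite mule_ge0 ?poweR_ge0// prode_ge0// => i _; exact: poweR_ge0.
rewrite (ge0_integral_cons21 mf f0) -/F.
(* One dimension lower the exponent of the function is [s + p], since (s + p) + p n = 1 + p. *)
apply: le_trans (IH F (s + p)%R _ _ _ mF F0); rewrite ?addr_ge0//;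
  last by rewrite addrAC sp1.
(* The marginal in the first coordinate is [F y], independent of [a], and leaves the integral. *)
have E y : \int[lam]_a (f (cons_rV (a, y)) `^ s * \prod_(i < n.+1) marginal i f (cons_rV
  (a, y)) `^ p) =
  F y `^ p * \int[lam]_a (f (cons_rV (a, y)) `^ s *
     \prod_(i < n) marginal (lift ord0 i) f (cons_rV (a, y)) `^ p).
  rewrite -ge0_integralZl//; last 3 first.
  - apply: emeasurable_funM.
      apply: (measurableT_comp (measurable_poweR _)).
      exact: (measurableT_comp mf (measurable_cons_slice y)).
    apply: emeasurable_prod => i.
    exact: (measurableT_comp (mM _) (measurable_cons_slice y)).
  - by move=> x _; rewrite mule_ge0 ?poweR_ge0// prode_ge0// => i _; exact: poweR_ge0.
  - exact: poweR_ge0.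
  apply: eq_integral => a _; rewrite big_ord_recl muleCA; congr (_ * (_ * _)).
  by congr (_ `^ _); apply: eq_integral => t _; rewrite upd_cons0.
(* Tonelli's theorem: integrating out the first coordinate commutes with the other marginals. *)
have E2 i y : \int[lam]_a marginal (lift ord0 i) f (cons_rV (a, y)) = marginal i F y.
  rewrite /marginal /F.
  transitivity (\int[lam]_a \int[lam]_t f (cons_rV (a, upd i t y))).
    by apply: eq_integral => a _; apply: eq_integral => t _; rewrite upd_cons_lift.
  apply: (@fubini_tonelli _ _ _ _ R lam lam (fun p => f (cons_rV (p.1, upd i p.2 y)))) =>
    //.
  apply: (measurableT_comp mf); apply: (measurableT_comp (@measurable_cons_rV R n)).
  apply: measurable_fun_pair; first exact: measurable_fst.
  exact: (measurableT_comp (measurable_upd i) (measurable_fun_pair (measurable_cst y)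
    measurable_snd)).
have mFM i : measurable_fun setT (fun x => marginal i F x `^ p).
  by apply: (measurableT_comp (measurable_poweR _)); exact: measurable_marginal.
apply: ge0_le_integral => //.
- move=> y _; apply: integral_ge0 => a _.
  by rewrite mule_ge0 ?poweR_ge0// prode_ge0// => i _; exact: poweR_ge0.
- have := @measurable_fun_fubini_tonelli_G _ _ _ _ R lam (fun q : measurableTypeR R *
    'rV[R]_n => f (cons_rV q) `^ s * \prod_(i < n.+1) marginal i f (cons_rV q) `^ p).
  apply => //.
    apply: emeasurable_funM.
      apply: (measurableT_comp (measurable_poweR _)).
      exact: (measurable_comp_cons mf).
    apply: emeasurable_prod => i.
    exact: (measurable_comp_cons (mM _)).
  by move=> x; rewrite mule_ge0 ?poweR_ge0// prode_ge0// => i _; exact: poweR_ge0.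
- apply: emeasurable_funM; first exact: (measurableT_comp (measurable_poweR _)).
  exact: emeasurable_prod.
move=> y _; rewrite E.
rewrite addrC poweRDge0// -muleA lee_wpmul2l ?poweR_ge0//.
under eq_bigr do rewrite -E2.
apply: holder_prod => //.
- exact: (measurableT_comp mf (measurable_cons_slice y)).
- move=> i; exact: (measurableT_comp (measurable_marginal _ mf f0) (measurable_cons_slice
    y)).
- by move=> i a; exact: marginal_ge0.
Qed.

End gagliardo.

Section bounded_integrable.
Variables (R : realType) (n : nat).
Local Notation D := (@unit_ball R n).
Local Notation mu := (lebesgue_rV R n).

Lemma bounded_integrable (f : 'rV[R]_n -> R) C : measurable_fun setT f ->
  (forall x, `|f x| <= C) -> mu.-integrable D (EFin \o f).
Proof.
move=> mf fC; apply: measurable_bounded_integrable.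
- exact: measurable_unit_ball.
- exact: unit_ball_fin.
- exact: measurable_funTS.
- exists C; split; first exact: num_real.
  by move=> y Cy x _ /=; rewrite (le_trans (fC x))// ltW.
Qed.

Lemma integral_supp (f : 'rV[R]_n -> \bar R) : (forall x, ~ D x -> f x = 0%E) ->
  (\int[mu]_x f x = \int[mu]_(x in D) f x)%E.
Proof.
move=> f0; rewrite [RHS]integral_mkcond; apply: eq_integral => x _; rewrite patchE.
by case: ifPn => //; rewrite notin_setE => /f0.
Qed.

Lemma bounded_integrableT (f : 'rV[R]_n -> R) C : measurable_fun setT f ->
  (forall x, `|f x| <= C) -> (forall x, ~ D x -> f x = 0) ->
  mu.-integrable setT (EFin \o f).
Proof.
move=> mf fC f0; have := bounded_integrable mf fC => /integrableP[_ fi].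
apply/integrableP; split; first exact/measurable_EFinP.
by rewrite integral_supp// => x Dx /=; rewrite f0// normr0.
Qed.

End bounded_integrable.

(** * The Gagliardo-Nirenberg-Sobolev inequality for nonnegative test functions *)

Section sobolev.
Variables (R : realType) (n : nat).
Hypothesis n3 : (3 <= n)%N.
Local Notation D := (@unit_ball R n).
Local Notation mu := (lebesgue_rV R n).
Local Notation lam := (@lebesgue_measure R).
Let nr : R := n%:R.
Let nr3 : 3 <= nr. Proof. by rewrite /nr ler_nat. Qed.

Definition sobolev_exp : R := 2 * n%:R / (n%:R - 2).
(** It has two roles: it is the power [g] for which psi^g is controlled by its line integrals, and,
    as the factor produced by differentiating that power, it is the constant of the inequality. *)
Definition sobolev_cst : R := 2 * (n%:R - 1) / (n%:R - 2).
Local Notation q := sobolev_exp.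
Local Notation g := sobolev_cst.

Lemma lee_prod_ord (m : nat) (a b : 'I_m -> \bar R) : (forall i, 0 <= a i)%E ->
  (forall i, a i <= b i)%E -> (\prod_(i < m) a i <= \prod_(i < m) b i)%E.
Proof.
elim: m a b => [|m IH] a b a0 ab; first by rewrite !big_ord0.
rewrite !big_ord_recl; apply: lee_pmul => //; last exact: IH.
by apply: prode_ge0 => i _.
Qed.

Lemma upd_notin_ball i t (x : 'rV[R]_n) : 1 <= `|t| -> ~ D (upd i t x).
Proof.
move=> t1 /= H; have := coord_le_enorm (upd i t x) i; rewrite upd_coord => H2.
by have := le_lt_trans (le_trans t1 H2) H; rewrite ltxx.
Qed.

Lemma partial_le_grad (psi : 'rV[R]_n -> R) i x : `|partial i psi x| <= enorm (grad psi x).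
Proof. by have := coord_le_enorm (grad psi x) i; rewrite mxE. Qed.

Lemma measurable_grad (psi : 'rV[R]_n -> R) : smooth psi ->
  measurable_fun setT (fun x => enorm (grad psi x) : R).
Proof.
move=> sp; apply: measurable_enorm => i; under eq_fun do rewrite mxE.
by apply: continuous_measurable_rV; exact/smooth_cont/smooth_partial.
Qed.

Let g1 : 1 < g.
Proof. by have := nr3; rewrite /sobolev_cst -/nr => ?; rewrite ltr_pdivlMr; lra. Qed.

Let q0 : 0 < q.
Proof. by have := nr3; rewrite /sobolev_exp -/nr => ?; rewrite divr_gt0//; lra. Qed.

Let nr2 : nr - 2 != 0. Proof. by have := nr3 => ?; rewrite gt_eqF//; lra. Qed.
Let nr1 : nr - 1 != 0. Proof. by have := nr3 => ?; rewrite gt_eqF//; lra. Qed.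
Let nr0 : nr != 0. Proof. by have := nr3 => ?; rewrite gt_eqF//; lra. Qed.

(* g = 2 (n - 1) / (n - 2) is chosen so that n g / (n - 1) = 2 (g - 1) = q,
   the Sobolev exponent. *)
Lemma test_fun_le_marginal psi i x : test_fun D psi -> (forall x, 0 <= psi x) ->
  ((psi x `^ g)%:E <= marginal i (fun y =>
    (g * psi y `^ (g - 1) * enorm (grad psi y))%:E) x)%E.
Proof.
move=> tp p0; have sp := test_fun_smooth tp; have g0 : 0 <= g := ltW (lt_trans ltr01 g1).
have := @powR_le_integral_derive R (fun t => psi (upd i t x)) (fun t =>
  partial i psi (upd i t x)) g (x ord0 i) g1.
rewrite upd_id => H; apply: (le_trans (H _ _ _ _)) => //.
- by move=> t; exact: is_derive_upd.
- exact: (is_derive1_continuous (fun t => is_derive_upd i x t (smooth_partial i sp))).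
- by move=> t t1; apply: (test_fun_supp tp); exact: upd_notin_ball.
have mupd : measurable_fun setT (fun t : measurableTypeR R => upd i t x).
  exact: (measurableT_comp (measurable_upd i) (pair1_measurable x)).
have mpsi : measurable_fun setT (fun t : measurableTypeR R => psi (upd i t x)).
  exact: (measurableT_comp (test_fun_measurable (A := setT) tp) mupd).
have mp : measurable_fun setT (fun t : measurableTypeR R => g * psi (upd i t x) `^ (g - 1)).
  by apply: measurable_funM => //; exact: (measurableT_comp (measurable_powR _)).
apply: ge0_le_integral => //.
- by move=> t _; rewrite lee_fin mulr_ge0// mulr_ge0// powR_ge0.
- apply/measurable_EFinP; apply: measurable_funM => //.
  apply: (measurableT_comp (@normr_measurable _ setT)).
  exact: (measurableT_comp (test_fun_measurable (A := setT) (test_fun_partial i tp)) mupd).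
- apply/measurable_EFinP; apply: measurable_funM => //.
  exact: (measurableT_comp (measurable_grad sp) mupd).
- move=> t _; rewrite lee_fin ler_wpM2l ?partial_le_grad//.
  by rewrite mulr_ge0 ?powR_ge0.
Qed.

(** [gridlines] bounds S by a power of the integral of |grad (psi^g)|, and Cauchy-Schwarz bounds
    that integral by g S^(1/2) E^(1/2). It remains to divide by the power of S on the right. *)
Lemma sobolev psi : test_fun D psi -> (forall x, 0 <= psi x) ->
  (\int[mu]_x (psi x `^ q)%:E <=
   (g `^ q)%:E * (\int[mu]_x (enorm (grad psi x) ^+ 2)%:E) `^ (q / 2))%E.
Proof.
move=> tp p0; have sp := test_fun_smooth tp.
have n3' := nr3; have g0 : 0 < g := lt_trans ltr01 g1.
pose p : R := (nr - 1)^-1.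
have p0' : 0 < p by rewrite invr_gt0; lra.
pose f y := (g * psi y `^ (g - 1) * enorm (grad psi y))%:E.
have mpsi := test_fun_measurable (A := setT) tp.
have mpq r : measurable_fun setT (fun x => psi x `^ r).
  exact: (measurableT_comp (measurable_powR _)).
have mgr := measurable_grad sp.
have f0 y : (0 <= f y)%E by rewrite lee_fin mulr_ge0 ?enorm_ge0// mulr_ge0 ?powR_ge0 ?(ltW
  g0).
have mf : measurable_fun setT f.
  by apply/measurable_EFinP; apply: measurable_funM => //; apply: measurable_funM.
set S := (\int[mu]_x (psi x `^ q)%:E)%E.
set E := (\int[mu]_x (enorm (grad psi x) ^+ 2)%:E)%E.
have S0 : (0 <= S)%E by apply: integral_ge0 => x _; rewrite lee_fin powR_ge0.
have E0 : (0 <= E)%E by apply: integral_ge0 => x _; rewrite lee_fin sqr_ge0.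
(* [gridlines] with s = 0 and p = 1 / (n - 1); psi^q is the product of [n] copies of (psi^g)^p, each
   at most a marginal to the power [p]. *)
have H1 : (S <= (\int[mu]_x f x) `^ (1 + p))%E.
  apply: le_trans (gridlines _ (ltW p0') _ mf f0); last 2 first.
  - exact: (lexx 0).
  - by rewrite add0r /p -/nr; field.
  apply: ge0_le_integral => //.
  - by move=> x _; rewrite lee_fin powR_ge0.
  - exact/measurable_EFinP.
  - apply: emeasurable_funM; first exact: (measurableT_comp (measurable_poweR _)).
    apply: emeasurable_prod => i; apply: (measurableT_comp (measurable_poweR _)).
    exact: measurable_marginal.
  move=> x _; rewrite poweRe0 mul1e.
  have -> : ((psi x `^ q)%:E = \prod_(i < n) (psi x `^ g)%:E `^ p)%E.
    rewrite -poweR_prod; last by move=> i; rewrite lee_fin powR_ge0.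
    rewrite prodEFin prodr_const card_ord poweR_EFin -powR_mulrn ?powR_ge0// -!powRrM.
    by congr ((_ `^ _)%:E); rewrite /p /sobolev_exp /sobolev_cst -/nr; field;
      rewrite nr1 nr2.
  apply: lee_prod_ord => i; first exact: poweR_ge0.
  apply: gt0_ler_poweR; first exact: ltW.
  - by rewrite in_itv/= leey lee_fin powR_ge0.
  - by rewrite in_itv/= leey marginal_ge0.
  - exact: test_fun_le_marginal.
(* Cauchy-Schwarz: 2 (g - 1) = q, so psi^(g - 1) is the square root of psi^q. *)
have H2 : (\int[mu]_x f x <= g%:E * (S `^ 2^-1 * E `^ 2^-1))%E.
  have := @holder_poweR _ _ R mu (fun x => (psi x `^ q)%:E) (fun x =>
    (enorm (grad psi x) ^+ 2)%:E) 2^-1.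
  have h2 : 1 - 2^-1 = 2^-1 :> R by lra.
  rewrite h2 -/S -/E => H.
  have fE : (\int[mu]_x f x = g%:E * \int[mu]_x ((psi x `^ q)%:E `^ 2^-1 * (enorm (grad psi
    x) ^+ 2)%:E `^ 2^-1))%E.
    rewrite -ge0_integralZl//; last 3 first.
    - apply: emeasurable_funM; apply: (measurableT_comp (measurable_poweR _));
        apply/measurable_EFinP => //.
      exact: measurable_funX.
    - by move=> x _; rewrite mule_ge0 ?poweR_ge0.
    - by rewrite lee_fin ltW.
    apply: eq_integral => x _; rewrite !poweR_EFin -!EFinM /f; congr EFin.
    rewrite -mulrA; congr (_ * (_ * _)).
      rewrite -powRrM; congr (_ `^ _); rewrite /sobolev_exp /sobolev_cst -/nr; field.
      by rewrite nr2.
    by rewrite powR12_sqrt ?sqr_ge0// sqrtr_sqr ger0_norm// enorm_ge0.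
  rewrite fE lee_wpmul2l ?lee_fin ?(ltW g0)//; apply: H => //.
  - by apply/andP; split; lra.
  - exact/measurable_EFinP.
  - by apply/measurable_EFinP; exact: measurable_funX.
  - by move=> x; rewrite lee_fin powR_ge0.
  - by move=> x; rewrite lee_fin sqr_ge0.
(* Needed in order to divide by a power of S; it holds because [psi] is bounded and vanishes off the
   ball. *)
have Sfin : S \is a fin_num.
  have [C C0 pC] := test_fun_bounded tp.
  have := @bounded_integrableT R n (fun x => psi x `^ q) (C `^ q) (mpq q).
  move=> /(_ _ _)/integrableP[| |_].
  - move=> x; rewrite ger0_norm ?powR_ge0// ge0_ler_powR ?nnegrE ?(ltW q0) ?(ltW C0)//.
    by rewrite (le_trans _ (pC x))// ler_norm.
  - by move=> x Dx; rewrite (test_fun_supp tp Dx) powR0// gt_eqF.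
  rewrite ge0_fin_numE//; apply: le_lt_trans.
  rewrite le_eqVlt; apply/orP; left; apply/eqP; apply: eq_integral => x _ /=.
  by rewrite ger0_norm// powR_ge0.
have q2 : 0 < q / 2 by rewrite divr_gt0.
have [Ey|Ey] := eqVneq E +oo%E.
  by rewrite Ey poweRyr ?gt_eqF// gt0_muley ?leey// lte_fin powR_gt0.
have Efin : E \is a fin_num by rewrite ge0_fin_numE// ltey.
have fS : fine S = 0 \/ 0 < fine S.
  have := fine_ge0 S0; rewrite le_eqVlt => /orP[/eqP <-|]; by [left|right].
have {H1 H2} : (S <= (g%:E * (S `^ 2^-1 * E `^ 2^-1)) `^ (1 + p))%E.
  apply: (le_trans H1); apply: gt0_ler_poweR => //.
  - by rewrite addr_ge0// ltW.
  - by rewrite in_itv/= leey integral_ge0.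
  - by rewrite in_itv/= leey !mule_ge0 ?poweR_ge0// lee_fin ltW.
rewrite -(fineK Sfin) -(fineK Efin) !poweR_EFin -!EFinM.
move: (fine_ge0 E0) fS; move: (fine S) (fine E) => s e e0 [->|s0].
  by move=> _; rewrite lee_fin mulr_ge0// powR_ge0.
rewrite lee_fin => H; rewrite lee_fin.
pose c := g * e `^ 2^-1.
have c0 : 0 <= c by rewrite mulr_ge0 ?powR_ge0// ltW.
have H' : s <= (c * s `^ 2^-1) `^ (1 + p).
  by rewrite (le_trans H)// le_eqVlt; apply/orP; left; apply/eqP; congr (_ `^ _);
    rewrite /c; ring.
have r0 : 0 < 1 + p by rewrite addr_gt0.
have H3 : s `^ (1 + p)^-1 <= c * s `^ 2^-1.
  have cs0 : 0 <= c * s `^ 2^-1 by rewrite mulr_ge0 ?powR_ge0.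
  have -> : c * s `^ 2^-1 = ((c * s `^ 2^-1) `^ (1 + p)) `^ (1 + p)^-1.
    by rewrite -powRrM divff ?gt_eqF// powRr1.
  by rewrite ge0_ler_powR ?nnegrE ?powR_ge0 ?invr_ge0 ?(ltW s0) ?(ltW r0).
(* The exponents match: 1 / (1 + p) - 1 / 2 = (n - 1) / n - 1 / 2 = 1 / q. *)
have H4 : s `^ q^-1 <= c.
  rewrite -(ler_pM2r (powR_gt0 2^-1 s0)) (le_trans _ H3)// -powRD;
    last by rewrite (gt_eqF s0) implybT.
  rewrite le_eqVlt; apply/orP; left; apply/eqP; congr (_ `^ _);
    rewrite /sobolev_exp /p -/nr; field.
  by move: nr0 nr1 nr2; rewrite /nr subrK => -> -> ->.
have H5 : s <= c `^ q.
  have -> : s = (s `^ q^-1) `^ q by rewrite -powRrM mulVf ?gt_eqF// powRr1 ?(ltW s0).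
  by rewrite ge0_ler_powR ?nnegrE ?powR_ge0 ?(ltW q0).
rewrite (le_trans H5)// /c powRM ?powR_ge0 ?(ltW g0)// -powRrM mulrC.
by rewrite [2^-1 * q]mulrC mulrC.
Qed.

End sobolev.

(** * Weak gradients *)

Section Rdct.
Context d (T : measurableType d) (R : realType) (mu : {measure set T -> \bar R}).
Variables (D : set T) (mD : measurable D).

Lemma Rdominated_convergence (f_ : nat -> T -> R) (f g : T -> R) :
  (forall k, measurable_fun D (f_ k)) -> measurable_fun D f ->
  {ae mu, forall x, D x -> (fun k => f_ k x) @ \oo --> f x} ->
  mu.-integrable D (EFin \o g) ->
  {ae mu, forall x, D x -> forall k, `|f_ k x| <= g x} ->
  mu.-integrable D (EFin \o f) /\
  (fun k => \int[mu]_(x in D) f_ k x) @ \oo --> \int[mu]_(x in D) f x.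
Proof.
move=> mf_ mf cf ig fg.
have [] := @dominated_convergence _ _ _ mu D mD (fun k =>
  EFin \o f_ k) (EFin \o f) (EFin \o g).
- by move=> k; exact/measurable_EFinP.
- exact/measurable_EFinP.
- by apply: filterS cf => x /[apply] cfx; apply: cvg_EFin => //; exact: nearW.
- exact: ig.
- by apply: filterS fg => x fgx k /fgx; rewrite lee_fin.
move=> fi _ cv; split=> //.
have fin : (\int[mu]_(x in D) (EFin \o f) x)%E \is a fin_num.
  exact: integrable_fin_num.
by apply: fine_cvg; rewrite /= fineK.
Qed.

Lemma dominated_integrable (f g : T -> R) : measurable_fun D f ->
  mu.-integrable D (EFin \o g) -> {ae mu, forall x, D x -> `|f x| <= g x} ->
  mu.-integrable D (EFin \o f).
Proof.
move=> mf ig fg; apply: (proj1 (@Rdominated_convergence (fun=> f) f g _ _ _ _ _)) => //.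
- by apply: aeW => x _; exact: cvg_cst.
- by apply: filterS fg => x /[apply] ? _.
Qed.

End Rdct.

Section expinv1.
Variable R : realType.

Lemma expinv1_ge0 (t : R) : 0 <= expinv 1 t.
Proof. by rewrite /expinv; case: ifP => // _; rewrite hornerC mul1r expR_ge0. Qed.

Lemma expinv1_le1 (t : R) : expinv 1 t <= 1.
Proof.
rewrite /expinv; case: ifP => // t0; rewrite hornerC mul1r -expR0 ler_expR.
by rewrite oppr_le0 invr_ge0 ltW.
Qed.

Lemma expinv1_gt0 (t : R) : 0 < t -> 0 < expinv 1 t.
Proof. by move=> t0; rewrite /expinv t0 hornerC mul1r expR_gt0. Qed.

(** Squeeze between 1 - 1 / t and 1, with t = (k + 1) y - c. The shift [c] is 1 for cutoffs of the
    ball and 0 for steps. *)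
Lemma expinv1_cvg (y c : R) : 0 < y ->
  (fun k : nat => expinv 1 (k.+1%:R * y - c)) @ \oo --> (1 : R).
Proof.
move=> y0.
have cu : (fun k : nat => k.+1%:R * y - c : R) @ \oo --> +oo.
  apply/cvgryPge => A; near=> k.
  rewrite lerBrDr -ler_pdivrMr// (@le_trans _ _ k%:R)//; last by rewrite ler_nat.
  by near: k; exact: nbhs_infty_ger.
have up : \forall k \near \oo, 0 < k.+1%:R * y - c :> R by have /cvgryPgt/(_ 0) := cu.
have ci : (fun k : nat => 1 - (k.+1%:R * y - c)^-1 : R) @ \oo --> (1 : R).
  rewrite -[X in _ --> X]subr0; apply: cvgB; first exact: cvg_cst.
  exact: (gtr0_cvgV0 up).2.
apply: squeeze_cvgr ci (cvg_cst (1 : R)).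
near=> k; rewrite expinv1_le1 andbT.
have u0 : 0 < k.+1%:R * y - c by near: k; exact: up.
by rewrite /expinv u0 hornerC mul1r expR_ge1Dx.
Unshelve. all: by end_near. Qed.

End expinv1.

(** * Integration by parts against test functions *)

Section ibp.
Variables (R : realType) (n : nat).
Local Notation D := (@unit_ball R n).
Local Notation mu := (lebesgue_rV R n).
Local Notation lam := (@lebesgue_measure R).
Implicit Types phi psi f : 'rV[R]_n -> R.

Lemma test_fun_integrable psi : test_fun D psi -> mu.-integrable D (EFin \o psi).
Proof.
move=> tp; have [C C0 pC] := test_fun_bounded tp.
by apply: bounded_integrable pC; exact: test_fun_measurable tp.
Qed.

Lemma integral_partial psi i : test_fun D psi -> \int[mu]_(x in D) partial i psi x = 0.
Proof.
move=> tp; have tpi := test_fun_partial i tp; have sp := test_fun_smooth tp.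
have [C C0 pC] := test_fun_bounded tpi.
rewrite /Rintegral -integral_supp; last by move=> x Dx; rewrite (test_fun_supp tpi).
rewrite (@integral_line0 _ _ i)//.
  apply: bounded_integrableT pC _; first exact: test_fun_measurable tpi.
  by move=> x; exact: test_fun_supp tpi.
move=> x; apply: (@integral_derive_supp R (fun t => psi (upd i t x))).
- by move=> t; exact: is_derive_upd.
- exact: (is_derive1_continuous (fun t => is_derive_upd i x t (smooth_partial i sp))).
- by move=> t t1; apply: (test_fun_supp tp); exact: upd_notin_ball.
- by move=> t t1; apply: (test_fun_supp tpi); exact: upd_notin_ball.
Qed.

Lemma ibp phi psi i : smooth phi -> test_fun D psi ->
  \int[mu]_(x in D) (phi x * partial i psi x) = - \int[mu]_(x in D) (partial i phi x * psi
    x).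
Proof.
move=> sp tp; have := integral_partial i (test_funMl sp tp).
rewrite partialM//; last exact: test_fun_smooth tp.
rewrite RintegralD//; first last.
- have := test_fun_integrable (test_funMl (smooth_partial i sp) tp).
  by congr (integrable _ _ (EFin \o _)); apply/funext => x; rewrite mulrC.
- exact: test_fun_integrable (test_funMl sp (test_fun_partial i tp)).
- exact: measurable_unit_ball.
move/eqP; rewrite addr_eq0 => /eqP ->; congr (- _).
by apply: eq_Rintegral => x _; rewrite mulrC.
Qed.

End ibp.

(** * The fundamental lemma of the calculus of variations *)

Section ray_sets.
Variables (R : realType) (n : nat).

(** The generating class for Dynkin's lemma: it is stable under intersection, and its indicators are
    pointwise limits of products of smooth steps. *)
Definition ray_sets : set (set 'rV[R]_n) :=
  [set A | exists a : 'rV[R]_n, A = [set x : 'rV[R]_n | forall i, a ord0 i < x ord0 i]].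

Lemma ray_sets_setI : setI_closed ray_sets.
Proof.
move=> _ _ [a ->] [b ->]; exists (\row_i Num.max (a ord0 i) (b ord0 i)).
apply/seteqP; split => x /=.
  by move=> [xa xb] i; rewrite mxE gt_max xa xb.
by move=> xab; split=> i; have := xab i; rewrite mxE gt_max => /andP[].
Qed.

Lemma measurable_ray_sets : @measurable _ 'rV[R]_n = <<s ray_sets >>.
Proof.
apply/seteqP; split; last first.
  apply: smallest_sub; first exact: sigma_algebra_measurable.
  move=> _ [a ->]; rewrite [X in measurable X](_ : _ = \bigcap_(i in [set: 'I_n]) [set x :
    'rV[R]_n | `]a ord0 i, +oo[%classic (x ord0 i)]).
    apply: fin_bigcap_measurable => // i _.
    by have := @measurable_coord R n i measurableT _ (measurable_itv `]a ord0 i, +oo[);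
      rewrite setTI.
  apply/seteqP; split=> x /= H i; first by move=> _; rewrite /= in_itv/= H.
  by have := H i I; rewrite /= in_itv/= andbT.
apply: smallest_sub; first exact: smallest_sigma_algebra.
rewrite -bigcup_seq; apply: bigcup_sub => i _ B [C mC <-].
suff mf : measurable_fun setT (fun x : g_sigma_algebraType ray_sets =>
  (x : 'rV[R]_n) ord0 i : measurableTypeR R).
  exact: mf.
apply: (measurability _ (RGenOInfty.measurableE R)) => //.
move=> _ [_ [c ->] <-]; rewrite setTI.
(* The half-space x_i > c is exhausted by the orthants whose other corner coordinates are -k. *)
rewrite [X in measurable X](_ : _ = \bigcup_(k : nat) [set x : 'rV[R]_n |
   forall j, (\row_j (if j == i then c else - k%:R) : 'rV[R]_n) ord0 j < x ord0 j]).
  apply: bigcup_measurable => k _; apply: sub_sigma_algebra.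
  by exists (\row_j (if j == i then c else - k%:R)).
apply/seteqP; split=> x /=; rewrite in_itv/= andbT.
  move=> cx; pose s : R := \sum_j `|x ord0 j|.
  exists (Num.truncn s).+1 => // j /=; rewrite mxE; case: eqVneq => [->//|_].
  rewrite ltrNl; apply: (@le_lt_trans _ _ s); last exact: truncnS_gt.
  rewrite (le_trans (ler_norm _))// normrN /s (bigD1 j)//= lerDl.
  exact: sumr_ge0.
by move=> [k _ /(_ i)]; rewrite mxE eqxx.
Qed.

End ray_sets.

Section du_bois_reymond.
Variables (R : realType) (n : nat).
Local Notation D := (@unit_ball R n).
Local Notation mu := (lebesgue_rV R n).
Let mD : measurable D := @measurable_unit_ball R n.

(** Subtracting 1 confines the support to the closed set |x|^2 <= 1 - 1 / (k + 1), strictly inside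
    the open ball. *)
Definition ball_cutoff (k : nat) (x : 'rV[R]_n) : R :=
  expinv 1 (k.+1%:R * (1 - dotrV x x) - 1).

Lemma ball_cutoff_test k : test_fun D (ball_cutoff k).
Proof.
have cdot : continuous (fun x : 'rV[R]_n => dotrV x x) := Ck_cont (Ck_dotrVxx R n 0).
pose K := [set x : 'rV[R]_n | dotrV x x <= 1 - k.+1%:R^-1].
have clK : closed K.
  rewrite (_ : K = (fun x : 'rV[R]_n => dotrV x x) @^-1` [set t | t <= 1 - k.+1%:R^-1]) //.
  by apply: preimage_closed; [move=> x _; exact: cdot|exact: closed_le].
have KD : K `<=` D.
  by move=> x /= Kx; apply/unit_ballE; rewrite (le_lt_trans Kx)// gtrBl invr_gt0.
have sK : closure [set x | ball_cutoff k x != 0] `<=` K.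
  have /closure_id Kc := clK; rewrite [X in _ `<=` X]Kc; apply: closureS => x /=.
  apply: contra_neqT; rewrite -ltNge => xk; apply: expinv_eq0.
  rewrite subr_le0 -ler_pdivlMl// mulr1 lerBlDr addrC -lerBlDr; exact: ltW.
split.
- move=> j; apply: Ck_comp; first exact: smooth1_expinv.
  apply: CkD; last exact: Ck_cst.
  apply: CkM; first exact: Ck_cst.
  apply: CkD; first exact: Ck_cst.
  rewrite (_ : (fun x => - dotrV x x) = (fun x : 'rV[R]_n => (-1) * dotrV x x)).
    by apply: CkM; [exact: Ck_cst|exact: Ck_dotrVxx].
  by apply/funext => x; rewrite mulN1r.
- apply: bounded_closed_compact; last exact: closed_closure.
  exists 1; split; first exact: num_real.
  move=> y y1 x /sK/KD/= /ltW xD; rewrite [leLHS]/Num.norm/= mx_normrE.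
  apply/bigmax_leP; split=> [|[i j] _ /=]; first by rewrite (le_trans ler01)// ltW.
  by rewrite (ord1 i) (le_trans (coord_le_enorm x j))// (le_trans xD)// ltW.
- exact: subset_trans sK KD.
Qed.

Lemma ball_cutoff_cvg x : D x -> (fun k => ball_cutoff k x) @ \oo --> (1 : R).
Proof. by move=> /unit_ballE Dx; apply: expinv1_cvg; rewrite subr_gt0. Qed.

(** The steps vanish at [t = a] too, so the limit is the indicator of the open ray; hence the strict
    inequalities in [ray_sets]. *)
Lemma expinv_step_cvg (a t : R) :
  (fun k => expinv 1 (k.+1%:R * (t - a))) @ \oo --> ((a < t)%R%:R : R).
Proof.
have [at_|ta] := ltP a t.
  have := @expinv1_cvg R (t - a) 0; rewrite subr_gt0 => /(_ at_).
  by under eq_fun do rewrite subr0.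
under eq_fun do rewrite expinv_eq0 ?mulr_ge0_le0 ?subr_le0//.
exact: cvg_cst.
Qed.

Lemma cvg_prod_ord (m : nat) (u : nat -> 'I_m -> R) (l : 'I_m -> R) :
  (forall i, (fun k => u k i) @ \oo --> l i) ->
  (fun k => \prod_(i < m) u k i) @ \oo --> \prod_(i < m) l i.
Proof.
elim: m u l => [|m IH] u l ul.
  by under eq_fun do rewrite big_ord0; rewrite big_ord0; exact: cvg_cst.
under eq_fun do rewrite big_ord_recl; rewrite big_ord_recl.
by apply: cvgM; [exact: ul|apply: (IH (fun k i => u k (lift ord0 i))) => i; exact: ul].
Qed.

Variable f : 'rV[R]_n -> R.
Hypothesis fi : mu.-integrable D (EFin \o f).
Hypothesis f0 : forall psi, test_fun D psi -> \int[mu]_(x in D) (f x * psi x) = 0.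

Let mf : measurable_fun D f.
Proof. by have /measurable_EFinP := measurable_int _ fi. Qed.

Let fni : mu.-integrable D (EFin \o (fun x => `|f x|)).
Proof. exact: integrable_norm. Qed.

(** Dominated convergence with [|f|] as bound: orthogonality to [f] survives bounded pointwise
    limits. *)
Let limit0 (psi : nat -> 'rV[R]_n -> R) (l : 'rV[R]_n -> R) :
  (forall k, measurable_fun D (psi k)) ->
    (forall k, \int[mu]_(x in D) (f x * psi k x) = 0) ->
  (forall k x, `|psi k x| <= 1) ->
  (forall x, D x -> (fun k => psi k x) @ \oo --> l x) -> measurable_fun D l ->
  \int[mu]_(x in D) (f x * l x) = 0.
Proof.
move=> mpsi psi0 psi1 psil ml.
have [|||||_] := @Rdominated_convergence _ _ R mu D mD (fun k x => f x * psi k x) (fun x =>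
  f x * l x) (fun x => `|f x|).
- by move=> k; exact: measurable_funM.
- exact: measurable_funM.
- by apply: aeW => x Dx; apply: cvgM; [exact: cvg_cst|exact: psil].
- exact: fni.
- apply: aeW => x Dx k; rewrite normrM -[leRHS]mulr1; exact: ler_wpM2l.
under eq_fun do rewrite psi0//.
by move=> /cvg_lim <-//; rewrite lim_cst.
Qed.

(** The property propagated by Dynkin's lemma from [ray_sets] to all measurable sets. *)
Let P (A : set 'rV[R]_n) := \int[mu]_(x in D) (f x * \1_A x) = 0.

Let fA A : measurable A -> mu.-integrable D (EFin \o (fun x => f x * \1_A x)).
Proof.
move=> mA; apply: (dominated_integrable mD _ fni).
  by apply: measurable_funM => //; exact: measurable_indic.
apply: aeW => x _; rewrite normrM -[leRHS]mulr1 ler_wpM2l// indicE.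
by case: (x \in A); rewrite ?normr1 ?normr0.
Qed.

Let PT : P setT.
Proof.
apply: (limit0 (psi := ball_cutoff)).
- by move=> k; exact: test_fun_measurable (ball_cutoff_test k).
- by move=> k; apply: f0; exact: ball_cutoff_test.
- by move=> k x; rewrite ger0_norm ?expinv1_ge0// expinv1_le1.
- by move=> x Dx; rewrite indicT; exact: ball_cutoff_cvg.
- exact: measurable_indic.
Qed.

Let PU (F : (set 'rV[R]_n)^nat) : (forall k, measurable (F k)) -> trivIset setT F ->
  (forall k, P (F k)) -> P (\bigcup_k F k).
Proof.
move=> mF tF PF; pose U k : set 'rV[R]_n := \big[setU/set0]_(i < k) F i.
have mU k : measurable (U k) by exact: bigsetU_measurable.
have PUk k : P (U k).
  elim: k => [|k IH].
    rewrite /P /U big_ord0; under eq_Rintegral do rewrite indic0 mulr0.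
    by rewrite Rintegral_cst//= mul0r.
  have -> : P (U k.+1) = (\int[mu]_(x in D) (f x * \1_(U k) x + f x * \1_(F k) x) = 0).
    rewrite /P; congr (_ = 0); apply: eq_Rintegral => x _; rewrite -mulrDr; congr (_ * _).
    rewrite !indicE /U big_ord_recr/= in_setU; have [xU|xU] := boolP (x \in _);
      have [xF|xF] := boolP (x \in F k) => //=.
    + exfalso; move: xU xF; rewrite !inE -bigcup_mkord => -[j /= jk Fj] Fk.
      by move: tF => /trivIsetP/(_ j k I I (negbT (ltn_eqF jk))) /seteqP[H _];
        exact: (H x (conj Fj Fk)).
    + by rewrite addr0.
    + by rewrite add0r.
    + by rewrite addr0.
  by rewrite RintegralD ?fA// IH PF addr0.
apply: (limit0 (psi := fun k => \1_(U k))).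
- by move=> k; exact: measurable_indic.
- exact: PUk.
- by move=> k x; rewrite indicE; case: (x \in U k); rewrite ?normr1 ?normr0.
- move=> x _; rewrite !indicE; have [[i _ Fi]|nF] := pselect ((\bigcup_k F k) x).
    rewrite mem_set; last by exists i.
    apply: cvg_near_cst; exists i.+1 => // k /= ik; rewrite indicE mem_set//.
    by rewrite /U -bigcup_mkord; exists i.
  rewrite memNset//; apply: cvg_near_cst; apply: nearW => k; rewrite indicE memNset//.
  by rewrite /U -bigcup_mkord => -[i _ Fi]; apply: nF; exists i.
- by apply: measurable_indic; exact: bigcup_measurable.
Qed.

Let Pall A : measurable A -> P A.
Proof.
rewrite measurable_ray_sets; apply: (dynkin_induction (measurable_ray_sets R n)) => //.
- exact: ray_sets_setI.
- move=> _ [a ->].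
  (* These products tend to the indicator of the orthant but lack compact support; [ball_cutoff],
     which tends to 1 on [D], supplies it. *)
  pose st k (x : 'rV[R]_n) := \prod_(i < n) expinv 1 (k.+1%:R * (x ord0 i - a ord0 i)).
  have st01 k x : 0 <= st k x <= 1.
    rewrite prodr_ge0 => [|i _]; last exact: expinv1_ge0.
    by rewrite prodr_ile1// => i _; rewrite expinv1_ge0 expinv1_le1.
  have tst k : test_fun D (fun x => st k x * ball_cutoff k x).
    apply: test_funMl; last exact: ball_cutoff_test.
    move=> j; apply: Ck_prod => i; apply: Ck_comp; first exact: smooth1_expinv.
    apply: CkM; first exact: Ck_cst.
    by apply: CkD; [exact: Ck_coord|exact: Ck_cst].
  apply: (limit0 (psi := fun k x => st k x * ball_cutoff k x)).
  + by move=> k; exact: test_fun_measurable (tst k).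
  + by move=> k; exact: f0 (tst k).
  + move=> k x; have /andP[s0 s1] := st01 k x; rewrite ger0_norm ?mulr_ge0 ?expinv1_ge0//.
    by rewrite mulr_ile1 ?expinv1_ge0 ?expinv1_le1.
  + move=> x Dx; rewrite -[X in _ --> X]mulr1; apply: cvgM; last exact: ball_cutoff_cvg.
    rewrite indicE (_ : _%:R = \prod_(i < n) ((a ord0 i < x ord0 i)%R%:R : R)).
      by apply: cvg_prod_ord => i; exact: expinv_step_cvg.
    have [/forallP H|/forallPn[i H]] := boolP [forall i, a ord0 i < x ord0 i].
      by rewrite mem_set// big1// => i _; rewrite H.
    rewrite memNset; first by rewrite (bigD1 i)//= (negbTE H) mul0r.
    by move=> /= /(_ i); exact/negP.
  + apply: measurable_indic; rewrite measurable_ray_sets.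
    by apply: sub_sigma_algebra; exists a.
- move=> B mB PB; rewrite /P.
  have -> : \int[mu]_(x in D) (f x * \1_(~` B) x) = \int[mu]_(x in D) (f x * \1_setT x - f
    x * \1_B x).
    apply: eq_Rintegral => x _; rewrite -mulrBr !indicE in_setT in_setC.
    by case: (x \in B); rewrite /= ?subrr ?subr0.
  by rewrite RintegralB ?fA// PT PB subrr.
Qed.

(** By [Pall] the integral of [f] over every measurable subset of [D] is 0. *)
Lemma du_bois_reymond : {ae mu, forall x, D x -> f x = 0}.
Proof.
have : ae_eq mu D (EFin \o f) (cst 0%E).
  apply: integral_ae_eq => //.
  move=> A AD mA; rewrite integral0.
  have := Pall mA; rewrite /P.
  have -> : \int[mu]_(x in D) (f x * \1_A x) = \int[mu]_(x in A) f x.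
    rewrite [RHS]Rintegral_mkcond [LHS]Rintegral_mkcond; apply: eq_Rintegral => x _.
    rewrite !patchE indicE; have [xA|xA] := boolP (x \in A).
      by rewrite mulr1 mem_set//; apply: AD; rewrite inE in xA.
    by rewrite mulr0; case: ifP.
  move=> H; rewrite -[LHS]fineK; first by rewrite [fine _]H.
  apply: integrable_fin_num => //; apply: integrableS fi => //.
by apply: filterS => x /= H Dx; have [] := H Dx.
Qed.

End du_bois_reymond.

(** * Square-integrable functions on a set *)

Section square_integrable.
Context d (T : measurableType d) (R : realType) (mu : {measure set T -> \bar R}).
Variables (D : set T) (mD : measurable D).
Implicit Types f g h : T -> R.

(** A form of [Lp D 2] without norm or extension by 0, convenient for domination arguments; [Lp2P]
    proves the equivalence. *)
Definition square_integrable f :=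
  measurable_fun D f /\ mu.-integrable D (EFin \o (fun x => f x ^+ 2)).

Lemma square_integrable_le f g : measurable_fun D f -> square_integrable g ->
  {ae mu, forall x, D x -> `|f x| <= `|g x|} -> square_integrable f.
Proof.
move=> mf [mg g2] fg; split=> //.
apply: (dominated_integrable mD _ g2); first exact: measurable_funX.
apply: filterS fg => x H /H fgx; rewrite normrX.
by rewrite -[leRHS]ger0_norm ?sqr_ge0// normrX lerXn2r// nnegrE.
Qed.

Lemma square_integrableM f g : square_integrable f -> square_integrable g ->
  mu.-integrable D (EFin \o (fun x => f x * g x)).
Proof.
move=> [mf f2] [mg g2].
have fg2 : mu.-integrable D (EFin \o (fun x => f x ^+ 2 + g x ^+ 2)).
  by have := integrableD mD f2 g2.
apply: (dominated_integrable mD _ fg2); first exact: measurable_funM.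
apply: aeW => x _; rewrite normrM -(real_normK (num_real (f x))) -(real_normK (num_real (g
  x))).
move: (normr_ge0 (f x)) (normr_ge0 (g x)) (sqr_ge0 (`|f x| - `|g x|)).
by move: `|f x| `|g x| => a b a0 b0; rewrite sqrrB; nra.
Qed.

Lemma square_integrableD f g : square_integrable f -> square_integrable g ->
  square_integrable (fun x => f x + g x).
Proof.
move=> sf sg; have [mf f2] := sf; have [mg g2] := sg.
split; first exact: measurable_funD.
have fg := square_integrableM sf sg.
have := integrableD mD (integrableD mD f2 g2) (integrableD mD fg fg).
by congr (integrable _ _ _); apply/funext => x /=; rewrite -!EFinD; congr EFin; ring.
Qed.

Lemma square_integrableMl h f (C : R) : measurable_fun D h -> (forall x, `|h x| <= C) ->
  square_integrable f -> square_integrable (fun x => h x * f x).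
Proof.
move=> mh hC [mf f2].
have Cf : square_integrable (fun x => C * f x).
  split; first exact: measurable_funM.
  have := integrableZl mD (C ^+ 2) f2.
  by congr (integrable _ _ _); apply/funext => x /=; rewrite -EFinM exprMn.
apply: (square_integrable_le _ Cf); first exact: measurable_funM.
apply: aeW => x _; rewrite !normrM ler_wpM2r// (le_trans (hC x))// ler_norm//.
Qed.

Lemma square_integrableB f g : square_integrable f -> square_integrable g ->
  square_integrable (fun x => f x - g x).
Proof.
move=> sf sg; apply: square_integrableD => //.
rewrite (_ : (fun x => - g x) = (fun x => -1 * g x)); last by apply/funext => x;
  rewrite mulN1r.
by apply: (@square_integrableMl _ _ 1) => // x; rewrite normrN normr1.
Qed.

Lemma square_integrable_norm f : square_integrable f -> square_integrable (fun x => `|f x|).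
Proof.
move=> sf; apply: (square_integrable_le _ sf); first by apply: measurableT_comp => //;
  case: sf.
by apply: aeW => x _; rewrite normr_id.
Qed.

Lemma square_integrable_bounded f (C : R) : (mu D < +oo)%E -> measurable_fun D f ->
  (forall x, `|f x| <= C) -> square_integrable f.
Proof.
move=> Dy mf fC; split=> //; apply: measurable_bounded_integrable => //;
  first exact: measurable_funX.
exists (C ^+ 2); split; first exact: num_real.
move=> y Cy x _ /=; rewrite (le_trans _ (ltW Cy))// normrX lerXn2r// nnegrE.
exact: le_trans (fC x).
Qed.

Lemma square_integrable_integrable f : (mu D < +oo)%E -> square_integrable f ->
  mu.-integrable D (EFin \o f).
Proof.
move=> Dy sf; have s1 : square_integrable (cst 1)
  by apply: (@square_integrable_bounded _ 1) => // x; rewrite normr1.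
by have := square_integrableM sf s1; congr (integrable _ _ (EFin \o _)); apply/funext => x;
  rewrite mulr1.
Qed.

Lemma square_integrable_sum (I : Type) (r : seq I) (F : I -> T -> R) :
  (mu D < +oo)%E ->
  (forall i, square_integrable (F i)) -> square_integrable (fun x => \sum_(i <- r) F i x).
Proof.
move=> Dy HF; elim: r => [|a r IH].
  under eq_fun do rewrite big_nil.
  by apply: (@square_integrable_bounded _ 0) => // x; rewrite normr0.
by under eq_fun do rewrite big_cons; exact: square_integrableD.
Qed.

End square_integrable.

(** * Uniqueness and linearity of weak gradients *)

Section weak_gradient.
Variables (R : realType) (n : nat).
Local Notation D := (@unit_ball R n).
Local Notation mu := (lebesgue_rV R n).
Local Notation L2 := (square_integrable mu D).
Let mD : measurable D := @measurable_unit_ball R n.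
Let Dy : (mu D < +oo)%E := @unit_ball_fin R n.
Implicit Types (u w phi : 'rV[R]_n -> R) (g h : 'rV[R]_n -> 'rV[R]_n).

Lemma Lp_measurable (p : R) u : Lp D p u -> measurable_fun D u.
Proof.
rewrite /Lp /= inE => /andP[+ _]; rewrite inE/= => mu'.
exact/(measurable_restrictT u mD).
Qed.

Lemma Lp2P u : Lp D 2 u <-> L2 u.
Proof.
split=> [up|[mu' u2]].
  split; first exact: Lp_measurable up.
  have := Lfun2_integrable_sqr up.
  move=> H; apply/(integrable_mkcond _ mD); move: H; congr (integrable _ _ _).
  by apply/funext => x /=; rewrite !patchE; case: ifP => //=; rewrite expr0n.
rewrite /Lp /= inE; apply/andP; rewrite !inE/=; split.
  exact/(measurable_restrictT u mD).
rewrite /finite_norm unlock /=.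
rewrite ?pnatr_eq0/=.
apply: poweR_lty.
move: u2 => /(integrable_mkcond _ mD)/integrableP[_]; apply: le_lt_trans.
rewrite le_eqVlt; apply/orP; left; apply/eqP; apply: eq_integral => x _ /=.
rewrite !patchE; case: ifP => //= _; last by rewrite normr0 powR0 ?normr0// pnatr_eq0.
by rewrite powR_mulrn// normrX.
Qed.

Lemma vLp2P g : vLp D 2 g <-> forall i, L2 (fun x => g x ord0 i).
Proof. by split=> H i; apply/Lp2P; exact: H. Qed.

Lemma wgradP u : H1 D u -> (forall i, L2 (fun x =>
  wgrad D u x ord0 i)) /\ weak_grad D u (wgrad D u).
Proof.
move=> [_ [g gu]]; have [vu wu] : [set g | vLp D 2 g /\ weak_grad D u g] (wgrad D u).
  by apply: xgetPex; exists g.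
by split => //; exact/vLp2P.
Qed.

Lemma test_fun_L2 phi : test_fun D phi -> L2 phi.
Proof.
move=> tp; have [C C0 pC] := test_fun_bounded tp.
by apply: square_integrable_bounded pC => //; exact: test_fun_measurable tp.
Qed.

(** The difference of the two gradients is orthogonal to every test function. This gives access to
    the values of [wgrad], which is defined by choice. *)
Lemma weak_grad_unique u g h : (forall i, L2 (fun x => g x ord0 i)) ->
  (forall i, L2 (fun x => h x ord0 i)) -> weak_grad D u g -> weak_grad D u h ->
  forall i, {ae mu, forall x, D x -> g x ord0 i = h x ord0 i}.
Proof.
move=> g2 h2 gu hu i.
have gh : {ae mu, forall x, D x -> g x ord0 i - h x ord0 i = 0}.
  apply: du_bois_reymond.
    exact: (square_integrable_integrable mD Dy (square_integrableB mD (g2 i) (h2 i))).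
  move=> psi tp; have p2 := test_fun_L2 tp.
  under eq_Rintegral do rewrite mulrBl.
  rewrite RintegralB//; try exact: square_integrableM.
  by apply/eqP; rewrite subr_eq0 -eqr_opp -gu// -hu.
by apply: filterS gh => x H /H/eqP; rewrite subr_eq0 => /eqP.
Qed.

Lemma weak_gradD u w g h : L2 u -> L2 w -> (forall i, L2 (fun x => g x ord0 i)) ->
  (forall i, L2 (fun x => h x ord0 i)) -> weak_grad D u g -> weak_grad D w h ->
  weak_grad D (fun x => u x + w x) (fun x => g x + h x).
Proof.
move=> u2 w2 g2 h2 gu hw phi tp i.
have p2 := test_fun_L2 tp; have dp2 := test_fun_L2 (test_fun_partial i tp).
under eq_Rintegral do rewrite mulrDl; rewrite RintegralD//; try exact: square_integrableM.
under [X in _ = - X]eq_Rintegral do rewrite mxE mulrDl.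
rewrite RintegralD//; try exact: square_integrableM.
by rewrite gu// hw// opprD.
Qed.

Lemma weak_grad_smooth phi (c : R) : smooth phi ->
  weak_grad D (fun x => c * phi x) (fun x => c *: grad phi x).
Proof.
move=> sp psi tp i.
have sc : smooth (fun x => c * phi x).
  by move=> k; apply: CkM; [exact: Ck_cst|exact: sp].
rewrite (ibp i sc tp); congr (- _); apply: eq_Rintegral => x _; rewrite !mxE.
rewrite partialM//; last by move=> k; exact: Ck_cst.
by rewrite [partial i (fun=> c)](_ : _ = fun=> 0) ?mulr0 ?addr0// /partial;
  apply/funext => y; rewrite derive_cst.
Qed.

Lemma test_fun_grad_L2 phi i : test_fun D phi -> L2 (fun x => grad phi x ord0 i).
Proof.
move=> tp; rewrite (_ : (fun _ => _) = partial i phi).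
  exact/test_fun_L2/test_fun_partial.
by apply/funext => x; rewrite mxE.
Qed.

(** [H1_norm] of a difference involves the gradient chosen for that difference; this identifies it
    with the difference of the gradients. *)
Lemma wgrad_sub_test u phi : H1 D u -> test_fun D phi ->
  [/\ L2 (fun x => u x - phi x),
      forall i, L2 (fun x => wgrad D (fun x => u x - phi x) x ord0 i) &
      {ae mu, forall x, D x -> wgrad D (fun x =>
        u x - phi x) x = wgrad D u x - grad phi x}].
Proof.
move=> hu tp; have [g2 gu] := wgradP hu; have u2 : L2 u by case: hu => /Lp2P.
have p2 := test_fun_L2 tp; have sp := test_fun_smooth tp.
have up2 : L2 (fun x => u x - phi x) by exact: square_integrableB.
have E : (fun x => u x - phi x) = (fun x => u x + -1 * phi x).
  by apply/funext => x; rewrite mulN1r.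
have gp2 i : L2 (fun x => (wgrad D u x + -1 *: grad phi x) ord0 i).
  rewrite (_ : (fun _ => _) = (fun x => wgrad D u x ord0 i - grad phi x ord0 i)).
    by apply: square_integrableB => //; exact: test_fun_grad_L2.
  by apply/funext => x; rewrite !mxE mulN1r.
have gup : weak_grad D (fun x => u x - phi x) (fun x => wgrad D u x + -1 *: grad phi x).
  rewrite E; apply: weak_gradD => //.
  - by apply: (@square_integrableMl _ _ _ _ _ _ _ _ 1) => // x; rewrite normrN normr1.
  - move=> i; rewrite (_ : (fun _ => _) = (fun x => -1 * grad phi x ord0 i)).
      apply: (@square_integrableMl _ _ _ _ _ _ _ _ 1) => //; first by move=> x;
        rewrite normrN normr1.
      exact: test_fun_grad_L2.
    by apply/funext => x; rewrite !mxE.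
  - exact: weak_grad_smooth.
have hup : H1 D (fun x => u x - phi x).
  split; first exact/Lp2P.
  by exists (fun x => wgrad D u x + -1 *: grad phi x); split => //; exact/vLp2P.
have [g2' gu'] := wgradP hup.
split=> //.
have H := weak_grad_unique g2' gp2 gu' gup.
have : {ae mu, forall x, forall i, D x -> wgrad D (fun x => u x - phi x) x ord0 i =
    (wgrad D u x + -1 *: grad phi x) ord0 i} by exact: filter_forall.
by apply: filterS => x Hx Dx; apply/rowP => i; rewrite Hx// !mxE mulN1r.
Qed.

End weak_gradient.

Lemma cvg_sub0 (R : realType) (a : R) (v : nat -> R) :
  (fun k => a - v k) @ \oo --> (0 : R) -> v @ \oo --> a.
Proof.
move=> H; rewrite -[a]subr0 (_ : v = fun k => a - (a - v k)); last first.
  by apply/funext => k; rewrite opprB addrC subrK.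
by apply: cvgB => //; exact: cvg_cst.
Qed.

(** * Approximation almost everywhere in [H10] *)

Section summable_domination.
Context d (T : measurableType d) (R : realType) (mu : {measure set T -> \bar R}).
Variables (D : set T) (mD : measurable D).

(** Take for [S] the sum of the series: by monotone convergence its integral is finite, so it is
    finite almost everywhere. It dominates each term, and the terms of a convergent series tend to
    0. *)
Lemma summable_domination (f : nat -> T -> R) :
  (forall k, measurable_fun D (f k)) -> (forall k x, 0 <= f k x) ->
  (\sum_(0 <= k <oo) \int[mu]_(x in D) (f k x)%:E < +oo)%E ->
  exists S : T -> R, [/\ measurable_fun D S, (forall x, 0 <= S x),
    mu.-integrable D (EFin \o S) &
    {ae mu, forall x, D x -> (forall k, f k x <= S x) /\ (fun k =>
      f k x) @ \oo --> (0 : R)}].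
Proof.
move=> mf f0 fy.
pose S x := (\sum_(0 <= k <oo) (f k x)%:E)%E.
have S0 x : (0 <= S x)%E by apply: nneseries_ge0 => k _ _; rewrite lee_fin.
have mS : measurable_fun D S.
  apply: (@ge0_emeasurable_sum _ _ _ _ (fun k x => (f k x)%:E) xpredT) => [k x _ _|k _].
    by rewrite lee_fin.
  exact/measurable_EFinP.
have SE : (\int[mu]_(x in D) S x = \sum_(0 <= k <oo) \int[mu]_(x in D) (f k x)%:E)%E.
  by rewrite integral_nneseries// => k; [exact/measurable_EFinP|move=> x _;
    rewrite lee_fin].
have Si : mu.-integrable D S.
  apply/integrableP; split=> //.
  by under eq_integral do rewrite gee0_abs//; rewrite SE.
have Sfin : {ae mu, forall x, D x -> S x \is a fin_num} := integrable_ae mD Si.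
exists (fine \o S); split.
- exact: (measurableT_comp (@fine_measurable R setT measurableT) mS).
- by move=> x; exact: fine_ge0.
- apply/integrableP; split.
    by apply/measurable_EFinP; exact: (measurableT_comp (@fine_measurable R setT
      measurableT) mS).
  have /integrableP[_] := Si; apply: le_lt_trans.
  apply: ge0_le_integral => //.
  + apply: measurableT_comp => //; apply/measurable_EFinP.
    exact: (measurableT_comp (@fine_measurable R setT measurableT) mS).
  + exact: measurableT_comp.
  + move=> x _ /=; rewrite gee0_abs//; have [Sx|] := boolP (S x \is a fin_num).
      by rewrite -[in leRHS](fineK Sx) lee_fin ger0_norm// fine_ge0.
    by rewrite ge0_fin_numE// -leNgt leye_eq => /eqP ->; rewrite leey.
apply: filterS Sfin => x Sx /Sx {}Sx.
have fS k : f k x <= fine (S x).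
  rewrite -lee_fin fineK//.
  rewrite /S (nneseries_split 0 k.+1)//; last by move=> i _; rewrite lee_fin.
  rewrite add0n big_nat_recr//=.
  apply: (@le_trans _ _ (\sum_(0 <= i < k) (f i x)%:E + (f k x)%:E)%E).
    by rewrite leeDr// sume_ge0// => i _; rewrite lee_fin.
  by rewrite leeDl// nneseries_ge0// => i _ _; rewrite lee_fin.
split=> //.
apply: (@cvg_series_cvg_0 _ R^o).
apply: nondecreasing_is_cvgn.
  by apply/nondecreasing_seqP => k; rewrite seriesSr lerDl.
exists (fine (S x)) => _ [k _ <-].
rewrite -lee_fin fineK// /series/= -sumEFin.
by rewrite /S (nneseries_split 0 k)// ?leeDl ?nneseries_ge0// => i *; rewrite lee_fin.
Qed.

End summable_domination.

Section approximation.
Variables (R : realType) (n : nat).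
Local Notation D := (@unit_ball R n).
Local Notation mu := (lebesgue_rV R n).
Local Notation L2 := (square_integrable mu D).
Let mD : measurable D := @measurable_unit_ball R n.
Let Dy : (mu D < +oo)%E := @unit_ball_fin R n.

Lemma enorm_L2 (g : 'rV[R]_n -> 'rV[R]_n) : (forall i, L2 (fun x => g x ord0 i)) ->
  L2 (fun x => enorm (g x)).
Proof.
move=> g2; apply: (@square_integrable_le _ _ _ _ _ _ _ (fun x => \sum_i `|g x ord0 i|)) =>
  //.
- by apply: measurable_enorm => i; case: (g2 i).
- by apply: square_integrable_sum => // i; exact: square_integrable_norm.
- apply: aeW => x _; rewrite !ger0_norm ?enorm_ge0 ?sumr_ge0//.
  rewrite -(@ler_pXn2r _ 2)// ?nnegrE ?enorm_ge0 ?sumr_ge0// enorm_sqr.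
  rewrite expr2 mulr_suml ler_sum// => i _.
  rewrite -expr2 -(real_normK (num_real _)) expr2 ler_wpM2l//.
  by rewrite (bigD1 i)//= lerDl sumr_ge0.
Qed.

(* The approximants are taken at distance at most 2^-(k+1), so that the squared
   errors are summable: the convergence holds almost everywhere, and the root of
   the sum of the errors dominates it. *)
Lemma H10_approx (w : 'rV[R]_n -> R) : H10 D w ->
  exists (phi : nat -> 'rV[R]_n -> R) (Gam : 'rV[R]_n -> R),
  [/\ forall k, test_fun D (phi k), L2 Gam &
      {ae mu, forall x, D x -> [/\ (fun k => phi k x) @ \oo --> w x,
        (forall i, (fun k => partial i (phi k) x) @ \oo --> wgrad D w x ord0 i) &
        forall k i, `|partial i (phi k) x| <= Gam x]}].
Proof.
move=> [hw happ].
have [gw2 gw] := wgradP hw; have w2 : L2 w by case: hw => /Lp2P.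
pose ep k : R := 1 / (2 ^ k.+1)%:R.
have ep0 k : 0 < ep k by rewrite divr_gt0// ltr0n expn_gt0.
(* Used to bound the squared distance, at most [ep k ^+ 2], by the summable [ep k]. *)
have ep1 k : ep k <= 1 by rewrite ler_pdivrMr ?mul1r ?ler1n ?expn_gt0// ltr0n expn_gt0.
have /choice[phi tphi] : forall k : nat, exists phi, test_fun D phi /\
    (H1_norm D (fun x => w x - phi x)%R < (ep k)%:E)%E.
  by move=> k; have [phi tphi p1] := happ (ep k) (ep0 k); exists phi.
have tp k : test_fun D (phi k) by case: (tphi k).
pose f k x := (w x - phi k x) ^+ 2 + enorm (wgrad D w x - grad (phi k) x) ^+ 2.
have d2 k : L2 (fun x => w x - phi k x) by apply: square_integrableB => //;
  exact: test_fun_L2.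
have gd2 k i : L2 (fun x => (wgrad D w x - grad (phi k) x) ord0 i).
  rewrite (_ : (fun _ => _) = (fun x => wgrad D w x ord0 i - grad (phi k) x ord0 i)).
    by apply: square_integrableB => //; exact: test_fun_grad_L2.
  by apply/funext => x; rewrite !mxE.
have mf k : measurable_fun D (f k).
  apply: measurable_funD; first by apply: measurable_funX; case: (d2 k).
  by apply: measurable_funX; case: (enorm_L2 (gd2 k)).
have f0 k x : 0 <= f k x by rewrite addr_ge0// sqr_ge0.
have fk k : (\int[mu]_(x in D) (f k x)%:E <= (ep k)%:E)%E.
  have [_ g2' ae] := wgrad_sub_test hw (tp k).
  have -> : (\int[mu]_(x in D) (f k x)%:E = \int[mu]_(x in D) ((w x - phi k x) ^+ 2 +
      enorm (wgrad D (fun x => w x - phi k x)%R x) ^+ 2)%:E)%E.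
    apply: ae_eq_integral => //; first exact/measurable_EFinP.
      apply/measurable_EFinP/measurable_funD; first by apply: measurable_funX; case: (d2 k).
      by apply: measurable_funX; case: (enorm_L2 g2').
    by apply: filterS ae => x H Dx /=; rewrite /f H.
  have [_ /ltW] := tphi k; rewrite /H1_norm; set I := (\int[mu]_(x in D) _)%E => H.
  have I0 : (0 <= I)%E by apply: integral_ge0 => x _; rewrite lee_fin addr_ge0// sqr_ge0.
  have IE : I = ((I `^ 2^-1) `^ 2)%E by rewrite -poweRrM mulVf ?poweRe1// pnatr_eq0.
  rewrite IE; apply: (@le_trans _ _ (((ep k)%:E : \bar R) `^ 2)%E).
    apply: gt0_ler_poweR => //; first by rewrite in_itv/= leey poweR_ge0.
    by rewrite in_itv/= leey lee_fin ltW.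
  by rewrite poweR_EFin lee_fin powR_mulrn ?(ltW (ep0 k))// expr2 ger_pMl.
have fsum : (\sum_(0 <= k <oo) \int[mu]_(x in D) (f k x)%:E < +oo)%E.
  apply: (@le_lt_trans _ _ (\sum_(0 <= k <oo) (ep k)%:E)%E).
    apply: lee_nneseries => [j _ _|j _]; last exact: fk.
    by apply: integral_ge0 => x _; rewrite lee_fin.
  exact: le_lt_trans (epsilon_trick0 xpredT ler01) (ltry 1).
have [S [mS S0 Si aeS]] := summable_domination mD mf f0 fsum.
have S2 : L2 (fun x => Num.sqrt (S x)).
  split.
    apply: (@measurableT_comp _ _ _ _ _ _ (@Num.sqrt R)) => //.
    by apply: continuous_measurable_fun; exact: sqrt_continuous.
  by move: Si; congr (integrable _ _ (EFin \o _)); apply/funext => x; rewrite sqr_sqrtr.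
(* Triangle inequality: a partial derivative of [phi k] differs from that of [w] by at most the root
   of the error [f k]. *)
exists phi, (fun x => enorm (wgrad D w x) + Num.sqrt (S x)); split=> //.
  by apply: square_integrableD => //; exact: enorm_L2.
apply: filterS aeS => x /[apply] -[fS fc].
have sqrt0 (v : nat -> R) : (forall k, v k ^+ 2 <= f k x) -> v @ \oo --> (0 : R).
  move=> vf; apply/cvgr0Pnorm_le => e e0.
  have e20 : 0 < e ^+ 2 by rewrite exprn_gt0.
  have /cvgr0Pnorm_le/(_ _ e20) := fc; apply: filterS => k; rewrite ger0_norm// => fe.
  rewrite -(@ler_pXn2r _ 2)// ?nnegrE ?(ltW e0)// -normrX ger0_norm ?sqr_ge0//.
  exact: le_trans (vf k) fe.
have di k i : (wgrad D w x ord0 i - partial i (phi k) x) ^+ 2 <= f k x.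
  have := coord_le_enorm (wgrad D w x - grad (phi k) x) i; rewrite !mxE => H.
  rewrite -(real_normK (num_real _)) (@le_trans _ _ (enorm (wgrad D w x - grad (phi k) x)
    ^+ 2))//.
    by rewrite lerXn2r// nnegrE enorm_ge0.
  by rewrite lerDr sqr_ge0.
split.
- have H : (fun k => w x - phi k x) @ \oo --> (0 : R) by apply: sqrt0 => k;
    rewrite lerDl sqr_ge0.
  exact: cvg_sub0 H.
- move=> i.
  have H : (fun k => wgrad D w x ord0 i - partial i (phi k) x) @ \oo --> (0 : R).
    by apply: sqrt0 => k; exact: di.
  exact: cvg_sub0 H.
- move=> k i; have -> : partial i (phi k) x = wgrad D w x ord0 i - (wgrad D w x ord0 i -
    partial i (phi k) x).
    by rewrite opprB addrC subrK.
  rewrite (le_trans (ler_normB _ _))// lerD ?coord_le_enorm//.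
  rewrite -sqrtr_sqr ler_sqrt// (le_trans (di k i))//.
Qed.

End approximation.

(** * Smooth bounded truncations *)

Section trunc.
Variable R : realType.
Implicit Types a t : R.

(* The test functions [trunc a \o phi] replace max(phi, 0): [trunc a] is smooth,
   bounded, vanishes on t <= 0 and has slope [dtrunc a] in [0, 1]; as a goes to
   +oo it tends to the positive part. *)
Definition trunc a t : R := a * (1 - expR (- (t * expinv 1 (a * t) / a))).

Definition dtrunc a t : R :=
  expR (- (t * expinv 1 (a * t) / a)) * (expinv 1 (a * t) + t * (a * expinv 'X^2 (a * t))).

Lemma smooth1_expR : smooth1 (@expR R).
Proof. by exists (fun=> expR) => // k t; exact: is_derive_expR. Qed.

Lemma expinv1_derive t : is_derive t 1 (expinv (1 : {poly R})) (expinv 'X^2 t).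
Proof. by have := is_derive_expinv 1 t; rewrite derivC subr0 mulr1. Qed.

Lemma is_derive_trunc a t : a != 0 -> is_derive t 1 (trunc a) (dtrunc a t).
Proof.
move=> a0.
have d1 : is_derive t 1 (fun s : R => a * s) a.
  by apply: is_derive_eq; rewrite /GRing.scale/= mulr1.
have d2 := @is_derive1_comp R (expinv 1) (fun s => a * s) t _ _ (expinv1_derive _) d1.
have d3 : is_derive t 1 (fun s : R => s * expinv 1 (a * s)) (t * (expinv 'X^2 (a * t) * a)
  + expinv 1 (a * t)).
  by apply: (is_derive_eq (is_deriveM (is_derive_id t 1) d2)); rewrite /GRing.scale/= mulr1.
have d4 : is_derive t 1 (fun s : R => - (s * expinv 1 (a * s) / a)) (- (t * (expinv 'X^2 (a
  * t) * a) + expinv 1 (a * t)) / a).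
  rewrite (_ : (fun _ => _) = (fun s => (- a^-1) * (s * expinv 1 (a * s)))); last first.
    by apply/funext => s; rewrite mulNr mulrC.
  by apply: (is_derive_eq (is_deriveZ (- a^-1) d3));
    rewrite /GRing.scale/= mulNr mulrC mulNr.
have d5 := @is_derive1_comp R expR _ t _ _ (is_derive_expR _) d4.
have d6 : is_derive t 1 (trunc a) (a * - (expR (- (t * expinv 1 (a * t) / a)) * (- (t *
  (expinv 'X^2 (a * t) * a) + expinv 1 (a * t)) / a))).
  have d6' : is_derive t 1 (fun s : R => 1 - expR (- (s * expinv 1 (a * s) / a))) _ :=
    is_deriveB (@is_derive_cst R R R 1 t 1) d5.
  by apply: (is_derive_eq (is_deriveZ a d6')); rewrite /GRing.scale/= sub0r.
apply: (is_derive_eq d6); rewrite /dtrunc; field; exact: a0.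
Qed.

Lemma continuous_trunc a : a != 0 -> continuous (trunc a).
Proof. by move=> a0; exact: (is_derive1_continuous (fun t => is_derive_trunc t a0)). Qed.

Lemma continuous_expinv (p : {poly R}) : continuous (expinv p).
Proof. exact/smooth1_continuous/smooth1_expinv. Qed.

Lemma continuous_dtrunc a : continuous (dtrunc a).
Proof.
have cm : continuous (fun t => a * t).
  by move=> t; apply: (@continuousM _ _ (fun=> a) id);
    [exact: cst_continuous|exact: cvg_id].
have ce p : continuous (fun t => expinv p (a * t)).
  by move=> t; apply: (@continuous_comp _ _ _ (fun t => a * t) (expinv p));
    [exact: cm|exact: continuous_expinv].
have cf p : continuous (fun t => t * expinv p (a * t)).
  by move=> t; apply: (@continuousM _ _ id (fun t => expinv p (a * t)));
    [exact: cvg_id|exact: ce].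
have cg : continuous (fun t => - (t * expinv 1 (a * t) / a)).
  move=> t; apply: (@continuousN _ _ _ (fun t => t * expinv 1 (a * t) / a)).
  by apply: (@continuousM _ _ (fun t => t * expinv 1 (a * t)) (fun=> a^-1));
    [exact: cf|exact: cst_continuous].
have ch : continuous (fun t => t * (a * expinv 'X^2 (a * t))).
  move=> t; apply: (@continuousM _ _ id (fun t => a * expinv 'X^2 (a * t)));
    first exact: cvg_id.
  by apply: (@continuousM _ _ (fun=> a) (fun t => expinv 'X^2 (a * t)));
    [exact: cst_continuous|exact: ce].
move=> t; apply: (@continuousM _ _ (fun t => expR (- (t * expinv 1 (a * t) / a))) (fun t =>
  expinv 1 (a * t) + t * (a * expinv 'X^2 (a * t)))).
  by apply: (@continuous_comp _ _ _ _ expR); [exact: cg|exact: continuous_expR].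
by apply: (@continuousD _ _ _ (fun t => expinv 1 (a * t))); [exact: ce|exact: ch].
Qed.

Lemma trunc_le0 a t : 0 < a -> t <= 0 -> trunc a t = 0.
Proof.
move=> a0 t0; rewrite /trunc expinv_eq0; first
  by rewrite mulr0 mul0r oppr0 expR0 subrr mulr0.
by rewrite pmulr_rle0.
Qed.

Lemma dtrunc_le0 a t : 0 < a -> t <= 0 -> dtrunc a t = 0.
Proof.
move=> a0 t0; rewrite /dtrunc !expinv_eq0 ?pmulr_rle0//.
by rewrite !mulr0 addr0 mulr0.
Qed.

Lemma dtrunc_gt0E a t : 0 < a -> 0 < t ->
  dtrunc a t = expR (- (t * expinv 1 (a * t) / a)) * (expinv 1 (a * t) * (1 + (a * t)^-1)).
Proof.
move=> a0 t0; have at0 : 0 < a * t by rewrite mulr_gt0.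
rewrite /dtrunc /expinv at0 hornerC hornerXn mul1r; congr (_ * _).
by field; rewrite gt_eqF//= gt_eqF.
Qed.

(** For t > 0 put s = 1 / (a t): the slope is an exponential at most 1 times exp (- s) (1 + s), and
    1 + s <= exp s. *)
Lemma dtrunc_bound a t : 0 < a -> 0 <= dtrunc a t <= 1.
Proof.
move=> a0; have [t0|t0] := leP t 0; first by rewrite dtrunc_le0// lexx ler01.
have at0 : 0 < a * t by rewrite mulr_gt0.
rewrite dtrunc_gt0E//; apply/andP; split.
  by rewrite !mulr_ge0 ?expR_ge0 ?expinv1_ge0// addr_ge0// invr_ge0 ltW.
rewrite mulr_ile1 ?expR_ge0//.
- by rewrite mulr_ge0 ?expinv1_ge0// addr_ge0// invr_ge0 ltW.
- by rewrite expR_le1 oppr_le0 !mulr_ge0 ?expinv1_ge0 ?invr_ge0// ltW.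
- rewrite /expinv at0 hornerC mul1r expRN mulrC ler_pdivrMr ?expR_gt0// mul1r.
  exact: expR_ge1Dx.
Qed.

Lemma trunc_ge0 a t : 0 < a -> 0 <= trunc a t.
Proof.
move=> a0; have [t0|t0] := leP t 0; first by rewrite trunc_le0.
rewrite /trunc mulr_ge0 ?(ltW a0)// subr_ge0 expR_le1 oppr_le0.
by rewrite !mulr_ge0 ?expinv1_ge0 ?invr_ge0// ltW.
Qed.

Lemma trunc_lea a t : 0 < a -> trunc a t <= a.
Proof. by move=> a0; rewrite /trunc ger_pMr// gerBl expR_ge0. Qed.

Lemma trunc_let a t : 0 < a -> 0 <= t -> trunc a t <= t.
Proof.
move=> a0 t0; rewrite /trunc.
apply: (@le_trans _ _ (a * (t * expinv 1 (a * t) / a))).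
  rewrite ler_pM2l// lerBlDr -lerBlDl.
  by have := expR_ge1Dx (- (t * expinv 1 (a * t) / a)).
rewrite mulrCA divff ?gt_eqF// mulr1 ler_piMr ?expinv1_le1//.
Qed.

Lemma expinv1_cvg0 t : 0 < t -> (fun k : nat => expinv 1 (k.+1%:R * t)) @ \oo --> (1 : R).
Proof. by move=> t0; have := @expinv1_cvg R t 0 t0; under eq_fun do rewrite subr0. Qed.

Lemma invS_cvg0 : (fun k : nat => k.+1%:R^-1 : R) @ \oo --> (0 : R).
Proof. exact: cvg_harmonic. Qed.

Lemma expR_arg_cvg t : 0 < t ->
  (fun k : nat => t * expinv 1 (k.+1%:R * t) / k.+1%:R) @ \oo --> (0 : R).
Proof.
move=> t0; have := cvgM (cvgM (cvg_cst t) (expinv1_cvg0 t0)) invS_cvg0.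
by rewrite mulr0; exact.
Qed.

Lemma dtrunc_cvg t : (fun k : nat => dtrunc k.+1%:R t) @ \oo --> ((0 < t)%R%:R : R).
Proof.
have [t0|t0] := ltP 0 t; last first.
  by under eq_fun do rewrite dtrunc_le0//; exact: cvg_cst.
under eq_fun do rewrite dtrunc_gt0E//.
have c1 : (fun k : nat => expR (- (t * expinv 1 (k.+1%:R * t) / k.+1%:R))) @ \oo --> (1 :
  R).
  have := cvgN (expR_arg_cvg t0); rewrite oppr0 => /(_ _) cN.
  have ce : {for (0 : R), continuous (@expR R)} by exact: continuous_expR.
  by have := continuous_cvg _ ce cN; rewrite expR0; apply.
have c2 : (fun k : nat => 1 + (k.+1%:R * t)^-1) @ \oo --> (1 : R).
  rewrite -[X in _ --> X]addr0; apply: cvgD; first exact: cvg_cst.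
  rewrite -[X in _ --> X](mul0r t^-1); under eq_fun do rewrite invfM.
  by apply: cvgM; [exact: invS_cvg0|exact: cvg_cst].
have := cvgM c1 (cvgM (expinv1_cvg0 t0) c2); rewrite !mulr1; exact.
Qed.

(** With a = k + 1 and P = t [expinv 1 (a * t)], the inequality exp y >= 1 + y gives [trunc a t] >=
    a (1 - 1 / (1 + P / a)) = P / (1 + P / a), which tends to [t]; the upper bound is [t] itself. *)
Lemma trunc_cvg t : 0 <= t -> (fun k : nat => trunc k.+1%:R t) @ \oo --> t.
Proof.
rewrite le_eqVlt => /orP[/eqP <-|t0].
  by under eq_fun do rewrite trunc_le0//; exact: cvg_cst.
pose P k := t * expinv 1 (k.+1%:R * t).
have cl : (fun k : nat => P k / (1 + P k / k.+1%:R)) @ \oo --> t.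
  rewrite -[X in _ --> X]divr1; apply: cvgM.
    by rewrite -[X in _ --> X]mulr1; apply: cvgM; [exact: cvg_cst|exact: expinv1_cvg0].
  apply: cvgV; first exact: oner_neq0.
  by rewrite -[X in _ --> X]addr0; apply: cvgD; [exact: cvg_cst|exact: expR_arg_cvg].
apply: squeeze_cvgr cl (cvg_cst t).
apply: nearW => k; rewrite trunc_let ?(ltW t0)// andbT.
have P0 : 0 <= P k by rewrite mulr_ge0 ?expinv1_ge0// ltW.
have k0 : 0 < k.+1%:R :> R by [].
have Pk0 : 0 <= P k / k.+1%:R by rewrite divr_ge0.
rewrite /trunc -/(P k) expRN.
have H : (expR (P k / k.+1%:R))^-1 <= (1 + P k / k.+1%:R)^-1.
  by rewrite lef_pV2 ?posrE ?expR_gt0 ?ltr_pwDl// expR_ge1Dx.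
apply: (@le_trans _ _ (k.+1%:R * (1 - (1 + P k / k.+1%:R)^-1))); last first.
  by rewrite ler_pM2l// lerD2l lerN2.
rewrite le_eqVlt; apply/orP; left; apply/eqP; field.
by rewrite gt_eqF//= gt_eqF// ltr_wpDr.
Qed.

Lemma trunc_test n (D : set 'rV[R]_n) a phi : 0 < a -> test_fun D phi ->
  test_fun D (fun x => trunc a (phi x)).
Proof.
move=> a0 tp; apply: (test_fun_sub tp).
  move=> k; have sp := test_fun_smooth tp k.
  apply: CkM; first exact: Ck_cst.
  apply: CkD; first exact: Ck_cst.
  rewrite (_ : (fun x => - expR _) = (fun x : 'rV[R]_n =>
    -1 * expR (- a^-1 * (phi x * expinv 1 (a * phi x))))); last first.
    by apply/funext => x; rewrite mulN1r; congr (- expR _); rewrite mulNr mulrC.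
  apply: CkM; first exact: Ck_cst.
  apply: Ck_comp; first exact: smooth1_expR.
  apply: CkM; first exact: Ck_cst.
  apply: CkM => //; apply: Ck_comp; first exact: smooth1_expinv.
  by apply: CkM => //; exact: Ck_cst.
move=> x hx; apply: subset_closure => /=; apply: contra_neq hx => ->.
by rewrite trunc_le0.
Qed.

Lemma partial_trunc n a (phi : 'rV[R]_n -> R) i x : a != 0 -> smooth phi ->
  partial i (fun x => trunc a (phi x)) x = dtrunc a (phi x) * partial i phi x.
Proof.
move=> a0 sp.
by have [_ <-] := is_derive_comp1 (is_derive_trunc (phi x) a0) (smooth_der i x sp).
Qed.

End trunc.

(** * The maximum principle *)

Section cauchy_schwarz.
Variables (R : realType) (n : nat).
Implicit Types x y : 'rV[R]_n.

(** The sum of the squares of |t| z_i - |z| t_i equals 2 |z| |t| (|z| |t| - z . t). If |z| |t| = 0,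
    one of the vectors is 0. *)
Lemma dotrV_le_enorm x y : `|dotrV x y| <= enorm x * enorm y.
Proof.
have H z t : dotrV z t <= enorm z * enorm t.
  have s0 : 0 <= \sum_i (enorm t * z ord0 i - enorm z * t ord0 i) ^+ 2
    by apply: sumr_ge0 => i _; exact: sqr_ge0.
  have sE : \sum_i (enorm t * z ord0 i - enorm z * t ord0 i) ^+ 2 =
      2 * (enorm z * enorm t) * (enorm z * enorm t - dotrV z t).
    transitivity (\sum_i (enorm t ^+ 2 * (z ord0 i * z ord0 i) + (- (2 * enorm t * enorm
      z)) * (z ord0 i * t ord0 i) + enorm z ^+ 2 * (t ord0 i * t ord0 i))).
      by apply: eq_bigr => i _; ring.
    rewrite !big_split/= -!mulr_sumr -/(dotrV z z) -/(dotrV z t) -/(dotrV t t) -!enorm_sqr;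
      ring.
  have [zt0|zt0] := eqVneq (enorm z * enorm t) 0; last first.
    have p : 0 < enorm z * enorm t by rewrite lt_neqAle eq_sym zt0 mulr_ge0 ?enorm_ge0.
    by rewrite -subr_ge0 -(pmulr_rge0 _ (_ : 0 < 2 * (enorm z * enorm t)))// -?sE//
      mulr_gt0.
  rewrite zt0 /dotrV big1// => i _.
  move/eqP: zt0; rewrite mulf_eq0 => /orP[]/eqP e0.
    by have := coord_le_enorm z i; rewrite e0 normr_le0 => /eqP ->; rewrite mul0r.
  by have := coord_le_enorm t i; rewrite e0 normr_le0 => /eqP ->; rewrite mulr0.
have HN : - dotrV x y = dotrV (- x) y.
  by rewrite /dotrV -sumrN; apply: eq_bigr => i _; rewrite mxE mulNr.
have eN : enorm (- x) = enorm x.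
  by rewrite /enorm; congr Num.sqrt; apply: eq_bigr => i _; rewrite !mxE mulrNN.
by rewrite ler_norml lerNl HN -{1}eN !H.
Qed.

End cauchy_schwarz.

(** * Limits along the approximants, at a fixed truncation level *)

Section limits.
Variables (R : realType) (n : nat).
Local Notation D := (@unit_ball R n).
Local Notation mu := (lebesgue_rV R n).
Local Notation L2 := (square_integrable mu D).
Let mD : measurable D := @measurable_unit_ball R n.
Let Dy : (mu D < +oo)%E := @unit_ball_fin R n.

Variables (w : 'rV[R]_n -> R) (phi : nat -> 'rV[R]_n -> R) (Gam : 'rV[R]_n -> R).
Hypothesis hw : H1 D w.
Hypothesis tp : forall k, test_fun D (phi k).
Hypothesis G2 : L2 Gam.
Hypothesis aeH : {ae mu, forall x, D x -> [/\ (fun k => phi k x) @ \oo --> w x,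
        (forall i, (fun k => partial i (phi k) x) @ \oo --> wgrad D w x ord0 i) &
        forall k i, `|partial i (phi k) x| <= Gam x]}.
Local Notation gw := (wgrad D w).

Let w2 : L2 w. Proof. by case: hw => /Lp2P. Qed.
Let gw2 : forall i, L2 (fun x => gw x ord0 i). Proof. by have [] := wgradP hw. Qed.

Let mh (h : R -> R) (f : 'rV[R]_n -> R) : continuous h -> measurable_fun D f ->
  measurable_fun D (fun x => h (f x)).
Proof. by move=> ch mf; apply: (measurableT_comp _ mf);
  exact: continuous_measurable_fun. Qed.

(* Test the definition of gz against [expinv 1 (phi k) * psi]: in the limit the
   left-hand side only involves products of z with functions of w that vanish on
   w <= 0, so that gz * expinv 1 w is orthogonal to every test function. *)
Lemma weak_grad_disjoint (z : 'rV[R]_n -> R) (gz : 'rV[R]_n -> 'rV[R]_n) :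
  L2 z -> (forall i, L2 (fun x => gz x ord0 i)) -> weak_grad D z gz ->
  (forall x, z x = 0 \/ w x <= 0) ->
  {ae mu, forall x, D x -> 0 < w x -> gz x = 0}.
Proof.
move=> z2 gz2 wz zw.
(* [C] bounds the derivative of [expinv 1]; it enters the domination of the gradients of the test
   functions [chi k]. *)
have [C C0 e'C] := expinv_bounded ('X^2 : {poly R}).
have ce p : continuous (expinv (p : {poly R})) by exact: continuous_expinv.
have coord i : {ae mu, forall x, D x -> gz x ord0 i * expinv 1 (w x) = 0}.
  have mgz : measurable_fun D (fun x => gz x ord0 i) by case: (gz2 i).
  have mew : measurable_fun D (fun x => expinv 1 (w x)) by apply: mh => //; case: w2.
  apply: du_bois_reymond.
    apply: (dominated_integrable mD _ (square_integrable_integrable mD Dy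
      (square_integrable_norm mD (gz2 i)))).
      exact: measurable_funM.
    apply: aeW => x _; rewrite normrM -[leRHS]mulr1 ler_wpM2l//.
    by rewrite ger0_norm ?expinv1_ge0// expinv1_le1.
  move=> psi tpsi.
  have [C1 C10 pC1] := test_fun_bounded tpsi.
  have [C2 C20 pC2] := test_fun_bounded (test_fun_partial i tpsi).
  have spsi := test_fun_smooth tpsi.
  have mpsi : measurable_fun D psi := test_fun_measurable tpsi.
  have mdpsi : measurable_fun D (partial i psi) :=
    test_fun_measurable (test_fun_partial i tpsi).
  have sphi k := test_fun_smooth (tp k).
  have mphi k : measurable_fun D (phi k) := test_fun_measurable (tp k).
  have mdphi k : measurable_fun D (partial i (phi k)) :=
    test_fun_measurable (test_fun_partial i (tp k)).
  have sep k : smooth (fun x => expinv 1 (phi k x)) by move=> j;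
    exact: (Ck_comp (smooth1_expinv 1) (sphi k j)).
  pose chi k x := expinv 1 (phi k x) * psi x.
  have tchi k : test_fun D (chi k) by exact: test_funMl.
  have dchi k x : partial i (chi k) x = expinv 1 (phi k x) * partial i psi x +
      psi x * (expinv 'X^2 (phi k x) * partial i (phi k) x).
    have [_ <-] := is_deriveM (is_derive_comp1 (expinv1_derive (phi k x)) (smooth_der i x
      (sphi k))) (smooth_der i x spsi).
    by [].
  have [|||||_ L] := @Rdominated_convergence _ _ R mu D mD
     (fun k x => z x * partial i (chi k) x) (fun x => 0)
     (fun x => `|z x| * (C2 + C1 * C * Gam x)).
  - move=> k; apply: measurable_funM; first by case: z2.
    exact: (test_fun_measurable (test_fun_partial i (tchi k))).
  - exact: measurable_cst.
  - apply: filterS aeH => x H Dx; have [c1 c2 _] := H Dx.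
    have c3 : (fun k => expinv 1 (phi k x)) @ \oo --> expinv 1 (w x)
      by apply: continuous_cvg => //; exact: ce.
    have c4 : (fun k => expinv 'X^2 (phi k x)) @ \oo --> expinv 'X^2 (w x)
      by apply: continuous_cvg => //; exact: ce.
    have := cvgM (cvg_cst (z x)) (cvgD (cvgM c3 (cvg_cst (partial i psi x)))
      (cvgM (cvg_cst (psi x)) (cvgM c4 (c2 i)))).
    under [X in _ -> X @ _ --> _]eq_fun do rewrite dchi.
    have -> : z x * (expinv 1 (w x) * partial i psi x + psi x * (expinv 'X^2 (w x) * gw x
      ord0 i)) = 0.
      by have [->|w0] := zw x; rewrite ?mul0r// !expinv_eq0// !mul0r mulr0 addr0 mulr0.
    exact.
  - apply: square_integrableM => //; first exact: square_integrable_norm.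
    apply: square_integrableD => //.
      by apply: (@square_integrable_bounded _ _ _ _ _ _ _ `|C2|).
    by apply: (@square_integrableMl _ _ _ _ _ _ (fun=> C1 * C) _ `|C1 * C|).
  - apply: filterS aeH => x H Dx k; have [_ _ dG] := H Dx.
    rewrite dchi normrM ler_wpM2l// (le_trans (ler_normD _ _))// lerD//.
      by rewrite normrM -[leRHS]mul1r ler_pM// ger0_norm ?expinv1_ge0// expinv1_le1.
    by rewrite !normrM -mulrA ler_pM// ?mulr_ge0// ler_pM.
  (* The same integrals, seen through the weak gradient of [z], tend to the integral to be shown
     null; uniqueness of the limit concludes. *)
  have [|||||_ L'] := @Rdominated_convergence _ _ R mu D mD
     (fun k x => gz x ord0 i * chi k x) (fun x => gz x ord0 i * expinv 1 (w x) * psi x)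
     (fun x => `|gz x ord0 i| * C1).
  - by move=> k; apply: measurable_funM => //; exact: (test_fun_measurable (tchi k)).
  - by apply: measurable_funM => //; exact: measurable_funM.
  - apply: filterS aeH => x H Dx; have [c1 _ _] := H Dx.
    have c3 : (fun k => expinv 1 (phi k x)) @ \oo --> expinv 1 (w x)
      by apply: continuous_cvg => //; exact: ce.
    have := cvgM (cvg_cst (gz x ord0 i)) (cvgM c3 (cvg_cst (psi x))); rewrite mulrA; exact.
  - apply: square_integrableM => //; first exact: square_integrable_norm.
    by apply: (@square_integrable_bounded _ _ _ _ _ _ _ `|C1|).
  - apply: aeW => x Dx k; rewrite normrM ler_wpM2l// normrM -[leRHS]mul1r.
    by rewrite ler_pM// ger0_norm ?expinv1_ge0// expinv1_le1.
  move: L; under eq_fun do rewrite wz//.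
  rewrite Rintegral_cst// mul0r => /cvgN; rewrite oppr0 => /(_ _) L0.
  have {}L0 : (fun k => \int[mu]_(x in D) (gz x ord0 i * chi k x)) @ \oo --> (0 : R).
    by move: L0; rewrite [X in X @ _ --> _ -> _](_ : _ = fun k =>
      \int[mu]_(x in D) (gz x ord0 i * chi k x)) //; apply/funext => k /=; rewrite opprK.
  by apply: (cvg_unique _ L' L0).
have : {ae mu, forall x, forall i, D x -> gz x ord0 i * expinv 1 (w x) = 0}
  by exact: filter_forall.
apply: filterS => x H Dx w0; apply/rowP => i; rewrite mxE.
by have /eqP := H i Dx; rewrite mulf_eq0 (gt_eqF (expinv1_gt0 w0)) orbF => /eqP.
Qed.

Lemma cvg_sum_ord (m : nat) (v : nat -> 'I_m -> R) (l : 'I_m -> R) :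
  (forall i, (fun k => v k i) @ \oo --> l i) ->
  (fun k => \sum_(i < m) v k i) @ \oo --> \sum_(i < m) l i.
Proof.
elim: m v l => [|m IH] v l vl.
  by under eq_fun do rewrite big_ord0; rewrite big_ord0; exact: cvg_cst.
under eq_fun do rewrite big_ord_recl; rewrite big_ord_recl.
by apply: cvgD; [exact: vl|apply: (IH (fun k i => v k (lift ord0 i))) => i; exact: vl].
Qed.

Section truncation.
Variable a : R.
Hypothesis a0 : 0 < a.
Let a0' : a != 0. Proof. by rewrite gt_eqF. Qed.

Lemma grad_trunc k i x : grad (fun y => trunc a (phi k y)) x ord0 i =
  dtrunc a (phi k x) * partial i (phi k) x.
Proof. by rewrite mxE (partial_trunc _ _ a0' (test_fun_smooth (tp k))). Qed.

Let cvg_grad_trunc : {ae mu, forall x, D x -> (forall i, 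
  (fun k => grad (fun y => trunc a (phi k y)) x ord0 i) @ \oo --> dtrunc a (w x) * gw x
    ord0 i) /\
  forall k i, `|grad (fun y => trunc a (phi k y)) x ord0 i| <= Gam x}.
Proof.
apply: filterS aeH => x H Dx; have [c1 c2 dG] := H Dx; split=> [i|k i].
  under eq_fun do rewrite grad_trunc; apply: cvgM; last exact: c2.
  by apply: continuous_cvg => //; exact: continuous_dtrunc.
have /andP[d0 d1] := dtrunc_bound (phi k x) a0.
by rewrite grad_trunc normrM (ger0_norm d0) -[leRHS]mul1r ler_pM.
Qed.

Let mgrad_trunc k i : measurable_fun D (fun x => grad (fun y =>
  trunc a (phi k y)) x ord0 i).
Proof. by have [] := test_fun_grad_L2 i (trunc_test a0 (tp k)). Qed.

Let mdtw : measurable_fun D (fun x => dtrunc a (w x)).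
Proof. by apply: mh; [exact: continuous_dtrunc|case: w2]. Qed.

Let mtw : measurable_fun D (fun x => trunc a (w x)).
Proof. by apply: mh; [exact: continuous_trunc|case: w2]. Qed.

Let mgw i : measurable_fun D (fun x => gw x ord0 i). Proof. by case: (gw2 i). Qed.

(** Since the slopes lie in [0, 1], the gradients of the truncations are still dominated by [Gam],
    and a product of two functions in L2 is integrable. *)
Lemma energy_limit (h : 'rV[R]_n -> 'rV[R]_n) : (forall i, L2 (fun x => h x ord0 i)) ->
  (fun k => \int[mu]_(x in D) dotrV (h x) (grad (fun y => trunc a (phi k y)) x)) @ \oo -->
  \int[mu]_(x in D) (dtrunc a (w x) * dotrV (h x) (gw x)).
Proof.
move=> h2; have mhi i : measurable_fun D (fun x => h x ord0 i) by case: (h2 i).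
have [|||||_] := @Rdominated_convergence _ _ R mu D mD
  (fun k x => dotrV (h x) (grad (fun y => trunc a (phi k y)) x))
  (fun x => dtrunc a (w x) * dotrV (h x) (gw x))
  (fun x => (\sum_i `|h x ord0 i|) * Gam x); last exact.
- by move=> k; exact: measurable_dotrV.
- by apply: measurable_funM => //; exact: measurable_dotrV.
- apply: filterS cvg_grad_trunc => x H Dx; have [c _] := H Dx.
  rewrite /dotrV mulr_sumr; apply: cvg_sum_ord => i; rewrite mulrCA.
  by apply: cvgM; [exact: cvg_cst|exact: c].
- apply: square_integrableM => //; apply: square_integrable_sum => // i.
  exact: square_integrable_norm.
- apply: filterS cvg_grad_trunc => x H Dx k; have [_ dG] := H Dx.
  rewrite (le_trans (ler_norm_sum _ _ _))// mulr_suml ler_sum// => i _.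
  by rewrite normrM ler_wpM2l.
Qed.

(** The bound [trunc a <= a] makes plain integrability of [f] sufficient; [f] will be the scalar
    product of the drift and the gradient of [u]. *)
Lemma drift_limit (f : 'rV[R]_n -> R) : mu.-integrable D (EFin \o f) ->
  (fun k => \int[mu]_(x in D) (f x * trunc a (phi k x))) @ \oo -->
  \int[mu]_(x in D) (f x * trunc a (w x)).
Proof.
move=> fi; have mf : measurable_fun D f by have /measurable_EFinP := measurable_int _ fi.
have [|||||_] := @Rdominated_convergence _ _ R mu D mD
  (fun k x => f x * trunc a (phi k x)) (fun x => f x * trunc a (w x))
  (fun x => `|f x| * a); last exact.
- by move=> k; exact: (measurable_funM mf (test_fun_measurable (trunc_test a0 (tp k)))).
- exact: measurable_funM.
- apply: filterS aeH => x H Dx; have [c _ _] := H Dx; apply: cvgM; first exact: cvg_cst.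
  by apply: continuous_cvg => //; exact: continuous_trunc.
- have := integrableZr mD a (integrable_norm fi).
  by congr (integrable _ _ _); apply/funext => x /=.
- by apply: aeW => x Dx k; rewrite normrM ler_wpM2l// ger0_norm ?trunc_ge0// trunc_lea.
Qed.

(** Both sides of [sobolev] for the truncated approximants converge: the left is dominated by the
    constant a^q, the gradients on the right by n Gam^2. *)
Lemma sobolev_limit (n3 : (3 <= n)%N) (q := sobolev_exp R n) :
  \int[mu]_(x in D) (trunc a (w x) `^ q) <= sobolev_cst R n `^ q *
    (\int[mu]_(x in D) (dtrunc a (w x) * enorm (gw x)) ^+ 2) `^ (q / 2).
Proof.
have q0 : 0 < q by rewrite /q /sobolev_exp divr_gt0 ?subr_gt0 ?ltr_nat// mulr_gt0// ltr0n
  (leq_trans _ n3).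
have mpow (f : 'rV[R]_n -> R) : measurable_fun D f -> measurable_fun D (fun x => f x `^ q).
  by move=> mf; exact: (measurableT_comp (measurable_powR q) mf).
have powa (t : R) : trunc a t `^ q <= a `^ q.
  by rewrite ge0_ler_powR ?nnegrE ?(ltW q0) ?(ltW a0) ?trunc_ge0// trunc_lea.
have [|||||_ cL] := @Rdominated_convergence _ _ R mu D mD
  (fun k x => trunc a (phi k x) `^ q) (fun x => trunc a (w x) `^ q) (fun=> a `^ q).
- by move=> k; apply: mpow; exact: (test_fun_measurable (trunc_test a0 (tp k))).
- exact: mpow.
- apply: filterS aeH => x H Dx; have [c _ _] := H Dx.
  have c1 : (fun k => trunc a (phi k x)) @ \oo --> trunc a (w x).
    by apply: continuous_cvg => //; exact: continuous_trunc.
  have cp : {for trunc a (w x), continuous (fun t : R => `|t| `^ q)}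
    by exact: continuous_powR_norm.
  have := continuous_cvg _ cp c1.
  rewrite ger0_norm ?trunc_ge0// => c2.
  rewrite (_ : (fun k => _) = fun k => `|trunc a (phi k x)| `^ q); first exact: c2.
  by apply/funext => k; rewrite ger0_norm ?trunc_ge0.
- by apply: (bounded_integrable (C := `|a `^ q|)).
- by apply: aeW => x Dx k; rewrite ger0_norm ?powR_ge0.
have [|||||_ cR] := @Rdominated_convergence _ _ R mu D mD
  (fun k x => enorm (grad (fun y => trunc a (phi k y)) x) ^+ 2)
  (fun x => (dtrunc a (w x) * enorm (gw x)) ^+ 2) (fun x => n%:R * (Gam x * Gam x)).
- by move=> k; apply: measurable_funX; exact: measurable_enorm.
- by apply: measurable_funX; apply: measurable_funM => //; exact: measurable_enorm.
- apply: filterS cvg_grad_trunc => x H Dx; have [c _] := H Dx.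
  under eq_fun do rewrite enorm_sqr; rewrite exprMn enorm_sqr /dotrV mulr_sumr.
  by apply: cvg_sum_ord => i; rewrite expr2 mulrACA; apply: cvgM; exact: c.
- have := integrableZl mD n%:R (square_integrableM mD G2 G2).
  by congr (integrable _ _ _); apply/funext => x /=.
- apply: filterS cvg_grad_trunc => x H Dx k; have [_ dG] := H Dx.
  rewrite ger0_norm ?sqr_ge0// enorm_sqr /dotrV.
  rewrite (@le_trans _ _ (\sum_(i < n) (Gam x * Gam x)))//; last first.
    by rewrite sumr_const card_ord mulr_natl.
  apply: ler_sum => i _; rewrite -expr2 -(real_normK (num_real _)) expr2.
  by rewrite ler_pM.
have cR' : (fun k => sobolev_cst R n `^ q *
     (\int[mu]_(x in D) enorm (grad (fun y =>
       trunc a (phi k y)) x) ^+ 2) `^ (q / 2)) @ \oo -->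
   sobolev_cst R n `^ q * (\int[mu]_(x in D) (dtrunc a (w x) * enorm (gw x)) ^+ 2) `^ (q /
     2).
  apply: cvgM; first exact: cvg_cst.
  have q2 : 0 < q / 2 by rewrite divr_gt0.
  have cp : continuous (fun t : R => `|t| `^ (q / 2)) by exact: continuous_powR_norm.
  have := continuous_cvg _ (cp _) cR.
  rewrite ger0_norm; last by apply: Rintegral_ge0 => x _; rewrite sqr_ge0.
  move=> c2; rewrite (_ : (fun k => _) = fun k => `|\int[mu]_(x in D) enorm (grad (fun y =>
    trunc a (phi k y)) x) ^+ 2| `^ (q / 2)); first exact: c2.
  by apply/funext => k; rewrite ger0_norm// Rintegral_ge0// => x _; rewrite sqr_ge0.
apply: (ler_cvg_to cL cR'); apply: nearW => k.
have := sobolev n3 (trunc_test a0 (tp k)) (fun x => trunc_ge0 (phi k x) a0).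
have ttk := trunc_test a0 (tp k).
rewrite integral_supp; last first.
  by move=> x Dx; rewrite (test_fun_supp ttk Dx) powR0// gt_eqF.
rewrite [X in (_ <= _ * X `^ _)%E]integral_supp; last first.
  move=> x Dx; rewrite enorm_sqr /dotrV big1// => i _.
  by rewrite mxE (test_fun_supp (test_fun_partial i ttk) Dx) mulr0.
have f1 : (\int[mu]_(x in D) (trunc a (phi k x) `^ q)%:E)%E \is a fin_num.
  apply: integrable_fin_num => //; apply: (bounded_integrable (C := a `^ q)).
    exact: (measurableT_comp (measurable_powR q) (test_fun_measurable ttk)).
  by move=> x; rewrite ger0_norm ?powR_ge0.
have f2 : (\int[mu]_(x in D) (enorm (grad (fun y =>
  trunc a (phi k y)) x) ^+ 2)%:E)%E \is a fin_num.
  apply: integrable_fin_num => //.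
  by have [] := enorm_L2 (fun i => test_fun_grad_L2 i ttk).
by rewrite -(fineK f1) -(fineK f2) poweR_EFin -EFinM lee_fin.
Qed.

End truncation.

End limits.

(** * Hölder's inequality with three factors *)

Section holder_three.
Context d (T : measurableType d) (R : realType) (mu : {measure set T -> \bar R}).

(** Hölder with weights 1 - 2 / N and 2 / N bounds the integral of (be om)^2 by (K g)^2 A, because q
    (1 - 2 / N) = 2; Cauchy-Schwarz with [al] then gives K g A. The bound on [om] has the shape of
    Sobolev's inequality, so the result is linear in the energy [A]. *)
Lemma holder_three (al be om : T -> R) (N K g A : R) (q := 2 * N / (N - 2)) :
  2 < N -> 0 <= K -> 0 <= g -> 0 <= A ->
  measurable_fun setT al -> measurable_fun setT be -> measurable_fun setT om ->
  (forall x, 0 <= al x) -> (forall x, 0 <= be x) -> (forall x, 0 <= om x) ->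
  (\int[mu]_x (al x ^+ 2)%:E <= A%:E)%E ->
  (\int[mu]_x (be x `^ N)%:E <= (K `^ N)%:E)%E ->
  (\int[mu]_x (om x `^ q)%:E <= (g `^ q * A `^ (q / 2))%:E)%E ->
  (\int[mu]_x (be x * al x * om x)%:E <= (K * g * A)%:E)%E.
Proof.
move=> N2 K0 g0 A0 mal mbe mom al0 be0 om0 iA iB iW.
have N0 : 0 < N by lra.
have Nn : N != 0 by rewrite gt_eqF.
have N2n : N - 2 != 0 by rewrite gt_eqF// subr_gt0.
have mpow (f : T -> R) r : measurable_fun setT f -> measurable_fun setT (fun x =>
  (f x `^ r)%:E).
  by move=> mf; apply/measurable_EFinP; exact: (measurableT_comp (measurable_powR r) mf).
have ineq (x y : \bar R) r : 0 <= r -> (0 <= x)%E -> (x <= y)%E -> (x `^ r <= y `^ r)%E.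
  by move=> r0 x0 xy; apply: gt0_ler_poweR; rewrite // in_itv/= leey ?(le_trans x0)//.
have qN : q * (1 - 2 / N) = 2 by rewrite /q; field; rewrite N2n Nn.
have th : 0 < 2 / N < 1 by rewrite divr_gt0//= ltr_pdivrMr// mul1r.
have B2 : (\int[mu]_x ((be x * om x) ^+ 2)%:E <= ((K * g) ^+ 2 * A)%:E)%E.
  have := holder_poweR mu th (mpow om q mom) (mpow be N mbe) (fun x =>
    powR_ge0 _ _) (fun x => powR_ge0 _ _).
  have -> : (\int[mu]_x ((om x `^ q)%:E `^ (1 - 2 / N) * (be x `^ N)%:E `^ (2 / N)) =
    \int[mu]_x ((be x * om x) ^+ 2)%:E)%E.
    apply: eq_integral => x _; rewrite !poweR_EFin -EFinM; congr EFin.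
    rewrite -!powRrM qN (mulrC N) divfK// exprMn mulrC.
    by rewrite -!powR_mulrn.
  move=> /le_trans; apply.
  apply: (@le_trans _ _ ((g `^ q * A `^ (q / 2))%:E `^ (1 - 2 / N) * ((K `^ N)%:E `^ (2 /
    N)))%E).
    have [t0 t1] := andP th.
    apply: lee_pmul; rewrite ?poweR_ge0//; apply: ineq => //.
    - by rewrite subr_ge0 ltW.
    - by apply: integral_ge0 => x _; rewrite lee_fin powR_ge0.
    - exact: ltW.
    - by apply: integral_ge0 => x _; rewrite lee_fin powR_ge0.
  rewrite !poweR_EFin -EFinM lee_fin powRM ?powR_ge0//.
  rewrite -!powRrM qN (mulrC N) divfK// (_ : q / 2 * (1 - 2 / N) = 1);
    last by rewrite mulrAC qN divff.
  by rewrite powRr1// !powR_mulrn// exprMn le_eqVlt; apply/orP; left; apply/eqP; ring.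
have h1 : 1 - 2^-1 = 2^-1 :> R by lra.
have th2 : 0 < (2^-1 : R) < 1 by apply/andP; split; lra.
have msq (f : T -> R) : measurable_fun setT f -> measurable_fun setT (fun x =>
  (f x ^+ 2)%:E).
  by move=> mf; apply/measurable_EFinP; exact: measurable_funX.
have := holder_poweR mu th2 (msq al mal) (msq (fun x =>
  be x * om x) (measurable_funM mbe mom)) (fun x => sqr_ge0 _) (fun x => sqr_ge0 _).
have -> : (\int[mu]_x ((al x ^+ 2)%:E `^ (1 - 2^-1) * ((be x * om x) ^+ 2)%:E `^ 2^-1) =
  \int[mu]_x (be x * al x * om x)%:E)%E.
  apply: eq_integral => x _; rewrite h1 !poweR_EFin -EFinM; congr EFin.
  rewrite !powR12_sqrt ?sqr_ge0// !sqrtr_sqr !ger0_norm ?mulr_ge0//; ring.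
move=> /le_trans; apply; rewrite h1.
apply: (@le_trans _ _ (A%:E `^ 2^-1 * ((K * g) ^+ 2 * A)%:E `^ 2^-1)%E).
  apply: lee_pmul; rewrite ?poweR_ge0//; apply: ineq; rewrite ?invr_ge0//.
    by apply: integral_ge0 => x _; rewrite lee_fin sqr_ge0.
  by apply: integral_ge0 => x _; rewrite lee_fin sqr_ge0.
rewrite !poweR_EFin -EFinM lee_fin powRM ?sqr_ge0// [X in _ * (X * _)]powR12_sqrt
  ?sqr_ge0//.
rewrite sqrtr_sqr ger0_norm ?mulr_ge0// mulrCA -powRD ?h1; last by rewrite gt_eqF.
by rewrite (_ : 2^-1 + 2^-1 = 1) ?powRr1//; lra.
Qed.

Lemma fatou_le (D : set T) (mD : measurable D) (f_ : nat -> T -> R) (f : T ->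
  R) (C : \bar R) :
  (forall k, measurable_fun D (f_ k)) -> (forall k x, 0 <= f_ k x) ->
  (forall x, D x -> (fun k => f_ k x) @ \oo --> f x) ->
  (forall k, (\int[mu]_(x in D) (f_ k x)%:E <= C)%E) ->
  (\int[mu]_(x in D) (f x)%:E <= C)%E.
Proof.
move=> mf f0 fc fC.
have mf' k : measurable_fun D (fun x => (f_ k x)%:E) by exact/measurable_EFinP.
have f0' k x : D x -> (0 <= (f_ k x)%:E)%E by rewrite lee_fin.
rewrite (_ : (\int[mu]_(x in D) _ = \int[mu]_(x in D) limn_einf (fun k => (f_ k x)%:E))%E);
  last first.
  apply: eq_integral => x; rewrite inE => Dx; apply/esym.
  have := @cvg_limn_einf_sup R (fun k => (f_ k x)%:E) (f x)%:E.
  by case=> //; apply: cvg_EFin; [exact: nearW|exact: fc].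
apply: (le_trans (fatou mu mD mf' f0')).
rewrite limn_einf_lim; apply: lime_le; first exact: is_cvg_einfs.
apply: nearW => k; apply: le_trans (fC k).
by apply: ereal_inf_lbound; exists k => /=.
Qed.

End holder_three.

(** * The energy estimate and its absorption *)

Section maximum_principle.
Variables (R : realType) (n : nat).
Hypothesis n3 : (3 <= n)%N.
Local Notation D := (@unit_ball R n).
Local Notation mu := (lebesgue_rV R n).
Local Notation L2 := (square_integrable mu D).
Local Notation q := (sobolev_exp R n).
Local Notation g := (sobolev_cst R n).
Let mD : measurable D := @measurable_unit_ball R n.
Let Dy : (mu D < +oo)%E := @unit_ball_fin R n.

Lemma nr_ge3 : 3 <= n%:R :> R. Proof. by rewrite ler_nat. Qed.

Lemma sobolev_cst_gt0 : 0 < g.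
Proof.
by have := nr_ge3 => H; rewrite /sobolev_cst divr_gt0 ?mulr_gt0 ?subr_gt0//; lra.
Qed.

Lemma sobolev_exp_gt0 : 0 < q.
Proof.
by have := nr_ge3 => H; rewrite /sobolev_exp divr_gt0 ?mulr_gt0 ?subr_gt0//; lra.
Qed.

Lemma integral_patch (f : 'rV[R]_n -> R) (h : R -> R) : h 0 = 0 ->
  (\int[mu]_x (h ((f \_ D) x))%:E = \int[mu]_(x in D) (h (f x))%:E)%E.
Proof.
move=> h0; rewrite [RHS]integral_mkcond; apply: eq_integral => x _; rewrite !patchE.
by case: ifP => // _; rewrite h0.
Qed.

Lemma vLp_norm_le (b : 'rV[R]_n -> 'rV[R]_n) (K : R) : 0 <= K ->
  (vLp_norm D n%:R b <= K%:E)%E ->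
  (\int[mu]_(x in D) (enorm (b x) `^ n%:R)%:E <= (K `^ n%:R)%:E)%E.
Proof.
have n0 : 0 < n%:R :> R by have := nr_ge3; lra.
move=> K0 bK; rewrite -(@integral_patch (fun x => enorm (b x)) (fun t =>
  t `^ n%:R)) ?powR0 ?gt_eqF//.
rewrite (_ : (\int[mu]_x _ = 'N[mu]_(n%:R%:E)[EFin \o ((fun x =>
  enorm (b x)) \_ D)] `^ n%:R)%E).
  rewrite -[in leRHS]poweR_EFin; apply: gt0_ler_poweR; first exact: ltW.
  - by rewrite in_itv/= leey Lnorm_ge0.
  - by rewrite in_itv/= leey andbT lee_fin.
  - exact: bK.
rewrite (powR_Lnorm _ _ (lt0r_neq0 n0)); apply: eq_integral => x _; rewrite poweR_EFin.
by rewrite ger0_norm// patchE; case: ifP => // _; exact: enorm_ge0.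
Qed.

(** The ball has finite measure and |b|^2 <= 1 + |b|^n as n >= 2. Hence the product of the drift
    with a square-integrable gradient is integrable. *)
Lemma drift_L2 (b : 'rV[R]_n -> 'rV[R]_n) (K : R) :
  (forall i, measurable_fun D (fun x => b x ord0 i)) ->
  (\int[mu]_(x in D) (enorm (b x) `^ n%:R)%:E <= K%:E)%E ->
  L2 (fun x => enorm (b x)).
Proof.
move=> mb bK; have meb : measurable_fun D (fun x => enorm (b x)) by exact: measurable_enorm.
split=> //.
have mbn : measurable_fun D (fun x => enorm (b x) `^ n%:R).
  exact: (measurableT_comp (measurable_powR _) meb).
have ibn : mu.-integrable D (EFin \o (fun x => enorm (b x) `^ n%:R)).
  apply/integrableP; split; first exact/measurable_EFinP.
  rewrite (le_lt_trans _ (le_lt_trans bK (ltry _)))// le_eqVlt; apply/orP; left; apply/eqP.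
  by apply: eq_integral => x _ /=; rewrite ger0_norm ?powR_ge0.
have i1 : mu.-integrable D (EFin \o (fun _ : 'rV[R]_n => 1 : R)).
  by apply: (@bounded_integrable R n (fun=> 1) 1) => // x; rewrite normr1.
have i2 : mu.-integrable D (EFin \o (fun x => 1 + enorm (b x) `^ n%:R)).
  exact: (integrableD mD i1 ibn).
apply: (dominated_integrable mD _ i2); first exact: measurable_funX.
apply: aeW => x _; rewrite ger0_norm ?sqr_ge0//.
have [e1|e1] := leP (enorm (b x)) 1.
  by rewrite (@le_trans _ _ 1)// ?lerDl ?powR_ge0// exprn_ile1// enorm_ge0.
rewrite -powR_mulrn ?enorm_ge0// (@le_trans _ _ (enorm (b x) `^ n%:R))// ?lerDr//.
by apply: ler_powR; [exact: ltW|rewrite ler_nat (leq_trans _ n3)].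
Qed.

Lemma supersolution_ge_boundary (b : 'rV[R]_n -> 'rV[R]_n) (m : R) (u : 'rV[R]_n -> R) :
  vLp D n%:R b -> H1 D u -> weak_supersolution D b u -> trace_ge D u m ->
  (vLp_norm D n%:R b <= ((2 * g)^-1)%:E)%E ->
  {ae mu, forall x, D x -> m <= u x}.
Proof.
have g0 := sobolev_cst_gt0; have q0 := sobolev_exp_gt0; have nr3 := nr_ge3.
set K := (2 * g)^-1.
have K0 : 0 <= K by rewrite invr_ge0 mulr_ge0// ltW.
move=> hb hu hsup htr hbK.
rewrite /trace_ge in htr; set w := (fun x => - Num.min (u x - m) 0) in htr.
have w0 x : 0 <= w x by rewrite oppr_ge0 ge_min lexx orbT.
have hw : H1 D w by case: htr.
have [phi [Gam [tp G2 aeH]]] := H10_approx htr.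
have [gu2 wgu] := wgradP hu; have [gw2 wgw] := wgradP hw.
have u2 : L2 u by case: hu => /Lp2P.
have w2 : L2 w by case: hw => /Lp2P.
have mw : measurable_fun D w by case: w2.
(* Constants are written [c * 1] to match [weak_grad_smooth], which supplies their weak gradient. *)
have one2 (c : R) : L2 (fun=> c * 1) by apply: (@square_integrable_bounded _ _ _ _ _ _ _
  `|c|) => // x; rewrite mulr1.
have sm1 : smooth (fun _ : 'rV[R]_n => 1 : R) by move=> k; exact: Ck_cst.
have gr1 x : grad (fun _ : 'rV[R]_n => 1 : R) x = 0.
  by apply/rowP => i; rewrite !mxE /partial derive_cst.
(* [weak_grad_disjoint] with z = u + w - m: either u <= m and z = 0, or u > m and w = 0. *)
have loc : {ae mu, forall x, D x -> 0 < w x -> wgrad D u x = - wgrad D w x}.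
  have wz := weak_gradD u2 w2 gu2 gw2 wgu wgw.
  have guw2 i : L2 (fun x => (wgrad D u x + wgrad D w x) ord0 i).
    rewrite (_ : (fun _ => _) = (fun x => wgrad D u x ord0 i + wgrad D w x ord0 i)).
      exact: square_integrableD.
    by apply/funext => x; rewrite mxE.
  have gm2 i : L2 (fun x => (- m *: grad (fun _ : 'rV[R]_n => 1 : R) x) ord0 i).
    rewrite [X in square_integrable _ _ X](_ : _ = (fun=> 0 * 1)); first exact: one2.
    by apply/funext => x; rewrite gr1 scaler0 mxE mul0r.
  have wz' := weak_gradD (square_integrableD mD u2 w2) (one2 (- m)) guw2 gm2 wz
    (weak_grad_smooth (- m) sm1).
  have gz2 i : L2 (fun x => (wgrad D u x + wgrad D w x + - m *: grad (fun _ : 'rV[R]_n =>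
    1 : R) x) ord0 i).
    rewrite [X in square_integrable _ _ X](_ : _ = (fun x =>
      (wgrad D u x + wgrad D w x) ord0 i)); first exact: guw2.
    by apply/funext => x; rewrite gr1 scaler0 addr0.
  have := weak_grad_disjoint hw tp G2 aeH (square_integrableD mD (square_integrableD mD u2
    w2) (one2 (- m))) gz2 wz'.
  move=> /(_ _)H; apply: filterS (H _) => [x Hx Dx wx|x].
    by have := Hx Dx wx; rewrite gr1 scaler0 addr0 => /eqP; rewrite addr_eq0 => /eqP.
  rewrite mulr1 /w; have [um|um] := leP (u x - m) 0; last by right; rewrite oppr0.
  by left; ring.
have mb i : measurable_fun D (fun x => b x ord0 i) := Lp_measurable (hb i).
have bn := vLp_norm_le K0 hbK.
have b2 := drift_L2 mb bn.
have egw2 := enorm_L2 gw2; have egu2 := enorm_L2 gu2.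
have megw : measurable_fun D (fun x => enorm (wgrad D w x)) by case: egw2.
have ak (k : nat) : 0 < k.+1%:R :> R by [].
have mdt k : measurable_fun D (fun x => dtrunc k.+1%:R (w x)).
  by apply: (measurableT_comp _ mw); apply: continuous_measurable_fun;
    exact: continuous_dtrunc.
have mtr k : measurable_fun D (fun x => trunc k.+1%:R (w x)).
  by apply: (measurableT_comp _ mw); apply: continuous_measurable_fun;
    apply: continuous_trunc; rewrite gt_eqF.
(* The indicator of w > 0 is the limit of the slopes [dtrunc], whence its measurability; [A] is the
   length of the gradient restricted to that set. *)
pose s x : R := (0 < w x)%R%:R.
have ms : measurable_fun D s by apply: measurable_fun_cvg mdt _ => x _; exact: dtrunc_cvg.
have s01 x : 0 <= s x <= 1 by rewrite /s; case: (0 < w x); rewrite ?lexx ?ler01.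
pose A x := s x * enorm (wgrad D w x).
have A0 x : 0 <= A x by rewrite mulr_ge0 ?enorm_ge0//; case/andP: (s01 x).
have A2 : L2 A.
  by apply: (@square_integrableMl _ _ _ _ _ _ _ _ 1) => // x; case/andP: (s01 x) => ? ?;
    rewrite ger0_norm.
have mA : measurable_fun D A by case: A2.
pose E := \int[mu]_(x in D) (A x ^+ 2).
have E0 : 0 <= E by apply: Rintegral_ge0 => x _; exact: sqr_ge0.
have dts k x : 0 <= dtrunc k.+1%:R (w x) <= s x.
  have /andP[d0 d1] := dtrunc_bound (w x) (ak k); rewrite d0 /s.
  have [wx|wx] := ltP 0 (w x); first exact: d1.
  by rewrite dtrunc_le0//; exact: lexx.
(* Sobolev's inequality for [w] with the energy of {w > 0} alone: at each truncation level the slope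
   is at most [s], and Fatou's lemma removes the truncation. *)
have W : (\int[mu]_(x in D) (w x `^ q)%:E <= (g `^ q * E `^ (q / 2))%:E)%E.
  apply: (@fatou_le _ _ _ _ D mD (fun k x => trunc k.+1%:R (w x) `^ q)).
  - by move=> k; exact: (measurableT_comp (measurable_powR q) (mtr k)).
  - by move=> k x; exact: powR_ge0.
  - move=> x _; have cp : {for w x, continuous (fun t : R => `|t| `^ q)}
      by exact: continuous_powR_norm.
    have := continuous_cvg _ cp (trunc_cvg (w0 x)); rewrite (ger0_norm (w0 x)) => c2.
    rewrite (_ : (fun k => _) = fun k : nat => `|trunc k.+1%:R (w x)| `^ q);
      first exact: c2.
    by apply/funext => k; rewrite ger0_norm ?trunc_ge0.
  - move=> k; have := sobolev_limit hw tp G2 aeH (ak k) n3.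
    have it : mu.-integrable D (EFin \o (fun x => trunc k.+1%:R (w x) `^ q)).
      apply: measurable_bounded_integrable => //;
        first exact: (measurableT_comp (measurable_powR q) (mtr k)).
      exists (k.+1%:R `^ q); split; first exact: num_real.
      move=> y Cy x _ /=; rewrite (le_trans _ (ltW Cy))// ger0_norm ?powR_ge0//.
      by rewrite ge0_ler_powR ?nnegrE ?(ltW q0) ?trunc_ge0// trunc_lea.
    rewrite -[X in (X <= _)%E]fineK; last exact: integrable_fin_num.
    rewrite lee_fin => /le_trans; apply.
    apply: ler_wpM2l; first exact: powR_ge0.
    have q2 : 0 <= q / 2 by rewrite divr_ge0// ltW.
    apply: (ge0_ler_powR q2); rewrite ?nnegrE//.
      by apply: Rintegral_ge0 => x _; exact: sqr_ge0.
    apply: le_Rintegral => //.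
    + have dA : L2 (fun x => dtrunc k.+1%:R (w x) * enorm (wgrad D w x)).
        apply: (@square_integrableMl _ _ _ _ _ _ _ _ 1) => // x.
        by have /andP[? ?] := dtrunc_bound (w x) (ak k); rewrite ger0_norm.
      by case: dA.
    + by case: A2.
    + move=> x _; have /andP[d0 d1] := dts k x.
      have de0 : 0 <= dtrunc k.+1%:R (w x) * enorm (wgrad D w x)
        by rewrite mulr_ge0// enorm_ge0.
      by apply: lerXn2r; rewrite ?nnegrE//; apply: ler_wpM2r => //; exact: enorm_ge0.
have H3 : (\int[mu]_(x in D) (enorm (b x) * A x * w x)%:E <= (K * g * E)%:E)%E.
  have mr (f : 'rV[R]_n -> R) : measurable_fun D f -> measurable_fun setT (f \_ D).
    by move=> mf; exact/(measurable_restrictT f mD).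
  have r0 (f : 'rV[R]_n -> R) : (forall x, 0 <= f x) -> forall x, 0 <= (f \_ D) x.
    by move=> f0 x; rewrite patchE; case: ifP.
  have := @holder_three _ _ R mu (A \_ D) ((fun x => enorm (b x)) \_ D) (w \_ D) n%:R K g E.
  rewrite /= -[2 * n%:R / (n%:R - 2)]/q.
  rewrite (@integral_patch A (fun t => t ^+ 2)) ?expr0n// (@integral_patch (fun x =>
    enorm (b x)) (fun t => t `^ n%:R)); last by rewrite powR0// gt_eqF//; lra.
  rewrite (@integral_patch w (fun t => t `^ q)); last by rewrite powR0// gt_eqF.
  have -> : (\int[mu]_x (((fun x => enorm (b x)) \_ D) x * (A \_ D) x * (w \_ D) x)%:E =
    \int[mu]_(x in D) (enorm (b x) * A x * w x)%:E)%E.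
    rewrite [RHS]integral_mkcond; apply: eq_integral => x _; rewrite !patchE.
    by case: ifP => // _; rewrite !mul0r.
  apply => //.
  - lra.
  - exact: ltW.
  - exact: mr.
  - by apply: mr; case: b2.
  - exact: mr.
  - exact: r0.
  - by apply: r0 => x; exact: enorm_ge0.
  - exact: r0.
  - rewrite le_eqVlt; apply/orP; left; apply/eqP; rewrite /E /Rintegral fineK//.
    by apply: integrable_fin_num => //; case: A2.
have ibAw : mu.-integrable D (EFin \o (fun x => enorm (b x) * A x * w x)).
  apply/integrableP; split.
    apply/measurable_EFinP; apply: measurable_funM => //; apply: measurable_funM => //.
    by case: b2.
  rewrite (le_lt_trans _ (le_lt_trans H3 (ltry _)))// le_eqVlt; apply/orP; left; apply/eqP.
  by apply: eq_integral => x _ /=; rewrite ger0_norm// !mulr_ge0// enorm_ge0.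
have H3' : \int[mu]_(x in D) (enorm (b x) * A x * w x) <= K * g * E.
  by rewrite -lee_fin /Rintegral fineK//; exact: integrable_fin_num.
(* The supersolution is tested with the truncated approximants [phi j], and j tends to infinity at
   the fixed level k + 1. *)
have en k : 0 <= \int[mu]_(x in D) (dtrunc k.+1%:R (w x) * dotrV (wgrad D u x) (wgrad D w
  x)) +
     \int[mu]_(x in D) (dotrV (b x) (wgrad D u x) * trunc k.+1%:R (w x)).
  have ibg : mu.-integrable D (EFin \o (fun x => dotrV (b x) (wgrad D u x))).
    apply: (dominated_integrable mD _ (square_integrableM mD b2 egu2)).
      by apply: measurable_dotrV => // i; case: (gu2 i).
    by apply: aeW => x _; exact: dotrV_le_enorm.
  have c1 := energy_limit hw tp G2 aeH (ak k) gu2.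
  have c2 := drift_limit hw tp aeH (ak k) ibg.
  apply: (ler_cvg_to (cvg_cst (0 : R)) (cvgD c1 c2)).
  apply: nearW => j; apply: hsup; first exact: trunc_test.
  by move=> x; exact: trunc_ge0.
have en' k : \int[mu]_(x in D) (dtrunc k.+1%:R (w x) * enorm (wgrad D w x) ^+ 2) <= K * g *
  E.
  apply: le_trans H3'.
  have i1 : mu.-integrable D (EFin \o (fun x =>
    dtrunc k.+1%:R (w x) * enorm (wgrad D w x) ^+ 2)).
    have [_ i2] := egw2; apply: (dominated_integrable mD _ i2).
      by apply: measurable_funM => //; exact: measurable_funX.
    apply: aeW => x _; have /andP[d0 d1] := dtrunc_bound (w x) (ak k).
    by rewrite normrM !ger0_norm ?sqr_ge0// ler_piMl ?sqr_ge0.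
  have mdb (h : 'rV[R]_n -> 'rV[R]_n) : (forall i, L2 (fun x => h x ord0 i)) ->
      measurable_fun D (fun x => dotrV (b x) (h x) * trunc k.+1%:R (w x)).
    by move=> h2; apply: measurable_funM => //; apply: measurable_dotrV => // i;
      case: (h2 i).
  have mdN : measurable_fun D (fun x => - (dotrV (b x) (wgrad D w x) * trunc k.+1%:R (w
    x))).
    exact: (measurableT_comp (@oppr_measurable R setT) (mdb _ gw2)).
  have i3 : mu.-integrable D (EFin \o (fun x =>
    - (dotrV (b x) (wgrad D w x) * trunc k.+1%:R (w x)))).
    have ibk := integrableZr mD k.+1%:R (square_integrableM mD b2 egw2).
    apply: (dominated_integrable mD mdN (g := fun x =>
      enorm (b x) * enorm (wgrad D w x) * k.+1%:R)).
    - by move: ibk; congr (integrable _ _ _); apply/funext => x /=; rewrite EFinM.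
    - apply: aeW => x _; rewrite normrN normrM ler_pM// ?dotrV_le_enorm//.
      by rewrite ger0_norm ?trunc_ge0// trunc_lea.
  (* On w > 0 this is [loc]; on w <= 0 both integrands vanish with [dtrunc]. The drift term below is
     treated alike. *)
  have e1 : \int[mu]_(x in D) (dtrunc k.+1%:R (w x) * dotrV (wgrad D u x) (wgrad D w x)) =
      - \int[mu]_(x in D) (dtrunc k.+1%:R (w x) * enorm (wgrad D w x) ^+ 2).
    rewrite -mulN1r -RintegralZl//; congr fine; apply: ae_eq_integral => //.
    - apply/measurable_EFinP; apply: measurable_funM => //.
      by apply: measurable_dotrV => i; [case: (gu2 i)|case: (gw2 i)].
    - by apply/measurable_EFinP; apply: measurable_funM => //;
        apply: measurable_funM => //; exact: measurable_funX.
    - apply: filterS loc => x Hx Dx; congr EFin; have [wx|wx] := ltP 0 (w x).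
        rewrite Hx// enorm_sqr mulN1r -mulrN; congr (_ * _); rewrite /dotrV -sumrN.
        by apply: eq_bigr => i _; rewrite mxE mulNr.
      by rewrite dtrunc_le0// !mul0r mulr0.
  have := en k; rewrite e1 addrC subr_ge0 => /le_trans; apply.
  have -> : \int[mu]_(x in D) (dotrV (b x) (wgrad D u x) * trunc k.+1%:R (w x)) =
      \int[mu]_(x in D) - (dotrV (b x) (wgrad D w x) * trunc k.+1%:R (w x)).
    congr fine; apply: ae_eq_integral => //; try exact/measurable_EFinP.
      by apply/measurable_EFinP; exact: (mdb _ gu2).
    apply: filterS loc => x Hx Dx; congr EFin; have [wx|wx] := ltP 0 (w x).
      rewrite Hx// -mulNr; congr (_ * _); rewrite /dotrV -sumrN.
      by apply: eq_bigr => i _; rewrite mxE mulrN.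
    by rewrite trunc_le0// !mulr0 oppr0.
  (* Pointwise, Cauchy-Schwarz and [trunc <= w] bound the drift by the integrand of [H3], which no
     longer depends on the level. *)
  apply: le_Rintegral => // x _; have [wx|wx] := ltP 0 (w x); last first.
    by rewrite trunc_le0// mulr0 oppr0 !mulr_ge0// enorm_ge0.
  have sx : s x = 1 by rewrite /s wx.
  rewrite /A sx mul1r (le_trans (ler_norm _))// normrN normrM ler_pM// ?dotrV_le_enorm//.
  by rewrite ger0_norm ?trunc_ge0// trunc_let.
(* Second limit, in the truncation level: the slopes tend to [s], with |grad w|^2 as dominating
   function. *)
have EE : E <= K * g * E.
  have [|||||_ cE] := @Rdominated_convergence _ _ R mu D mD
    (fun k x => dtrunc k.+1%:R (w x) * enorm (wgrad D w x) ^+ 2) (fun x =>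
      A x ^+ 2) (fun x => enorm (wgrad D w x) ^+ 2).
  - by move=> k; apply: measurable_funM => //; exact: measurable_funX.
  - exact: measurable_funX.
  - apply: aeW => x _; rewrite exprMn (_ : s x ^+ 2 = s x); last by rewrite /s;
      case: (0 < w x); rewrite ?expr1n ?expr0n.
    by apply: cvgM; [exact: dtrunc_cvg|exact: cvg_cst].
  - by case: egw2.
  - apply: aeW => x _ k; have /andP[d0 d1] := dtrunc_bound (w x) (ak k).
    by rewrite normrM !ger0_norm ?sqr_ge0// ler_piMl ?sqr_ge0.
  by apply: (ler_cvg_to cE (cvg_cst (K * g * E))); exact: nearW.
(* The choice of [K] gives K g = 1 / 2, hence E <= E / 2. *)
have Ez : E = 0.
  have Kg : K * g = 2^-1 by rewrite /K invfM -mulrA mulVf ?mulr1// gt_eqF.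
  by apply/eqP; rewrite eq_le E0 andbT; move: EE; rewrite Kg; lra.
(* With E = 0 the bound [W] is 0, since q / 2 > 0; so [w], and with it the minimum of u - m and 0,
   vanishes almost everywhere in [D]. *)
have Wz : (\int[mu]_(x in D) `|(w x `^ q)%:E| = 0)%E.
  apply/eqP; rewrite eq_le; apply/andP; split; last exact: integral_ge0.
  under eq_integral do rewrite abse_EFin ger0_norm ?powR_ge0//.
  by move: W; rewrite Ez powR0 ?mulr0// gt_eqF// divr_gt0.
have mwq : measurable_fun D (fun x => (w x `^ q)%:E).
  by apply/measurable_EFinP; exact: (measurableT_comp (measurable_powR q) mw).
have /(ae_eq_integral_abs mu mD mwq) := Wz.
apply: filterS => x Hx Dx; have [/powR_eq0_eq0] := Hx Dx.
rewrite /w => /eqP; rewrite oppr_eq0 => /eqP mz.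
have : Num.min (u x - m) 0 <= u x - m by rewrite ge_min lexx.
by rewrite mz subr_ge0.
Qed.

End maximum_principle.

Theorem theorem1p5 (R : realType) (n : nat) (hn : (3 <= n)%N) :
  exists2 k : R, 0 < k &
    forall (b : 'rV[R]_n -> 'rV[R]_n) (m : R) (u : 'rV[R]_n -> R),
      vLp (@unit_ball R n) n%:R b ->
      0 < m ->
      H1 (@unit_ball R n) u ->
      weak_supersolution (@unit_ball R n) b u ->
      trace_ge (@unit_ball R n) u m ->
      (vLp_norm (@unit_ball R n) n%:R b <= k%:E)%E ->
      {ae (@lebesgue_rV R n), forall x, unit_ball x -> m <= u x}.
Proof.
have g0 := sobolev_cst_gt0 R hn.
exists (2 * sobolev_cst R n)^-1; first by rewrite invr_gt0 mulr_gt0.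
move=> b m u hb m0 hu hsup htr hbk.
exact: (supersolution_ge_boundary hn hb hu hsup htr hbk).
Qed.
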